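(* Let $M^3=I\times U$ carry the warped product metric $$ds^2=dx_1^2+f(x_1)^2\,(E\,dx_2^2+2F\,dx_2dx_3+G\,dx_3^2),$$ where $f=f(x_1)>0$ is a smooth function on $I$ and $E,F,G$ are smooth functions of $(x_2,x_3)\in U$ defining a Riemannian metric $E\,dx_2^2+2F\,dx_2dx_3+G\,dx_3^2$ on the fiber $U$, with Gaussian curvature $K$. (1) If $M^3$ can be isometrically embedded into $\mathbb{R}^4$ and $f''\neq 0$ everywhere, then the fiber is a space of positive constant curvature $K$, satisfying the inequality $K\geq f'^2$. (2) Conversely, if the fiber is a space of positive constant curvature $K$ satisfying $K>f'^2$, then $M^3$ can be locally isometrically embedded into $\mathbb{R}^4$ (each point has a neighborhood admitting an isometric embedding into $\mathbb{R}^4$), including around the points where $f''=0$.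
   Context: $I\subset\mathbb{R}$ is an open interval with coordinate $x_1$ and $U\subset\mathbb{R}^2$ is a connected open set with coordinates $(x_2,x_3)$ (the paper works locally, in simply connected coordinate neighborhoods). All maps and metrics are smooth. An isometric embedding is a smooth embedding pulling back the standard Euclidean metric to the given metric. $f'$, $f''$ denote derivatives with respect to $x_1$. *)

(* Defs.v *)
From HB Require Import structures.
From mathcomp Require Import all_boot all_order all_algebra.
From mathcomp Require Import all_classical all_reals all_analysis.

Set Implicit Arguments.
Unset Strict Implicit.
Unset Printing Implicit Defensive.

Import Order.TTheory GRing.Theory Num.Theory.
Import numFieldNormedType.Exports.

Local Open Scope classical_set_scope.
Local Open Scope ring_scope.

Section Smooth.
Context {R : realType} {V W : normedModType R}.

(* For finite-dimensional [V] this is the usual C^k class.  It is meant for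
   open [D], where none of the clauses depends on [f] outside [D]. *)
Fixpoint Ck (k : nat) (D : set V) (f : V -> W) : Prop :=
  if k is k'.+1 then
    (forall x, D x -> differentiable f x) /\
    (forall v : V, Ck k' D (fun x => 'D_v f x))
  else forall x, D x -> {for x, continuous f}.

Definition smooth_on (D : set V) (f : V -> W) : Prop := forall k, Ck k D f.

(* The continuous left inverse on the image says that [phi] is injective on
   [D] and a homeomorphism onto [phi @` D]. *)
Definition smooth_embedding (D : set V) (phi : V -> W) : Prop :=
  [/\ smooth_on D phi,
      forall p, D p -> injective ('d phi p) &
      exists2 psi : W -> V,
        (forall p, D p -> psi (phi p) = p) &
        {within phi @` D, continuous psi}].

End Smooth.

Section IsometricEmbedding.
Context {R : realType}.

Definition dot n (u v : 'rV[R]_n) : R := \sum_i u 0 i * v 0 i.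

(* [h p v w] is the value at [p] of the metric on the tangent vectors [v, w]. *)
Definition isometric_embedding {V : normedModType R} n (D : set V)
    (h : V -> V -> V -> R) (phi : V -> 'rV[R]_n) : Prop :=
  smooth_embedding D phi /\
  (forall p, D p -> forall v w : V, dot ('d phi p v) ('d phi p w) = h p v w).

Definition isometrically_embeddable {V : normedModType R} n (D : set V)
    (h : V -> V -> V -> R) : Prop :=
  exists phi : V -> 'rV[R]_n, isometric_embedding D h phi.

Definition locally_isometrically_embeddable {V : normedModType R} n (D : set V)
    (h : V -> V -> V -> R) : Prop :=
  forall p, D p -> exists N : set V,
    [/\ open N, N p, N `<=` D & isometrically_embeddable n N h].

End IsometricEmbedding.

(* [g q i j] is the coefficient g_ij at the point [q] of a coordinate domain
   in R^2. *)
Section Surface.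
Context {R : realType}.
Implicit Types (g : 'rV[R]_2 -> 'M[R]_2) (q : 'rV[R]_2) (i j k l : 'I_2).

Definition metric_form g q (u v : 'rV[R]_2) : R :=
  \sum_i \sum_j g q i j * u 0 i * v 0 j.

Definition partial i (a : 'rV[R]_2 -> R) q : R := 'D_(delta_mx 0 i) a q.

(* Gamma^k_ij of the Levi-Civita connection *)
Definition christoffel g k i j q : R :=
  2^-1 * \sum_l invmx (g q) k l *
    (partial i (fun y => g y j l) q + partial j (fun y => g y i l) q
     - partial l (fun y => g y i j) q).

(* Component along d_l of R(d_i, d_j) d_k, where
   R(X, Y) Z = nabla_X nabla_Y Z - nabla_Y nabla_X Z - nabla_[X,Y] Z. *)
Definition riemann g l k i j q : R :=
  partial i (christoffel g l j k) q - partial j (christoffel g l i k) q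
  + \sum_m (christoffel g l i m q * christoffel g m j k q
            - christoffel g l j m q * christoffel g m i k q).

(* <R(d_0, d_1) d_1, d_0> / det g, which is positive on round spheres *)
Definition gauss_curvature g q : R :=
  (\sum_l g q 0 l * riemann g l 1 0 1 q) / \det (g q).

(* E dx_2^2 + 2 F dx_2 dx_3 + G dx_3^2 *)
Definition fiber_metric (E F G : 'rV[R]_2 -> R) q : 'M[R]_2 :=
  \matrix_(i, j) if i == j then (if i == 0 then E q else G q) else F q.

(* dx_1^2 + f(x_1)^2 g, the base coordinate x_1 being the first component *)
Definition warped_metric (f : R -> R) g (p v w : R * 'rV[R]_2) : R :=
  v.1 * w.1 + f p.1 ^+ 2 * metric_form g p.2 v.2 w.2.

End Surface.

(* Main.v *)
(* Necessity. Along a hypersurface X of R^4 with X_t unit, the Gauss equations read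
   A h_ij - b_i b_j = - f f'' g_ij and det h = f^2 (K - f'^2) det g, where A, b_i,
   h_ij are the components of the second fundamental form, and the Codazzi equation
   gives b_j h_ik = b_k h_ij. Since f'' <> 0 this forces b = 0, hence
   K - f'^2 = (f'' / A)^2 > 0; moreover A^2 = |X_tt|^2 does not depend on the fiber
   coordinates, so K is constant.
   Sufficiency. If K is constant, the linear system of Gauss-Weingarten equations for
   a frame (y, d_0 y, d_1 y) with y on the sphere of radius 1/sqrt K is flat, so by
   Frobenius it has a local solution with prescribed Gram matrix. Then
   (f(t) y(q), H(t)) with H' = sqrt (1 - f'^2 / K) is the wanted immersion, and a
   mean value estimate makes it a local embedding. The Frobenius theorem itself is
   obtained by solving the system along rays and comparing neighbouring rays. *)
Require Import Defs.
From HB Require Import structures.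
From mathcomp Require Import all_boot all_order all_algebra.
From mathcomp Require Import all_classical all_reals all_analysis.
From mathcomp Require Import ring lra.
Set Implicit Arguments.
Unset Strict Implicit.
Unset Printing Implicit Defensive.
Import Order.TTheory GRing.Theory Num.Theory.
Import numFieldNormedType.Exports.
Local Open Scope classical_set_scope.
Local Open Scope ring_scope.

(** * Differential calculus of matrix-valued maps *)

(** In the necessity part no unit normal field is built: at each point the component along the
    normal line is chosen separately, up to sign. Whatever has to be differentiated is therefore
    phrased with inner products of derivatives of X: b = 0 becomes X_it = (f'/f) X_i, and A^2
    becomes the smooth function |X_tt|^2. In the Frobenius theorem the obstacle is dependence on
    parameters: the solution along each ray is picked by choice, with no regularity from ray to ray.
    A quadratic estimate for the difference of two neighbouring rays stands in for it; it yields
    differentiability and the system at once, and smoothness follows because the derivatives of a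
    solution are expressed through the solution itself. Differential inequalities are brought to the
    time interval [0, 1] with coefficient at most 1/2, by shrinking the neighbourhood, so that
    neither exponentials nor continuation of solutions are needed. The sufficiency part never
    divides by f'', hence points with f'' = 0 need no separate treatment. *)

Section Derive.
Context {R : realType}.
Implicit Types V W : normedModType R.

Lemma derive_comp_linear V V' W (l : {linear V' -> V}) (a : V -> W) x v :
  'D_v (a \o l) x = 'D_(l v) a (l x).
Proof.
rewrite /derive; set f := (X in lim (X @ _) = _); set g := (X in _ = lim (X @ _)).
suff -> : f = g by [].
by apply/funext => h; rewrite /f /g /= [l (_ + _)]linearP.
Qed.

Lemma derivable_comp_linear V V' W (l : {linear V' -> V}) (a : V -> W) x v :
  derivable a (l x) (l v) -> derivable (a \o l) x v.
Proof.
rewrite /derivable.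
set f := (X in cvg (X @ _) -> _); set g := (X in _ -> cvg (X @ _)).
suff -> : f = g by [].
by apply/funext => h; rewrite /f /g /= [l (_ + _)]linearP.
Qed.

Lemma is_derive_linear_comp V W W' (L : {linear W -> W'}) (f : V -> W) x v df :
  continuous L -> is_derive x v f df -> is_derive x v (L \o f) (L df).
Proof.
move=> Lc [] /cvg_ex [l fl] fE.
have dl : df = l by rewrite -fE; apply/cvg_lim.
have cv : (fun h => h^-1 *: (((L \o f) \o shift x) (h *: v) - (L \o f) x)) @ 0^' --> L l.
  have := cvg_comp _ _ fl (Lc l).
  apply: cvg_trans; apply: near_eq_cvg; near=> h => /=.
  by rewrite linearZ linearB.
by apply: DeriveDef; [apply/cvg_ex; exists (L l) | rewrite dl; apply/cvg_lim].
Unshelve. all: by end_near. Qed.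

Lemma is_derive_diff V W (f : V -> W) x v :
  differentiable f x -> is_derive x v f ('D_v f x).
Proof. by move=> /diff_derivable h; apply/derivableP/h. Qed.

Lemma is_derive_path V W (f : V -> W) p k (t : R) :
  differentiable f (p + t *: k) ->
  is_derive t 1 (fun s => f (p + s *: k)) ('D_k f (p + t *: k)).
Proof.
move=> df.
have E : (fun h => h^-1 *: (((fun s => f (p + s *: k)) \o shift t) h%:A -
      f (p + t *: k))) =
    (fun h => h^-1 *: ((f \o shift (p + t *: k)) (h *: k) - f (p + t *: k))).
  apply/funext => h /=; rewrite [h%:A]mulr1 scalerDl.
  by rewrite addrCA.
have := diff_derivable df (v := k); rewrite /derivable -E => cv.
by apply: DeriveDef => //; rewrite /derive E.
Qed.

Lemma mean_value_le (F dF : R -> R) (a b c : R) : a <= b ->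
  (forall x, x \in `]a, b[ -> is_derive x 1 F (dF x)) ->
  {within `[a, b], continuous F} ->
  (forall x, x \in `]a, b[ -> `|dF x| <= c) -> `|F b - F a| <= c * (b - a).
Proof.
move=> aleb dF' Fc lec; case: (ltgtP a b) aleb => // [ab _|-> _]; last first.
  by rewrite !subrr normr0 mulr0.
have [x xab ->] := MVT ab dF' Fc.
rewrite normrM (gtr0_norm (x := b - a)) ?subr_gt0//.
by rewrite ler_pM2r ?subr_gt0//; exact: lec.
Qed.

End Derive.

Section Entry.
Context (R : realType) (m n : nat) (i : 'I_m) (j : 'I_n).

Definition entry (M : 'M[R]_(m, n)) : R := M i j.

Fact entry_is_linear : linear entry.
Proof. by move=> a u v; rewrite /entry !mxE. Qed.

HB.instance Definition _ :=
  GRing.isLinear.Build R 'M[R]_(m, n) R *:%R entry entry_is_linear.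

End Entry.

Section MxCalculus.
Context {R : realType}.
Implicit Types V W : normedModType R.

Lemma is_derive_mxP V m n (M : V -> 'M[R]_(m, n)) x v dM :
  is_derive x v M dM <->
  forall i j, is_derive x v (fun y => M y i j) (dM i j).
Proof.
split=> [[Mx <-] i j|h].
  by apply: DeriveDef; [exact: (derivable_mxP _ _ _).1 | rewrite derive_mx// mxE].
have Mx : derivable M x v by apply/derivable_mxP => i j; have [] := h i j.
apply: DeriveDef => //; rewrite derive_mx//.
by apply/matrixP => i j; rewrite mxE; have [] := h i j.
Qed.

Lemma mx_entry_le m n (M : 'M[R]_(m, n)) i j : `|M i j| <= `|M|.
Proof.
rewrite [leRHS]/Num.Def.normr/= mx_normrE.
exact: (le_bigmax _ (fun ij => `|M ij.1 ij.2|) (i, j)).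
Qed.

Lemma mx_norm_leP m n (M : 'M[R]_(m, n)) c : 0 <= c ->
  (forall i j, `|M i j| <= c) -> `|M| <= c.
Proof.
move=> c0 h; rewrite [leLHS]/Num.Def.normr/= mx_normrE.
by rewrite (bigmax_le _ c0).
Qed.

(** The matrix norm is the largest absolute value of an entry, which is not submultiplicative: an
    entry of the product is a sum of [n] terms, whence the factor. *)
Lemma mx_norm_mul m n p (A : 'M[R]_(m, n)) (B : 'M[R]_(n, p)) :
  `|A *m B| <= n%:R * `|A| * `|B|.
Proof.
apply: mx_norm_leP; first by rewrite !mulr_ge0.
move=> i j; rewrite mxE (le_trans (ler_norm_sum _ _ _))//.
rewrite (le_trans (ler_sum _ (G := fun=> `|A| * `|B|) _))//.
  by move=> k _; rewrite normrM ler_pM// mx_entry_le.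
by rewrite sumr_const card_ord -mulrA mulr_natl.
Qed.

Lemma mx_norm_tr m n (A : 'M[R]_(m, n)) : `|A^T| = `|A|.
Proof.
apply/eqP; rewrite eq_le; apply/andP; split; apply: mx_norm_leP => // i j.
  by rewrite mxE mx_entry_le.
by have := mx_entry_le A^T j i; rewrite mxE.
Qed.

Lemma cvg_mxP T (F : set_system T) (FF : Filter F) m n (M : T -> 'M[R]_(m, n)) (l : 'M[R]_(m, n)) :
  (M @ F --> l) <-> forall i j, (fun x => M x i j) @ F --> l i j.
Proof.
split=> [h i j|h].
  exact: (cvg_comp _ _ h (@coord_continuous R m n i j l)).
apply/cvgrPdist_le => /= e e0; near=> x.
apply: mx_norm_leP; first exact: ltW.
near: x; apply: filter_forall => i; apply: filter_forall => j.
by have /cvgrPdist_le/(_ e e0) := h i j; apply: filterS => x; rewrite !mxE.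
Unshelve. all: by end_near. Qed.

Lemma continuous_mxP (T : topologicalType) m n (M : T -> 'M[R]_(m, n)) x :
  {for x, continuous M} <-> forall i j, {for x, continuous (fun y => M y i j)}.
Proof. exact: cvg_mxP. Qed.

Lemma continuous_mulmx (T : topologicalType) m n p (A : T -> 'M[R]_(m, n))
    (B : T -> 'M[R]_(n, p)) x :
  {for x, continuous A} -> {for x, continuous B} ->
  {for x, continuous (fun y => A y *m B y)}.
Proof.
move=> Ac Bc; apply/continuous_mxP => i j.
have -> : (fun y => (A y *m B y) i j) =
    \sum_k ((fun y => A y i k) * (fun y => B y k j)).
  by apply/funext => y; rewrite mxE fct_sumE.
apply: (big_ind (fun f : T -> R => {for x, continuous f})).
- exact: cst_continuous.
- by move=> f g fc gc; apply: continuousD.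
- move=> k _; apply: continuousM.
    by have := (continuous_mxP A x).1 Ac i k.
  by have := (continuous_mxP B x).1 Bc k j.
Qed.

Lemma is_derive_mulmx V m n p (A : V -> 'M[R]_(m, n)) (B : V -> 'M[R]_(n, p))
    x v dA dB :
  is_derive x v A dA -> is_derive x v B dB ->
  is_derive x v (fun y => A y *m B y) (dA *m B x + A x *m dB).
Proof.
move=> /is_derive_mxP hA /is_derive_mxP hB; apply/is_derive_mxP => i j.
have -> : (fun y => (A y *m B y) i j) =
    \sum_k ((fun y => A y i k) * (fun y => B y k j)).
  by apply/funext => y; rewrite mxE fct_sumE.
apply: is_derive_eq.
rewrite !mxE -big_split/=; apply: eq_bigr => k _.
by rewrite addrC; congr (_ + _); rewrite mulrC.
Qed.

Lemma mean_value_mx m n (F dF : R -> 'M[R]_(m, n)) (a b c : R) :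
  a <= b -> 0 <= c ->
  (forall x, x \in `]a, b[ -> is_derive x 1 F (dF x)) ->
  {within `[a, b], continuous F} ->
  (forall x, x \in `]a, b[ -> `|dF x| <= c) -> `|F b - F a| <= c * (b - a).
Proof.
move=> ab c0 dF' Fc lec; apply: mx_norm_leP => [|i j].
  by rewrite mulr_ge0 ?subr_ge0.
rewrite !mxE; apply: (mean_value_le (F := fun x => F x i j) (dF := fun x => dF x i j)) => //.
- by move=> x /dF' /is_derive_mxP.
- by move=> x; apply: ((continuous_mxP _ _).1 (Fc x)).
- by move=> x /lec; apply: le_trans; exact: mx_entry_le.
Qed.

Lemma mean_value_segment V m n (F : V -> 'M[R]_(m, n)) p k c :
  (forall s, 0 <= s <= 1 -> differentiable F (p + s *: k)) ->
  (forall s, 0 <= s <= 1 -> `|'D_k F (p + s *: k)| <= c) ->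
  `|F (p + k) - F p| <= c.
Proof.
move=> dF lec.
have c0 : 0 <= c by apply: le_trans (lec 0 _); rewrite ?lexx ?ler01.
have := @mean_value_mx m n (fun s => F (p + s *: k)) (fun s => 'D_k F (p + s *: k)) 0 1 c.
rewrite scale1r scale0r addr0 subr0 mulr1; apply => //.
- move=> s; rewrite in_itv /= => /andP[s0 s1].
  by apply: is_derive_path; apply: dF; rewrite !ltW.
- apply/derivable_within_continuous => s; rewrite in_itv /= => s01.
  by have [] := is_derive_path (dF _ s01).
- by move=> s; rewrite in_itv /= => /andP[s0 s1]; apply: lec; rewrite !ltW.
Qed.

End MxCalculus.

(** * Maps of class C^k *)

Section Differentiable.
Context {R : realType}.
Implicit Types V W : normedModType R.

(** Uniqueness of the differential turns an explicit first-order estimate with a candidate [L] into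
    differentiability; this is how the Frobenius solution gets its derivative. *)
Lemma is_diff_littleo V W (f : V -> W) (L : {linear V -> W}) x :
  continuous L ->
  (forall e, 0 < e -> \forall h \near 0, `|f (h + x) - f x - L h| <= e * `|h|) ->
  is_diff x f L.
Proof.
move=> Lc h.
have E : f \o shift x = cst (f x) + L +o_ (0 : V) id.
  apply/eqaddoP => _/posnumP[e]; near=> y.
  by rewrite /= !fctE opprD addrA; near: y; exact: h.
have dE := diff_unique Lc E.
by apply: DiffDef => //; apply/diff_locallyP; rewrite dE.
Unshelve. all: by end_near. Qed.

Lemma differentiable_littleo V W (f : V -> W) x : differentiable f x ->
  forall e, 0 < e ->
  \forall h \near 0, `|f (h + x) - f x - 'd f x h| <= e * `|h|.
Proof.
move=> /diff_locallyP [_ /eqaddoP E] e e0; near=> y.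
by rewrite -addrA -opprD; near: y; exact: (E _ e0).
Unshelve. all: by end_near. Qed.

Lemma near_eq_differentiable V W (f g : V -> W) x :
  (\forall y \near x, f y = g y) -> differentiable f x -> differentiable g x.
Proof.
move=> fg df; suff [] : is_diff x g ('d f x) by [].
apply: is_diff_littleo => [|e e0]; first exact: diff_continuous.
have := differentiable_littleo df e0.
have fg' : \forall h \near (0 : V), f (h + x) = g (h + x).
  have : \forall y \near (0 : V), (fun z => f z = g z) (y + x).
    by rewrite (near_shift x)/= sub0r; near=> y; rewrite /= addrNK; near: y.
  by [].
apply: filterS2 fg' => h ->; by rewrite (nbhs_singleton fg).
Unshelve. all: by end_near. Qed.

End Differentiable.

Section Ck.
Context {R : realType}.
Implicit Types V W : normedModType R.

(** As [D] is open, equality on [D] holds near each of its points and so passes to directional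
    derivatives. Most closure properties below compute a derivative on [D] only and conclude through
    this lemma. *)
Lemma Ck_eq V W k (D : set V) (f g : V -> W) : open D ->
  (forall x, D x -> f x = g x) -> Ck k D f -> Ck k D g.
Proof.
move=> oD; elim: k f g => [|k IH] f g fg /=.
  move=> fc x Dx; have := fc x Dx; rewrite /prop_for /continuous_at (fg x Dx).
  apply: cvg_trans; apply: near_eq_cvg; have : \near x, D x by exact: open_nbhs_nbhs.
  by apply: filterS.
have nfg x : D x -> \forall y \near x, f y = g y.
  by move=> Dx; have : \near x, D x by [exact: open_nbhs_nbhs]; apply: filterS.
move=> [df Df]; split=> [x Dx|v].
  exact: near_eq_differentiable (nfg x Dx) (df x Dx).
by apply: IH (Df v) => x Dx; apply: near_eq_derive; exact: nfg.
Qed.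

Lemma Ck_continuous V W k (D : set V) (f : V -> W) : Ck k D f ->
  forall x, D x -> {for x, continuous f}.
Proof.
by case: k => [|k] //= [df _] x /df; exact: differentiable_continuous.
Qed.

Lemma CkW V W k (D : set V) (f : V -> W) : Ck k.+1 D f -> Ck k D f.
Proof.
elim: k f => [|k IH] f; first exact: Ck_continuous.
by move=> [df Df]; split=> // v; apply: IH; exact: Df.
Qed.

Lemma Ck_sub V W k (D D' : set V) (f : V -> W) : D' `<=` D ->
  Ck k D f -> Ck k D' f.
Proof.
move=> sD; elim: k f => [|k IH] f /=; first by move=> h x /sD /h.
by move=> [df Df]; split=> [x /sD /df //|v]; apply: IH.
Qed.

Lemma Ck_cst V W k (D : set V) (w : W) : Ck k D (fun=> w).
Proof.
elim: k w => [|k IH] w /=; first by move=> x _; exact: cst_continuous.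
split=> [x _|v]; first exact: differentiable_cst.
suff -> : 'D_v (fun _ : V => w) = (fun=> 0) by exact: IH.
by apply/funext => x; rewrite derive_cst.
Qed.

Lemma CkD V W k (D : set V) (f g : V -> W) : open D ->
  Ck k D f -> Ck k D g -> Ck k D (fun x => f x + g x).
Proof.
move=> oD; elim: k f g => [|k IH] f g /=.
  by move=> fc gc x Dx; apply: continuousD; [exact: fc|exact: gc].
move=> [df Df] [dg Dg]; split=> [x Dx|v].
  by apply: differentiableD; [exact: df|exact: dg].
apply: Ck_eq (IH _ _ (Df v) (Dg v)) => // x Dx.
by rewrite deriveD//; apply: diff_derivable; [exact: df|exact: dg].
Qed.

Lemma Ck_linear_comp V W W' k (D : set V) (L : {linear W -> W'}) (f : V -> W) :
  open D -> continuous L -> Ck k D f -> Ck k D (L \o f).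
Proof.
move=> oD Lc; elim: k f => [|k IH] f /=.
  by move=> fc x Dx; apply: continuous_comp; [exact: fc|exact: Lc].
move=> [df Df]; split=> [x Dx|v].
  by apply: differentiable_comp; [exact: df|exact: linear_differentiable].
apply: Ck_eq (IH _ (Df v)) => // x Dx /=.
by have [_ ->] := is_derive_linear_comp Lc (is_derive_diff v (df x Dx)).
Qed.

Lemma Ck_comp_linear V V' W k (D : set V) (l : {linear V' -> V}) (f : V -> W) :
  continuous l -> Ck k D f -> Ck k (l @^-1` D) (f \o l).
Proof.
move=> lc; elim: k f => [|k IH] f /=.
  by move=> fc x Dx; apply: continuous_comp; [exact: lc|exact: fc].
move=> [df Df]; split=> [x Dx|v].
  by apply: differentiable_comp; [exact: linear_differentiable|exact: df].
rewrite (_ : (fun _ => _) = ('D_(l v) f) \o l); first exact: IH.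
by apply/funext => x; rewrite derive_comp_linear.
Qed.

Lemma Ck_linear V W k (D : set V) (L : {linear V -> W}) : continuous L ->
  Ck k D L.
Proof.
move=> Lc; case: k => [|k] /=; first by move=> x _; exact: Lc.
split=> [x _|v]; first exact: linear_differentiable.
rewrite (_ : (fun _ => _) = fun=> L v); first exact: Ck_cst.
apply/funext => x; rewrite deriveE; last exact: linear_differentiable.
by rewrite diff_lin.
Qed.

Lemma CkM V k (D : set V) (f g : V -> R) : open D ->
  Ck k D f -> Ck k D g -> Ck k D (fun x => f x * g x).
Proof.
move=> oD; elim: k f g => [|k IH] f g.
  by move=> fc gc x Dx; apply: continuousM; [exact: fc|exact: gc].
move=> Cf Cg; have [[df Df] [dg Dg]] := (Cf, Cg); split=> [x Dx|v].
  by apply: differentiableM; [exact: df|exact: dg].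
apply: (Ck_eq (f := fun x => f x * 'D_v g x + g x * 'D_v f x)) => // [x Dx|].
  by rewrite deriveM//; apply: diff_derivable; [exact: df|exact: dg].
by apply: CkD => //; [exact: IH (CkW Cf) (Dg v)|exact: IH (CkW Cg) (Df v)].
Qed.

(** Induction on [k]: the derivative -f'/f^2 contains 1/f undifferentiated, so the class already
    known for 1/f suffices. The square root is handled in the same way. *)
Lemma CkV V k (D : set V) (f : V -> R) : open D -> (forall x, D x -> f x != 0) ->
  Ck k D f -> Ck k D (fun x => (f x)^-1).
Proof.
move=> oD f0; elim: k => [|k IH].
  by move=> fc x Dx; apply: cvgV; [exact: f0|exact: fc].
move=> Cf; have [df Df] := Cf; split=> [x Dx|v].
  by apply: differentiableV; [exact: df|exact: f0].
have CV := IH (CkW Cf).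
apply: (Ck_eq (f := fun x => -1 * ((f x)^-1 * (f x)^-1) * 'D_v f x)) => // [x Dx|].
  rewrite deriveV ?f0//; last by apply: diff_derivable; exact: df.
  by rewrite mulN1r -invfM -expr2.
apply: CkM (Df v) => //; apply: (CkM (f := fun=> -1)) => //; first exact: Ck_cst.
exact: CkM.
Qed.

Lemma Ck_sqrt V k (D : set V) (f : V -> R) : open D -> (forall x, D x -> 0 < f x) ->
  Ck k D f -> Ck k D (fun x => Num.sqrt (f x)).
Proof.
move=> oD f0; elim: k => [|k IH].
  move=> fc x Dx; apply: (continuous_comp (fc x Dx)).
  exact: sqrt_continuous.
move=> Cf; have [df Df] := Cf.
have dsqrt x : D x -> is_derive (f x) 1 Num.sqrt (2 * Num.sqrt (f x))^-1.
  by move=> Dx; exact: is_derive1_sqrt (f0 x Dx).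
have dif x : D x -> differentiable Num.sqrt (f x).
  by move=> Dx; apply/derivable1_diffP; have [] := dsqrt x Dx.
split=> [x Dx|v].
  by apply: differentiable_comp; [exact: df|exact: dif].
have CV := IH (CkW Cf).
apply: (Ck_eq (f := fun x => (2 * Num.sqrt (f x))^-1 * 'D_v f x)) => // [x Dx|].
  rewrite [RHS]deriveE; last by apply: differentiable_comp; [exact: df|exact: dif].
  rewrite (@diff_comp _ _ _ _ f Num.sqrt)/=; [|exact: df|exact: dif].
  rewrite -(deriveE v (df x Dx)).
  rewrite (diff1E (dif x Dx)).
  by rewrite derive1E; have [_ ->] := dsqrt x Dx; rewrite mulrC.
apply: CkM (Df v) => //; apply: CkV => //.
  by move=> x Dx; rewrite mulf_neq0// sqrtr_eq0 -ltNge f0.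
by apply: (CkM (f := fun=> 2)) => //; exact: Ck_cst.
Qed.

Lemma Ck_sum V W k (D : set V) (I : Type) (s : seq I) (f : I -> V -> W) :
  open D -> (forall i, Ck k D (f i)) -> Ck k D (fun x => \sum_(i <- s) f i x).
Proof.
move=> oD Cf; elim: s => [|i s IH].
  apply: (Ck_eq (f := fun=> 0)) => // [x _|]; first by rewrite big_nil.
  exact: Ck_cst.
apply: (Ck_eq (f := fun x => f i x + \sum_(i <- s) f i x)) => // [x _|].
  by rewrite big_cons.
exact: CkD.
Qed.

Lemma CkZl V W k (D : set V) (f : V -> R) (w : W) : open D ->
  Ck k D f -> Ck k D (fun x => f x *: w).
Proof.
move=> oD Cf.
have lin : linear ( *:%R ^~ w : R -> W).
  by move=> a u v /=; rewrite scalerDl scalerA.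
pose lM := GRing.isLinear.Build _ _ _ _ _ lin.
pose L : {linear R -> W} := HB.pack ( *:%R ^~ w : R -> W) lM.
have Lc : continuous L by exact: scalel_continuous.
exact: (Ck_linear_comp oD Lc Cf).
Qed.

Lemma Ck_mxP V m n k (D : set V) (M : V -> 'M[R]_(m, n)) : open D ->
  Ck k D M <-> forall i j, Ck k D (fun x => M x i j).
Proof.
move=> oD; split=> [CM i j|CM].
  exact: (Ck_linear_comp (L := entry i j) oD (@coord_continuous R m n i j) CM).
apply: (Ck_eq (f := fun x => \sum_i \sum_j M x i j *: delta_mx i j)) => //.
  by move=> x _; rewrite -matrix_sum_delta.
by apply: Ck_sum => // i; apply: Ck_sum => // j; exact: CkZl.
Qed.

(** Schwarz's theorem through the second difference of [a] over a small square: two mean values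
    identify it with either mixed derivative at some point of the square, and continuity of both
    brings these points back to [x]. *)
Lemma Ck2_symmetric V (D : set V) (a : V -> R) u v x : open D -> D x ->
  Ck 2 D a -> 'D_u ('D_v a) x = 'D_v ('D_u a) x.
Proof.
move=> oD Dx Ca.
(* The mean value theorem is applied in direction [u'] to the difference of [a] along two parallel
   edges, then in direction [v']. *)
have square (u' v' : V) s : 0 < s ->
    (forall r t, 0 <= r <= s -> 0 <= t <= s -> D (x + r *: u' + t *: v')) ->
    exists r t, [/\ 0 <= r <= s, 0 <= t <= s &
      a (x + s *: u' + s *: v') - a (x + s *: u') - (a (x + s *: v') - a x) =
      s * s * 'D_v' ('D_u' a) (x + r *: u' + t *: v')].
  move=> s0 Ds; have [da /(_ u') [dDa _]] := Ca.
  have le0s : 0 <= (0 : R) <= s by rewrite lexx ltW.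
  have less : 0 <= s <= s by rewrite lexx ltW.
  have d1 r : 0 <= r <= s -> is_derive r 1
      (fun r => a ((x + s *: v') + r *: u') - a (x + r *: u'))
      ('D_u' a ((x + s *: v') + r *: u') - 'D_u' a (x + r *: u')).
    move=> rs; apply: is_deriveB; apply: is_derive_path; apply: da.
      by rewrite addrAC; exact: Ds.
    by have := Ds r 0 rs le0s; rewrite scale0r addr0.
  have itvW r : r \in `]0, s[ -> 0 <= r <= s.
    by rewrite in_itv/= => /andP[? ?]; rewrite !ltW.
  have [|r rs] := MVT_segment (ltW s0) (fun r rs => d1 r (itvW r rs)).
    apply/derivable_within_continuous => r; rewrite in_itv /= => rs.
    by have [] := d1 r rs.
  move: rs; rewrite in_itv/= => rs; rewrite !scale0r !addr0 subr0 => E1.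
  have d2 t : 0 <= t <= s -> is_derive t 1
      (fun t => 'D_u' a ((x + r *: u') + t *: v'))
      ('D_v' ('D_u' a) ((x + r *: u') + t *: v')).
    by move=> ts; apply: is_derive_path; apply: dDa; exact: Ds.
  have [|t ts] := MVT_segment (ltW s0) (fun t ts => d2 t (itvW t ts)).
    apply/derivable_within_continuous => t; rewrite in_itv /= => ts.
    by have [] := d2 t ts.
  move: ts; rewrite in_itv/= => ts; rewrite !scale0r !addr0 subr0 => E2.
  exists r, t; split => //; rewrite [x + s *: u' + _]addrAC E1.
  by rewrite [x + _ + r *: _]addrAC E2 -mulrA mulrC.
have [_ Da] := Ca.
have Ac : {for x, continuous ('D_v ('D_u a))} by have [_ /(_ v)] := Da u; apply.
have Bc : {for x, continuous ('D_u ('D_v a))} by have [_ /(_ u)] := Da v; apply.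
apply/eqP/negPn/negP => neq.
(* Half the supposed gap: two errors below [e] cannot add up to it. *)
pose e := `|'D_u ('D_v a) x - 'D_v ('D_u a) x| / 2.
have e0 : 0 < e by rewrite divr_gt0// normr_gt0 subr_eq0.
have : \forall y \near x, [/\ D y, `|'D_v ('D_u a) x - 'D_v ('D_u a) y| < e &
    `|'D_u ('D_v a) x - 'D_u ('D_v a) y| < e].
  have Dn : \near x, D x by exact: open_nbhs_nbhs.
  have An : \forall y \near x, `|'D_v ('D_u a) x - 'D_v ('D_u a) y| < e.
    by move/cvgrPdist_lt : Ac; apply.
  have Bn : \forall y \near x, `|'D_u ('D_v a) x - 'D_u ('D_v a) y| < e.
    by move/cvgrPdist_lt : Bc; apply.
  by apply: filterS3 Dn An Bn => y *; split.
move=> /nbhs_normP [d /= d0 hd].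
(* The [+ 1] keeps the divisor positive when [u] and [v] vanish; the final 2 keeps the square
   strictly inside the ball of radius [d]. *)
pose s := d / (`|u| + `|v| + 1) / 2.
have M0 : 0 < `|u| + `|v| + 1 by rewrite ltr_wpDl// addr_ge0.
have s0 : 0 < s by rewrite !divr_gt0.
have close (u' v' : V) r t : `|u'| + `|v'| = `|u| + `|v| ->
    0 <= r <= s -> 0 <= t <= s -> `|x - (x + r *: u' + t *: v')| < d.
  move=> E /andP[r0 rs] /andP[t0 ts].
  rewrite -addrA opprD addNKr normrN (le_lt_trans (ler_normD _ _))//.
  rewrite !normrZ !ger0_norm//.
  apply: (@le_lt_trans _ _ (s * (`|u'| + `|v'|))).
    by rewrite mulrDr lerD// ler_wpM2r.
  rewrite E; apply: (@le_lt_trans _ _ (s * (`|u| + `|v| + 1))).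
    by rewrite ler_pM2l// lerDl.
  by rewrite /s mulrAC divfK ?gt_eqF// ltr_pdivrMr// ltr_pMr// ltr1n.
have [|r1 [t1 [r1s t1s E1]]] := square u v s s0.
  by move=> r t rs ts; have [] := hd _ (close u v r t erefl rs ts).
have [|r2 [t2 [r2s t2s E2]]] := square v u s s0.
  by move=> r t rs ts; have [] := hd _ (close v u r t (addrC _ _) rs ts).
have [_ h1 _] := hd _ (close u v r1 t1 erefl r1s t1s).
have [_ _ h2] := hd _ (close v u r2 t2 (addrC _ _) r2s t2s).
have EE : 'D_v ('D_u a) (x + r1 *: u + t1 *: v) = 'D_u ('D_v a) (x + r2 *: v + t2 *: u).
  apply: (@mulfI _ (s * s)); first by rewrite mulf_neq0// gt_eqF.
  rewrite -E1 -E2 [x + s *: v + _]addrAC; ring.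
suff : `|'D_u ('D_v a) x - 'D_v ('D_u a) x| < e + e by rewrite /e -splitr ltxx.
rewrite -(subrKA ('D_u ('D_v a) (x + r2 *: v + t2 *: u))).
apply: le_lt_trans (ler_normD _ _) _; apply: ltrD; first exact: h2.
by rewrite -EE distrC; exact: h1.
Qed.

End Ck.

(** * Linear differential equations *)

Section Primitive.
Context {R : realType}.

(* The base point is -1 because the fundamental theorem of calculus is needed
   at 0, which must therefore be interior to the range of integration. *)
Definition primitive (g : R -> R) (t : R) : R :=
  Rintegral lebesgue_measure `[-1, t] g - Rintegral lebesgue_measure `[-1, 0] g.

Lemma primitive0 g : primitive g 0 = 0.
Proof. by rewrite /primitive subrr. Qed.

Lemma is_derive_primitive (g : R -> R) (t : R) : continuous g -> -1 < t ->
  is_derive t 1 (primitive g) (g t).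
Proof.
move=> gc t0.
have int : lebesgue_measure.-integrable `[-1, t + 1] (EFin \o g).
  apply: continuous_compact_integrable; first exact: segment_compact.
  exact: continuous_subspaceT.
have [dF FE] := continuous_FTC1_closed (ltr_pwDr ltr01 (lexx t)) int t0 (gc t).
rewrite derive1E in FE; rewrite -[g t]subr0; apply: is_deriveB.
by apply: DeriveDef.
Qed.

Definition primitive_mx m n (g : R -> 'M[R]_(m, n)) (t : R) : 'M[R]_(m, n) :=
  \matrix_(i, j) primitive (fun s => g s i j) t.

Lemma primitive_mx0 m n (g : R -> 'M[R]_(m, n)) : primitive_mx g 0 = 0.
Proof. by apply/matrixP => i j; rewrite !mxE primitive0. Qed.

Lemma is_derive_primitive_mx m n (g : R -> 'M[R]_(m, n)) (t : R) :
  continuous g -> -1 < t -> is_derive t 1 (primitive_mx g) (g t).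
Proof.
move=> gc t0; apply/is_derive_mxP => i j.
have -> : (fun y => primitive_mx g y i j) = primitive (fun s => g s i j).
  by apply/funext => y; rewrite mxE.
apply: is_derive_primitive => // s.
exact: ((continuous_mxP _ _).1 (gc s)).
Qed.

Lemma primitive_mx_le m n (g : R -> 'M[R]_(m, n)) (t c : R) : continuous g ->
  0 <= t -> 0 <= c -> (forall s, s \in `]0, t[ -> `|g s| <= c) ->
  `|primitive_mx g t| <= c * t.
Proof.
move=> gc t0 c0 gle.
have := @mean_value_mx _ _ _ (primitive_mx g) g 0 t c t0 c0.
have N1 (x : R) : 0 <= x -> -1 < x by apply: lt_le_trans; rewrite ltrN10.
rewrite primitive_mx0 !subr0; apply => //.
- by move=> x; rewrite in_itv/= => /andP[/ltW x0 _]; apply: is_derive_primitive_mx => //; exact: N1.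
- apply: derivable_within_continuous => x; rewrite in_itv/= => /andP[x0 _].
  by have [] := is_derive_primitive_mx gc (N1 x x0).
Qed.

End Primitive.

Section LinearODE.
Context {R : realType}.
Implicit Types t s b c : R.

(** At a point [c] where [|e|] is maximal on [0, 1], the mean value inequality gives |e c| <= |e c|
    / 2 + b, and the first term is absorbed. The coefficient 1/2 on an interval of length 1 replaces
    the usual exponential. *)
Lemma gronwall_half m n (e de : R -> 'M[R]_(m, n)) b : 0 <= b -> e 0 = 0 ->
  {within `[0, 1], continuous e} ->
  (forall t, t \in `]0, 1[ -> is_derive t 1 e (de t)) ->
  (forall t, t \in `]0, 1[ -> `|de t| <= 2^-1 * `|e t| + b) ->
  forall t, t \in `[0, 1] -> `|e t| <= 2 * b.
Proof.
move=> b0 e0 ec de' deb t t01.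
have nc : {within `[0, 1], continuous (fun t => `|e t|)}.
  by move=> s; apply: (continuous_comp (ec s)); exact: norm_continuous.
have [c c01 cmax] := EVT_max (ler01 : (0 : R) <= 1) nc.
move: (c01); rewrite in_itv /= => /andP[c0 c1].
have sub x : x \in `]0, c[ -> x \in `]0, 1[.
  by rewrite !in_itv/= => /andP[-> /lt_le_trans -> //].
have := @mean_value_mx _ _ _ e de 0 c (2^-1 * `|e c| + b) c0.
have b1 : 0 <= 2^-1 * `|e c| + b by rewrite addr_ge0// mulr_ge0// invr_ge0.
move=> /(_ b1 (fun x xc => de' x (sub x xc))).
have ec' : {within `[0, c], continuous e}.
  apply: continuous_subspaceW ec => x /=; rewrite !in_itv/= => /andP[-> /=].
  by move=> /le_trans; apply.
move=> /(_ ec').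
have h x : x \in `]0, c[ -> `|de x| <= 2^-1 * `|e c| + b.
  move=> xc; apply: le_trans (deb _ (sub x xc)) _; rewrite lerD2r.
  rewrite ler_pM2l ?invr_gt0//; apply: cmax.
  by have := sub x xc; rewrite !in_itv/= => /andP[? ?]; rewrite !ltW.
move=> /(_ h); rewrite e0 !subr0 => ce.
have ce' : `|e c| <= 2^-1 * `|e c| + b.
  by apply: (le_trans ce); rewrite ler_piMr.
apply: le_trans (cmax _ t01) _; lra.
Qed.

(* Freezes the time outside [0, 1], so that maps defined only there become
   continuous on the whole line. *)
Definition clamp t : R := if t <= 0 then 0 else if t <= 1 then t else 1.

Lemma clamp_itv t : 0 <= clamp t <= 1.
Proof.
rewrite /clamp; case: (leP t 0) => ?; case: (leP t 1) => ?; apply/andP; split; lra.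
Qed.

Lemma clamp_id t : 0 <= t <= 1 -> clamp t = t.
Proof.
move=> /andP[t0 t1]; rewrite /clamp t1; case: (leP t 0) => // t0'.
by apply/eqP; rewrite eq_le t0.
Qed.

Lemma clamp_continuous : continuous clamp.
Proof.
have lip s t : `|clamp s - clamp t| <= `|s - t|.
  have [st|st] := lerP t s; rewrite ler_norml /clamp;
    case: (leP s 0) => ?; case: (leP t 0) => ?;
    case: (leP s 1) => ?; case: (leP t 1) => ?; apply/andP; split; lra.
move=> t; apply/cvgrPdist_lt => e e0; near=> s.
apply: le_lt_trans (lip _ _) _; near: s.
by have /cvgrPdist_lt := @cvg_id _ (nbhs t); apply.
Unshelve. all: by end_near. Qed.

(** * Picard iteration for linear systems with small coefficients *)

Section Picard.
Variables (n p : nat) (B : R -> 'M[R]_n) (w0 : 'M[R]_(n, p)).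
Implicit Types u v : R -> 'M[R]_(n, p).
Hypothesis Bc : continuous B.
Hypothesis B_small : forall t, 0 <= t <= 1 -> n%:R * `|B t| <= 2^-1.

(** Integral form of u' = B u, u(0) = w0. Clamping the upper bound makes the result continuous on
    the whole line, while estimates involve only times in [0, 1]. *)
Definition picard (u : R -> 'M[R]_(n, p)) t : 'M[R]_(n, p) :=
  w0 + primitive_mx (fun s => B s *m u s) (clamp t).

Lemma picard_integrand_continuous u : continuous u -> continuous (fun s => B s *m u s).
Proof. by move=> uc s; apply: continuous_mulmx; [exact: Bc|exact: uc]. Qed.

Lemma primitive_continuous g t : continuous g -> -1 < t ->
  {for t, continuous (primitive_mx g : R -> 'M[R]_(n, p))}.
Proof.
move=> gc t1; apply: differentiable_continuous; apply/derivable1_diffP.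
by have [] := is_derive_primitive_mx gc t1.
Qed.

Lemma clamp_gtN1 t : -1 < clamp t.
Proof. by have /andP[+ _] := clamp_itv t; apply: lt_le_trans; rewrite ltrN10. Qed.

Lemma picard_continuous u : continuous u -> continuous (picard u).
Proof.
move=> uc t; apply: (@continuousD _ _ _ (cst w0)
  (fun t => primitive_mx (fun s => B s *m u s) (clamp t))).
  exact: cst_continuous.
apply: continuous_comp; first exact: clamp_continuous.
exact: primitive_continuous (picard_integrand_continuous uc) (clamp_gtN1 t).
Qed.

(** The ratio 1/2 is the bound [B_small], integrated over a time at most 1. *)
Lemma picard_contraction u v c : 0 <= c -> continuous u -> continuous v ->
  (forall t, `|u t - v t| <= c) ->
  forall t, `|picard u t - picard v t| <= c / 2.
Proof.
move=> c0 uc vc uv t; rewrite /picard opprD addrACA subrr add0r.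
have /andP[s0 s1] := clamp_itv t; set s := clamp t in s0 s1 *.
pose F (x : R) := primitive_mx (fun s => B s *m u s) x - primitive_mx (fun s => B s *m v s) x.
have d (x : R) : -1 < x -> is_derive x 1 F (B x *m u x - B x *m v x).
  by move=> x1; apply: is_deriveB; apply: is_derive_primitive_mx => //;
    exact: picard_integrand_continuous.
have N1 (x : R) : 0 <= x -> -1 < x by apply: lt_le_trans; rewrite ltrN10.
have := @mean_value_mx _ _ _ F (fun x => B x *m u x - B x *m v x) 0 s (c / 2) s0.
rewrite [F 0]/F !primitive_mx0 !subr0 => h.
apply: (@le_trans _ _ (c / 2 * s)); last by rewrite ler_piMr// divr_ge0.
apply: h.
- by rewrite divr_ge0.
- by move=> x; rewrite in_itv/= => /andP[/ltW x0 _]; apply: d; exact: N1.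
- apply: derivable_within_continuous => x; rewrite in_itv/= => /andP[x0 _].
  by have [] := d x (N1 x x0).
- move=> x; rewrite in_itv/= => /andP[/ltW x0 /ltW xs]; rewrite -mulmxBr.
  apply: le_trans (mx_norm_mul _ _) _; rewrite mulrC.
  by apply: ler_pM => //; apply: B_small; rewrite x0 (le_trans xs).
Qed.

Let u_ k := iter k picard (fun=> w0).

Lemma picard_iter_continuous k : continuous (u_ k).
Proof.
elim: k => [|k IH]; first by move=> t; exact: cst_continuous.
exact: picard_continuous.
Qed.

Let c0 := `|w0|.

Lemma picard_iter_step k t : `|u_ k.+1 t - u_ k t| <= c0 / 2 ^+ k.
Proof.
elim: k t => [|k IH] t.
  rewrite /u_/= /picard addrC addKr expr0 divr1.
  have /andP[s0 s1] := clamp_itv t.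
  have c2 : 0 <= c0 / 2 by rewrite divr_ge0 ?normr_ge0.
  apply: (@le_trans _ _ (c0 / 2 * clamp t)); last first.
    apply: (@le_trans _ _ (c0 / 2)); first by rewrite ler_piMr.
    by rewrite ler_pdivrMr// ler_peMr ?normr_ge0// ler1n.
  apply: primitive_mx_le => //.
    by apply: picard_integrand_continuous => s; exact: cst_continuous.
  move=> x; rewrite in_itv/= => /andP[/ltW x0 /ltW xs].
  apply: le_trans (mx_norm_mul _ _) _; rewrite mulrC.
  by apply: ler_pM => //; apply: B_small; rewrite x0 (le_trans xs).
rewrite exprSr invfM mulrA.
have c1 : 0 <= c0 / 2 ^+ k by rewrite mulr_ge0 ?normr_ge0// invr_ge0 exprn_ge0.
exact: (picard_contraction c1 (@picard_iter_continuous k.+1) (@picard_iter_continuous k) IH).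
Qed.

Lemma picard_iter_dist k l t : `|u_ (k + l) t - u_ k t| <= c0 * 2 / 2 ^+ k.
Proof.
(* Strengthened so that the induction on [l] telescopes the geometric bounds of the single steps. *)
suff h : `|u_ (k + l) t - u_ k t| <= c0 * 2 / 2 ^+ k - c0 * 2 / 2 ^+ (k + l).
  by apply: (le_trans h); rewrite gerBl !mulr_ge0 ?normr_ge0// invr_ge0 exprn_ge0.
elim: l => [|l IH]; first by rewrite addn0 !subrr normr0.
rewrite addnS -(subrKA (u_ (k + l) t)).
apply: (le_trans (ler_normD _ _)); apply: (le_trans (lerD (picard_iter_step _ _) IH)).
rewrite exprSr invfM; set X := (2 ^+ (k + l))^-1; lra.
Qed.

Lemma geometric_small e : 0 < e -> exists k, c0 * 2 / 2 ^+ k < e.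
Proof.
move=> e0; have := @cvg_geometric R (c0 * 2) (2^-1).
rewrite ger0_norm ?invr_ge0// invf_lt1// ltr1n => /(_ isT).
move=> /cvgrPdist_lt /(_ e e0) [k _ /(_ k (leqnn k))] /=.
rewrite sub0r normrN ger0_norm; last by rewrite !mulr_ge0 ?normr_ge0// exprn_ge0// invr_ge0.
by rewrite exprVn => h; exists k.
Qed.

Lemma picard_iter_cvg t i j : cvgn (fun k => u_ k t i j).
Proof.
apply/cauchy_cvgP/cauchy_exP => e e0; have [k hk] := geometric_small e0.
exists (u_ k t i j); exists k => // l /= kl.
rewrite -ball_normE /= distrC; apply: le_lt_trans hk.
rewrite -(subnKC kl); apply: le_trans (picard_iter_dist k (l - k) t).
by have := mx_entry_le (u_ (k + (l - k)) t - u_ k t) i j; rewrite !mxE.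
Qed.

Let U t : 'M[R]_(n, p) := \matrix_(i, j) limn (fun k => u_ k t i j).

(** Limit of [picard_iter_dist] as [l] grows. The bound does not depend on [t], so the entrywise
    limits are uniform in time, which gives continuity of the limit. *)
Lemma picard_limit_dist k t : `|U t - u_ k t| <= c0 * 2 / 2 ^+ k.
Proof.
have ge0 : 0 <= c0 * 2 / 2 ^+ k by rewrite !mulr_ge0 ?normr_ge0// invr_ge0 exprn_ge0.
apply: mx_norm_leP => // i j; rewrite !mxE.
apply/ler_addgt0Pr => e e0.
have /cvgrPdist_lt/(_ e e0) [l _ hl] := @picard_iter_cvg t i j.
have := hl (k + l)%N (leq_addl _ _) => /= h.
rewrite -(subrKA (u_ (k + l) t i j)) (le_trans (ler_normD _ _))// [leRHS]addrC.
apply: lerD; first exact: ltW.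
apply: le_trans (picard_iter_dist k l t).
by have := mx_entry_le (u_ (k + l) t - u_ k t) i j; rewrite !mxE.
Qed.

Lemma picard_limit_continuous : continuous U.
Proof.
move=> t; apply/cvgrPdist_lt => e e0.
have [k hk] := geometric_small (divr_gt0 e0 (ltr0Sn _ 2)).
near=> s.
rewrite -(subrKA (u_ k t)) -[X in _ + X](subrKA (u_ k s)).
have -> : e = e / 3 + (e / 3 + e / 3) by field.
rewrite (le_lt_trans (ler_normD _ _))// ltrD//.
  exact: le_lt_trans (picard_limit_dist _ _) hk.
rewrite (le_lt_trans (ler_normD _ _))// ltrD//.
  near: s; have /cvgrPdist_lt := @picard_iter_continuous k t; apply.
  by rewrite divr_gt0.
by rewrite distrC; exact: le_lt_trans (picard_limit_dist _ _) hk.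
Unshelve. all: by end_near. Qed.

Lemma picard_limit_fixed t : U t = picard U t.
Proof.
apply/eqP; rewrite -subr_eq0 -normr_le0; apply/ler_addgt0Pr => e e0.
rewrite add0r; have [k hk] := geometric_small e0.
rewrite -(subrKA (u_ k.+1 t)) (le_trans (ler_normD _ _))//.
apply: le_trans (ltW hk).
have h1 := picard_limit_dist k.+1 t.
have h2 : `|u_ k.+1 t - picard U t| <= c0 * 2 / 2 ^+ k / 2.
  have c1 : 0 <= c0 * 2 / 2 ^+ k.
    by rewrite !mulr_ge0 ?normr_ge0// invr_ge0 exprn_ge0.
  apply: (picard_contraction c1 (@picard_iter_continuous k) picard_limit_continuous) => s.
  by rewrite distrC; exact: picard_limit_dist.
apply: (le_trans (lerD h1 h2)); rewrite exprSr invfM; set X := (2 ^+ k)^-1; lra.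
Qed.

(** The equation is claimed on the open interval only, since the clamped integral may have corners
    at 0 and 1. *)
Lemma linear_ode : exists u : R -> 'M[R]_(n, p), [/\ u 0 = w0, continuous u &
  forall t, t \in `]0, 1[ -> is_derive t 1 u (B t *m u t)].
Proof.
exists U; split; [|exact: picard_limit_continuous|].
  by rewrite picard_limit_fixed /picard clamp_id ?lexx ?ler01// primitive_mx0 addr0.
move=> t; rewrite in_itv/= => t01; have /andP[t0 t1] := t01.
apply: (@near_eq_is_derive _ _ _
  (cst w0 + primitive_mx (fun s => B s *m U s))).
  have : \forall s \near t, s \in `]0, 1[ by apply: near_in_itvoo; rewrite in_itv.
  apply: filterS => s; rewrite in_itv/= => /andP[s0 s1].
  by rewrite picard_limit_fixed /picard clamp_id// !ltW.
rewrite -[B t *m U t]add0r; apply: is_deriveD.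
apply: is_derive_primitive_mx; last exact: lt_trans t0.
exact: picard_integrand_continuous picard_limit_continuous.
Qed.

End Picard.
End LinearODE.

(** * Flat linear systems *)

(* [Om q v] and [dOm q k v] stand for the value at [q] of a connection form on the
   vector [v], and for its derivative in the direction [k]. *)
Section RadialTransport.
Context {R : realType} {V : normedModType R} {n p : nat}.
Variables (Om : V -> V -> 'M[R]_n) (dOm : V -> V -> V -> 'M[R]_n) (K rho : R).
Hypothesis K_ge0 : 0 <= K.
Hypothesis OmD : forall q u v, Om q (u + v) = Om q u + Om q v.
Hypothesis dOmD : forall q k u v, dOm q k (u + v) = dOm q k u + dOm q k v.
Hypothesis dOmZ : forall q a k v, dOm q (a *: k) v = a *: dOm q k v.
Hypothesis Om_le : forall q v, `|q| < rho -> `|Om q v| <= K * `|v|.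
Hypothesis dOm_le : forall q k v, `|q| < rho -> `|dOm q k v| <= K * `|k| * `|v|.
Hypothesis Om_taylor : forall q k v, `|q| < rho -> `|q + k| < rho ->
  `|Om (q + k) v - Om q v - dOm q k v| <= K * `|k| ^+ 2 * `|v|.
Hypothesis is_derive_Om : forall q v (t : R), `|t *: q| < rho ->
  is_derive t 1 (fun s => Om (s *: q) v) (dOm (t *: q) q v).
(** For a solution of dw = Om w, the derivative along [h] of [Om q k *m w] is
    [dOm q h k *m w + Om q k *m Om q h *m w]; flatness makes this symmetric in [h] and [k], as a
    second derivative must be. *)
Hypothesis Om_flat : forall q h k, `|q| < rho ->
  Om q k *m Om q h - Om q h *m Om q k + dOm q h k - dOm q k h = 0.

Variable r : R.
Implicit Types (q h k v : V) (t : R).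
(** [r_half] keeps differences of points of the ball at norm at most 1, so that quadratic errors are
    also linear ones; [r_small] provides the coefficient 1/2 of [gronwall_half] and of the Picard
    contraction. *)
Hypothesis r_rho : r <= rho.
Hypothesis r_half : r <= 2^-1.
Hypothesis r_small : n%:R * (K * r) <= 2^-1.
Variable w0 : 'M[R]_(n, p).

Lemma scale_lt q (t : R) : `|q| < r -> 0 <= t <= 1 -> `|t *: q| < r.
Proof.
move=> qr /andP[t0 t1]; apply: le_lt_trans qr.
by rewrite normrZ ger0_norm// ler_piMl.
Qed.

Lemma radial_small q v (s : R) : `|q| < r -> `|v| < r -> 0 <= s <= 1 ->
  n%:R * `|Om (s *: q) v| <= 2^-1.
Proof.
move=> qr vr s01; apply: le_trans r_small; rewrite ler_wpM2l//.
apply: le_trans (Om_le _ (lt_le_trans (scale_lt qr s01) r_rho)) _.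
by rewrite ler_wpM2l// ltW.
Qed.

Lemma radial_ode q : `|q| < r -> exists u : R -> 'M[R]_(n, p),
  [/\ u 0 = w0, continuous u & forall t, t \in `]0, 1[ ->
    is_derive t 1 u (Om (t *: q) q *m u t)].
Proof.
move=> qr; pose B (t : R) := Om (clamp t *: q) q.
have Bc : continuous B.
  move=> t; apply: (@continuous_comp _ _ _ clamp (fun s => Om (s *: q) q)).
    exact: clamp_continuous.
  apply: differentiable_continuous; apply/derivable1_diffP.
  have [] // := @is_derive_Om q q (clamp t) _.
  exact: lt_le_trans (scale_lt qr (clamp_itv t)) r_rho.
have [|u [u0 uc du]] := linear_ode w0 Bc.
  by move=> t t01; apply: radial_small => //; rewrite clamp_id.
exists u; split=> // t t01; have := du t t01.
by rewrite /B clamp_id//; move: t01; rewrite in_itv/= => /andP[? ?]; rewrite !ltW.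
Qed.

(** The solution is chosen separately for each [q], so nothing relates two rays a priori; outside
    the ball the value is the default 0. *)
Definition radial q : R -> 'M[R]_(n, p) :=
  if pselect (`|q| < r) is left qr then sval (cid (radial_ode qr)) else fun=> 0.

Lemma radialP q : `|q| < r ->
  [/\ radial q 0 = w0, continuous (radial q) & forall t, t \in `]0, 1[ ->
    is_derive t 1 (radial q) (Om (t *: q) q *m radial q t)].
Proof. by rewrite /radial; case: pselect => // qr _; case: cid. Qed.

Lemma radial_le q t : `|q| < r -> t \in `[0, 1] -> `|radial q t| <= 2 * `|w0|.
Proof.
move=> qr t01; have [u0 uc du] := radialP qr.
suff h : `|radial q t - w0| <= 2 * (2^-1 * `|w0|).
  rewrite -[radial q t](subrK w0) (le_trans (ler_normD _ _))//; lra.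
apply: (gronwall_half (e := fun t => radial q t - w0)
  (de := fun t => Om (t *: q) q *m radial q t)) t01.
- by rewrite mulr_ge0 ?invr_ge0.
- by rewrite u0 subrr.
- apply: continuous_subspaceT => s; apply: continuousB; first exact: uc.
  exact: cst_continuous.
- by move=> s s01; rewrite -[X in is_derive _ _ _ X]subr0; apply: is_deriveB; exact: du.
- move=> s; rewrite in_itv/= => /andP[s0 s1].
  have s01 : 0 <= s <= 1 by rewrite !ltW.
  rewrite -mulrDr; apply: le_trans (mx_norm_mul _ _) _.
  apply: ler_pM => //; first exact: radial_small.
  by rewrite -{1}[radial q s](subrK w0) ler_normD.
Qed.

Definition transport q := radial q 1.

(** On the degenerate ray the coefficient is [Om] on the zero vector, which vanishes;
    [gronwall_half] with bound 0 makes the solution constant. *)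
Lemma transport0 : 0 < r -> transport 0 = w0.
Proof.
move=> r0; have z : `|0 : V| < r by rewrite normr0.
have [u0 uc du] := radialP z.
have Om0 q : Om q 0 = 0.
  by apply: (addrI (Om q 0)); rewrite -OmD !addr0.
have := @gronwall_half _ _ _ (fun t => radial 0 t - w0) (fun=> 0) 0 (lexx 0).
rewrite u0 subrr => /(_ erefl) h.
apply/eqP; rewrite -subr_eq0 -normr_le0 -(mulr0 2); apply: h.
- apply: continuous_subspaceT => s; apply: continuousB; first exact: uc.
  exact: cst_continuous.
- move=> s s01; rewrite -[X in is_derive _ _ _ X]subr0; apply: is_deriveB.
  by have := du s s01; rewrite Om0 mul0mx.
- by move=> t _; rewrite normr0 addr0 mulr_ge0// invr_ge0.
- by rewrite in_itv/= lexx ler01.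
Qed.

(** [P] and [B] are the coefficients of the radial equations of [q + h] and [q]. To first order in
    [h] they differ by [L], from the new direction of the ray, and by [t *: dOm (t *: q) h q], from
    the displacement of its points. *)
Lemma radial_increment_le q h (t : R) (L := Om (t *: q) h)
    (B := Om (t *: q) q) (P := Om (t *: (q + h)) (q + h)) :
  `|q| < r -> `|q + h| < r -> 0 <= t <= 1 ->
  `|P - B - L - t *: dOm (t *: q) h q| <= 2 * K * `|h| ^+ 2 /\
  `|P - B| <= 4 * K * `|h|.
Proof.
move=> qr qhr t01; have /andP[t0 t1] := t01.
have tq : `|t *: q| < rho := lt_le_trans (scale_lt qr t01) r_rho.
have tqh : `|t *: q + t *: h| < rho.
  by rewrite -scalerDr; exact: lt_le_trans (scale_lt qhr t01) r_rho.
have h1 : `|h| <= 1.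
  rewrite -[h](addKr q) addrC (le_trans (ler_normB _ _))//.
  have := ltW qr; have := ltW qhr; move: r_half; lra.
have E1 : `|P - B - L - t *: dOm (t *: q) h q| <= 2 * K * `|h| ^+ 2.
  have -> : P - B - L - t *: dOm (t *: q) h q =
     (Om (t *: q + t *: h) (q + h) - Om (t *: q) (q + h)
       - dOm (t *: q) (t *: h) (q + h)) + t *: dOm (t *: q) h h.
    rewrite /P /B /L scalerDr (OmD (t *: q)) dOmZ dOmD scalerDr !opprD !addrA.
    by rewrite subrK.
  apply: le_trans (ler_normD _ _) _.
  have -> : 2 * K * `|h| ^+ 2 = K * `|h| ^+ 2 + K * `|h| ^+ 2 by ring.
  apply: lerD.
    apply: le_trans (Om_taylor _ tq tqh) _.
    rewrite -[leRHS]mulr1; apply: ler_pM => //.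
    - by rewrite mulr_ge0// exprn_ge0.
    - rewrite ler_wpM2l// ler_pXn2r ?nnegrE// normrZ ger0_norm//.
      by rewrite ler_piMl.
    - by apply: le_trans (ltW qhr) _; apply: le_trans r_half _; rewrite invf_le1// ler1n.
  rewrite normrZ ger0_norm// (le_trans (ler_piMl _ t1))//.
  by apply: le_trans (dOm_le _ _ tq) _; rewrite expr2 mulrA.
split=> //.
have -> : P - B = (P - B - L - t *: dOm (t *: q) h q) + (L + t *: dOm (t *: q) h q).
  by apply/matrixP => i j; rewrite !mxE; ring.
apply: le_trans (ler_normD _ _) _.
apply: (@le_trans _ _ (2 * K * `|h| + (K * `|h| + K * `|h|))); last by lra.
apply: lerD.
  apply: (le_trans E1); rewrite ler_wpM2l ?mulr_ge0// expr2.
  by rewrite ler_piMl.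
apply: le_trans (ler_normD _ _) _; apply: lerD; first exact: Om_le.
rewrite normrZ ger0_norm// (le_trans (ler_piMl _ t1))//.
apply: le_trans (dOm_le _ _ tq) _; rewrite ler_piMr ?mulr_ge0//.
by apply: le_trans (ltW qr) _; apply: le_trans r_half _; rewrite invf_le1// ler1n.
Qed.

Lemma transport_expansion : exists c, forall q h, `|q| < r -> `|q + h| < r ->
  `|transport (q + h) - transport q - Om q h *m transport q| <= c * `|h| ^+ 2.
Proof.
pose S := 2 * `|w0|; pose N : R := n%:R.
(* The outer 2 comes from [gronwall_half]. The first summand bounds the second-order part of [P - B]
   applied to the solution, the second the product of the first-order quantities [P - B] and [L];
   [S] bounds the solution. *)
exists (2 * (2 * N * K * S + 4 * N ^+ 2 * K ^+ 2 * S)) => q h qr qhr.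
have [u0 uc du] := radialP qr; have [v0 vc dv] := radialP qhr.
pose L (t : R) := Om (t *: q) h.
pose B (t : R) := Om (t *: q) q.
pose P (t : R) := Om (t *: (q + h)) (q + h).
(* Flatness makes [e] satisfy e' = P e + O(|h|^2): the first-order terms of the
   difference of the two radial equations add up to the curvature. *)
pose e (t : R) := radial (q + h) t - radial q t - t *: (L t *m radial q t).
pose de (t : R) := P t *m radial (q + h) t - B t *m radial q t -
  (t *: (dOm (t *: q) q h *m radial q t + L t *m (B t *m radial q t))
   + L t *m radial q t).
have dL t : 0 <= t <= 1 -> is_derive t 1 L (dOm (t *: q) q h).
  by move=> t01; apply: is_derive_Om; exact: lt_le_trans (scale_lt qr t01) r_rho.
have itvW t : t \in `]0, 1[ -> 0 <= t <= 1.
  by rewrite in_itv/= => /andP[? ?]; rewrite !ltW.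
have d_e t : t \in `]0, 1[ -> is_derive t 1 e (de t).
  move=> t01; apply: is_deriveB; first by apply: is_deriveB; [exact: dv|exact: du].
  have dLu := is_derive_mulmx (dL t (itvW t t01)) (du t t01).
  apply/is_derive_mxP => i j; move/is_derive_mxP: dLu => /(_ i j) dLu.
  have -> : (fun y : R => (y *: (L y *m radial q y)) i j) =
      (@id R : R -> R) * (fun y => (L y *m radial q y) i j).
    by apply/funext => y; rewrite mxE.
  apply: is_derive_eq; rewrite [in RHS]mxE [in X in _ = X + _]mxE /=.
  by congr (_ + _); rewrite /GRing.scale/= mulr1.
have h2 : 0 <= 2 * N * K * S + 4 * N ^+ 2 * K ^+ 2 * S.
  by rewrite addr_ge0// !mulr_ge0 ?exprn_ge0.
have := @gronwall_half _ _ _ e de ((2 * N * K * S + 4 * N ^+ 2 * K ^+ 2 * S) * `|h| ^+ 2).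
rewrite mulr_ge0 ?exprn_ge0// => /(_ isT).
have e0 : e 0 = 0 by rewrite /e u0 v0 subrr scale0r subr0.
move=> /(_ e0).
have ec0 t : 0 <= t <= 1 -> {for t, continuous e}.
  move=> t01; apply: (@continuousB _ _ _ (fun t => radial (q + h) t - radial q t)
    (fun t => t *: (L t *m radial q t))).
    apply: (@continuousB _ _ _ (radial (q + h)) (radial q)); [exact: vc|exact: uc].
  have Lu : {for t, continuous (fun t => L t *m radial q t)}.
    apply: continuous_mulmx; last exact: uc.
    apply: differentiable_continuous; apply/derivable1_diffP.
    by have [] := dL t t01.
  have idc : {for t, continuous (@id R)} by exact: cvg_id.
  exact: (@continuousZ _ _ _ (@id R) (fun t => L t *m radial q t) t idc Lu).
have ec : {within `[0, 1], continuous e}.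
  apply/continuous_in_subspaceT => t; rewrite inE/= in_itv/= => t01.
  exact: ec0.
move=> /(_ ec d_e).
have de_le t : t \in `]0, 1[ -> `|de t| <= 2^-1 * `|e t| +
    (2 * N * K * S + 4 * N ^+ 2 * K ^+ 2 * S) * `|h| ^+ 2.
  move=> t01; have t01' := itvW t t01.
  have tq : `|t *: q| < rho := lt_le_trans (scale_lt qr t01') r_rho.
  have [E1 E2] := radial_increment_le qr qhr t01'.
  have uS : `|radial q t| <= S.
    by apply: radial_le => //; rewrite in_itv/=.
  have flat := Om_flat h q tq.
  (* Flatness trades the derivative of the form along [q] and the product of [L] by [B] for the
     derivative along [h] and the product of [B] by [L]; every term other than [P t *m e t] is then
     of second order in [h]. *)
  have deE : de t = P t *m e t
      + (P t - B t - L t - t *: dOm (t *: q) h q) *m radial q t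
      + t *: ((P t - B t) *m (L t *m radial q t)).
    have -> : P t *m e t = P t *m radial (q + h) t - P t *m radial q t
        - t *: (P t *m (L t *m radial q t)).
      by rewrite /e !mulmxBr -scalemxAr.
    have := congr1 (fun M => t *: (M *m radial q t)) flat.
    rewrite mul0mx scaler0 !mulmxBl !mulmxDl !mulNmx -!mulmxA -/(B t) -/(L t).
    rewrite -?scalemxAl /de.
    move: (P t *m (L t *m _)) (B t *m (L t *m _)) (L t *m (B t *m _)) => x1 x2 x3.
    move: (P t *m _) (P t *m _) (B t *m _) (L t *m _) => x4 x5 x6 x7.
    move: (dOm _ h q *m _) (dOm _ q h *m _) => x8 x9 flat'.
    rewrite -[RHS]addr0 -flat'; apply/matrixP => i j; rewrite !mxE; ring.
  have Pt : N * `|P t| <= 2^-1 by apply: radial_small.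
  rewrite deE mulrDl !addrA; apply: le_trans (ler_normD _ _) _.
  have t1 : `|t| <= 1 by case/andP: t01' => t0 t1; rewrite ger0_norm.
  apply: lerD.
    apply: le_trans (ler_normD _ _) _; apply: lerD.
      by apply: le_trans (mx_norm_mul _ _) _; rewrite ler_wpM2r.
    apply: le_trans (mx_norm_mul _ _) _.
    apply: (@le_trans _ _ (N * (2 * K * `|h| ^+ 2) * S)); last by lra.
    by apply: ler_pM => //; rewrite ler_wpM2l.
  rewrite normrZ (le_trans (ler_piMl _ t1))//.
  apply: le_trans (mx_norm_mul _ _) _.
  apply: (@le_trans _ _ (N * (4 * K * `|h|) * (N * (K * `|h|) * S))); last first.
    by rewrite le_eqVlt; apply/orP; left; apply/eqP; ring.
  apply: ler_pM => //; first by rewrite ler_wpM2l.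
  apply: le_trans (mx_norm_mul _ _) _.
  by apply: ler_pM => //; rewrite ler_wpM2l//; exact: Om_le.
move=> /(_ de_le 1); rewrite in_itv/= lexx ler01 => /(_ isT).
by rewrite /e /L !scale1r mulrA.
Qed.

Lemma flat_transport : 0 < r -> exists w : V -> 'M[R]_(n, p), w 0 = w0 /\
  exists c, forall q h, `|q| < r -> `|q + h| < r ->
    `|w (q + h) - w q - Om q h *m w q| <= c * `|h| ^+ 2.
Proof.
by move=> r0; exists transport; split; [exact: transport0|exact: transport_expansion].
Qed.

End RadialTransport.

Section MoreCk.
Context {R : realType} {V : normedModType R}.

Lemma CkZ (W : normedModType R) k (D : set V) (a : R) (f : V -> W) : open D ->
  Ck k D f -> Ck k D (fun x => a *: f x).
Proof.
move=> oD Cf; apply: (Ck_linear_comp (L := ( *:%R a : W -> W)) oD _ Cf).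
move=> x; apply: (@continuousZ R W W (cst a) id); first exact: cst_continuous.
exact: cvg_id.
Qed.

Lemma Ck_derive (W : normedModType R) k (D : set V) (f : V -> W) v :
  Ck k.+1 D f -> Ck k D ('D_v f).
Proof. by move=> [_ /(_ v)]. Qed.

Lemma CkN (W : normedModType R) k (D : set V) (f : V -> W) : open D ->
  Ck k D f -> Ck k D (fun x => - f x).
Proof.
move=> oD Cf; apply: (Ck_eq (f := fun x => -1 *: f x)) => // [x _|].
  by rewrite scaleN1r.
exact: CkZ.
Qed.

Lemma Ck_mulmx m n p k (D : set V) (A : V -> 'M[R]_(m, n)) (B : V -> 'M[R]_(n, p)) :
  open D -> Ck k D A -> Ck k D B -> Ck k D (fun x => A x *m B x).
Proof.
move=> oD /(Ck_mxP _ _ oD) CA /(Ck_mxP _ _ oD) CB; apply/Ck_mxP => // i j.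
apply: (Ck_eq (f := fun x => \sum_l A x i l * B x l j)) => // [x _|].
  by rewrite mxE.
by apply: Ck_sum => // l; apply: CkM.
Qed.

End MoreCk.

Section RowVectors.
Context {R : realType} {d : nat}.
Let e_ (i : 'I_d) : 'rV[R]_d := delta_mx 0 i.

Lemma norm_sum_coord_le (W : normedModType R) (v : 'rV[R]_d) (M : 'I_d -> W) c :
  0 <= c -> (forall i, `|M i| <= c) ->
  `|\sum_i v 0 i *: M i| <= d%:R * c * `|v|.
Proof.
move=> c0 Mc; rewrite (le_trans (ler_norm_sum _ _ _))//.
apply: (@le_trans _ _ (\sum_(i < d) c * `|v|)).
  apply: ler_sum => i _; rewrite normrZ mulrC ler_pM//.
  exact: mx_entry_le.
by rewrite sumr_const card_ord -mulrA mulr_natl.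
Qed.

Lemma diff_sum_coord (W : normedModType R) (F : 'rV[R]_d -> W) x v :
  differentiable F x -> 'd F x v = \sum_i v 0 i *: 'D_(e_ i) F x.
Proof.
move=> dF; rewrite {1}(row_sum_delta v) linear_sum; apply: eq_bigr => i _.
by rewrite linearZ deriveE.
Qed.

Lemma derive_sum_coord (W : normedModType R) (F : 'rV[R]_d -> W) x v :
  differentiable F x -> 'D_v F x = \sum_i v 0 i *: 'D_(e_ i) F x.
Proof. by move=> dF; rewrite deriveE// diff_sum_coord. Qed.

Lemma locally_bounded (I : finType) (W : normedModType R) (V : normedModType R)
    (F : I -> V -> W) x : (forall i, {for x, continuous (F i)}) ->
  exists2 C, 0 <= C & \forall y \near x, forall i, `|F i y| <= C.
Proof.
move=> Fc; exists (1 + \sum_i `|F i x|); first by rewrite addr_ge0// sumr_ge0.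
apply: filter_forall => i; have /cvgrPdist_lt/(_ 1 ltr01) := Fc i.
apply: filterS => y yx; rewrite -[F i y](subrK (F i x)).
apply: le_trans (ler_normD _ _) _; apply: lerD; first by rewrite distrC ltW.
by rewrite (bigD1 i)//= lerDl sumr_ge0.
Qed.

Lemma sum_coord_continuous (W : normedModType R) (M : 'I_d -> W) :
  continuous (fun v : 'rV[R]_d => \sum_i v 0 i *: M i).
Proof.
move=> x; apply: (@Ck_continuous R 'rV[R]_d W 0 setT) => //.
apply: Ck_sum; first exact: openT.
move=> i; apply: CkZl; first exact: openT.
exact: (Ck_linear (L := entry 0 i) _ _ (@coord_continuous R 1 d 0 i)).
Qed.

(** The mean value inequality twice: once ['d F x] is subtracted, the derivative along [k] is itself
    an increment of ['D_k F]. Expanding each of the two directions in coordinates costs a factor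
    [d]. *)
Lemma taylor2 m n (F : 'rV[R]_d -> 'M[R]_(m, n)) (D : set 'rV[R]_d) x k c :
  open D -> Ck 2 D F ->
  0 <= c -> (forall s, 0 <= s <= 1 -> D (x + s *: k) /\
    forall i j, `|'D_(e_ i) ('D_(e_ j) F) (x + s *: k)| <= c) ->
  `|F (x + k) - F x - 'd F x k| <= d%:R * (d%:R * c) * `|k| ^+ 2.
Proof.
move=> oD CF c0 h; have [dF DF] := CF.
have second s u : 0 <= s <= 1 ->
    `|'D_u ('D_k F) (x + s *: k)| <= d%:R * (d%:R * c) * `|k| * `|u|.
  move=> s01; have [Ds bs] := h s s01.
  have [dDkF _] := DF k; rewrite derive_sum_coord; last exact: dDkF.
  have E j : 'D_(e_ j) ('D_k F) (x + s *: k) =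
      \sum_i k 0 i *: 'D_(e_ j) ('D_(e_ i) F) (x + s *: k).
    rewrite (@near_eq_derive _ _ _ _ (\sum_i k 0 i \*: ('D_(e_ i) F))); last first.
      have : \forall y \near x + s *: k, D y by exact: open_nbhs_nbhs.
      apply: filterS => y Dy; rewrite derive_sum_coord; last exact: dF.
      by rewrite fct_sumE.
    rewrite derive_sum => [|i]; last first.
      by apply: derivableZ; apply: diff_derivable; have [+ _] := DF (e_ i); apply.
    apply: eq_bigr => i _; rewrite deriveZ//.
    by apply: diff_derivable; have [+ _] := DF (e_ i); apply.
  rewrite -!mulrA mulrA mulrACA -!mulrA.
  rewrite [leRHS](_ : _ = d%:R * (d%:R * c * `|k|) * `|u|); last by ring.
  apply: norm_sum_coord_le => [|j]; first by rewrite !mulr_ge0.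
  by rewrite E; apply: norm_sum_coord_le.
have in01 s t : 0 <= s <= 1 -> 0 <= t <= 1 -> 0 <= t * s <= 1.
  by move=> /andP[s0 s1] /andP[t0 t1]; rewrite mulr_ge0//= mulr_ile1.
pose G y := F y - 'd F x y.
have -> : F (x + k) - F x - 'd F x k = G (x + k) - G x.
  rewrite /G linearD; move: (F (x + k)) (F x) ('d F x x) ('d F x k) => a b a' b'.
  by apply/matrixP => i j; rewrite !mxE; ring.
have Dx : D x by have [+ _] := h 0 ltac:(by rewrite lexx ler01); rewrite scale0r addr0.
have lind y : differentiable ('d F x) y.
  by apply: linear_differentiable; apply: diff_continuous; exact: dF.
apply: mean_value_segment => s s01; have [Ds _] := h s s01.
  by apply: differentiableB; [exact: dF|exact: lind].
rewrite /G deriveB; [|exact/diff_derivable/dF|exact/diff_derivable/lind].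
rewrite [X in _ - X]deriveE// diff_lin; last exact/diff_continuous/dF.
rewrite -deriveE; last exact: dF.
apply: (mean_value_segment (F := 'D_k F) (p := x) (k := s *: k)) => t t01;
  rewrite scalerA.
  by have [+ _] := DF k; apply; have [] := h _ (in01 _ _ _ s01 t01).
apply: le_trans (second _ _ (in01 _ _ _ s01 t01)) _.
rewrite expr2 !mulrA ler_wpM2l ?mulr_ge0// normrZ.
by case/andP: s01 => s0 s1; rewrite ger0_norm// ler_piMl.
Qed.

End RowVectors.

(** * Frobenius theorem for flat linear systems in coordinates *)

Section Frobenius.
Context {R : realType} {d n p : nat}.
Let e_ (i : 'I_d) : 'rV[R]_d := delta_mx 0 i.
Variables (A : 'I_d -> 'rV[R]_d -> 'M[R]_n) (D : set 'rV[R]_d) (q0 : 'rV[R]_d).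
Hypothesis D_open : open D.
Hypothesis Dq0 : D q0.
Hypothesis A_C2 : forall i, Ck 2 D (A i).
Hypothesis A_flat : forall q i j, D q ->
  'D_(e_ i) (A j) q - 'D_(e_ j) (A i) q + A j q *m A i q - A i q *m A j q = 0.

Lemma connection_bounds : exists2 rho, 0 < rho & exists2 C, 0 <= C &
  forall q, `|q| < rho -> [/\ D (q0 + q), forall i, `|A i (q0 + q)| <= C,
    forall i j, `|'D_(e_ j) (A i) (q0 + q)| <= C &
    forall i j k, `|'D_(e_ k) ('D_(e_ j) (A i)) (q0 + q)| <= C].
Proof.
have [C1 C10 b1] := @locally_bounded R _ _ _ A q0 (fun i =>
  Ck_continuous (A_C2 i) Dq0).
have [C2 C20 b2] := @locally_bounded R _ _ _
  (fun ij : 'I_d * 'I_d => 'D_(e_ ij.2) (A ij.1)) q0 (fun ij =>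
  Ck_continuous (Ck_derive (e_ ij.2) (A_C2 ij.1)) Dq0).
have [C3 C30 b3] := @locally_bounded R _ _ _
  (fun ij : 'I_d * 'I_d * 'I_d => 'D_(e_ ij.2) ('D_(e_ ij.1.2) (A ij.1.1))) q0
  (fun ij => Ck_continuous (Ck_derive (e_ ij.2) (Ck_derive (e_ ij.1.2) (A_C2 ij.1.1))) Dq0).
have Dn : \near q0, D q0 by exact: open_nbhs_nbhs.
have FF : Filter (nbhs q0) by exact: nbhs_filter.
have := filterI (filterI Dn b1) (filterI b2 b3).
move=> /(_ FF FF FF) /nbhs_normP[rho /= rho0 hrho]; exists rho => //.
exists (C1 + C2 + C3); first by rewrite !addr_ge0.
move=> q qrho; have /hrho [[Dq h1] [h2 h3]] : `|q0 - (q0 + q)| < rho.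
  by rewrite opprD addNKr normrN.
split=> // [i|i j|i j k].
- by apply: le_trans (h1 i) _; rewrite -addrA lerDl addr_ge0.
- by apply: le_trans (h2 (i, j)) _; rewrite addrAC lerDr addr_ge0.
- by apply: le_trans (h3 (i, j, k)) _; rewrite lerDr addr_ge0.
Qed.

Let Om (x v : 'rV[R]_d) : 'M[R]_n := \sum_i v 0 i *: A i (q0 + x).
Let dOm (x k v : 'rV[R]_d) : 'M[R]_n := \sum_i v 0 i *: 'd (A i) (q0 + x) k.

Lemma frobenius (w0 : 'M[R]_(n, p)) : exists2 r, 0 < r &
  exists w : 'rV[R]_d -> 'M[R]_(n, p), w q0 = w0 /\
  forall q, `|q - q0| < r -> [/\ D q, differentiable w q &
    forall v, 'D_v w q = \sum_i v 0 i *: (A i q *m w q)].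
Proof.
have [rho rho0 [C C0 bnd]] := connection_bounds.
(* The three summands bound the form, its derivative and its Taylor remainder; each further
   expansion in coordinates costs a factor [N]. *)
pose N : R := d%:R; pose K := N * C + N * (N * C) + N * (N * (N * C)).
have K0 : 0 <= K by rewrite !addr_ge0 ?mulr_ge0.
have le1 : N * C <= K by rewrite -[leLHS]addr0 /K -addrA lerD2l addr_ge0 ?mulr_ge0.
have le2 : N * (N * C) <= K by rewrite /K addrAC lerDr addr_ge0 ?mulr_ge0.
have le3 : N * (N * (N * C)) <= K by rewrite /K lerDr addr_ge0 ?mulr_ge0.
have dA i q : `|q| < rho -> differentiable (A i) (q0 + q).
  by move=> /bnd[Dq _ _ _]; have [+ _] := A_C2 i; apply.
have OmD q u v : Om q (u + v) = Om q u + Om q v.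
  by rewrite -big_split/=; apply: eq_bigr => i _; rewrite mxE scalerDl.
have dOmD q k u v : dOm q k (u + v) = dOm q k u + dOm q k v.
  by rewrite -big_split/=; apply: eq_bigr => i _; rewrite mxE scalerDl.
have dOmZ q a k v : dOm q (a *: k) v = a *: dOm q k v.
  rewrite scaler_sumr; apply: eq_bigr => i _.
  by rewrite linearZ/= !scalerA mulrC.
have Om_le q v : `|q| < rho -> `|Om q v| <= K * `|v|.
  move=> /bnd[_ b1 _ _]; apply: le_trans (norm_sum_coord_le _ C0 b1) _.
  by rewrite ler_wpM2r.
have dOm_le q k v : `|q| < rho -> `|dOm q k v| <= K * `|k| * `|v|.
  move=> qr; have [Dq _ b2 _] := bnd q qr.
  apply: (@le_trans _ _ (N * (N * C * `|k|) * `|v|)); last first.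
    by rewrite ler_wpM2r// mulrA ler_wpM2r.
  apply: norm_sum_coord_le => [|i]; first by rewrite !mulr_ge0.
  rewrite diff_sum_coord; last exact: dA.
  exact: norm_sum_coord_le.
have taylor q k v : `|q| < rho -> `|q + k| < rho ->
    `|Om (q + k) v - Om q v - dOm q k v| <= K * `|k| ^+ 2 * `|v|.
  move=> qr qkr.
  have -> : Om (q + k) v - Om q v - dOm q k v =
      \sum_i v 0 i *: (A i (q0 + q + k) - A i (q0 + q) - 'd (A i) (q0 + q) k).
    rewrite /Om /dOm -!sumrB; apply: eq_bigr => i _.
    by rewrite !scalerBr addrA.
  apply: (@le_trans _ _ (N * (N * (N * C) * `|k| ^+ 2) * `|v|)); last first.
    by rewrite ler_wpM2r// mulrA ler_wpM2r// exprn_ge0.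
  apply: norm_sum_coord_le => [|i]; first by rewrite !mulr_ge0// exprn_ge0.
  apply: (taylor2 D_open (A_C2 i)) => // s s01; rewrite -addrA.
  have qskr : `|q + s *: k| < rho.
    have -> : q + s *: k = (1 - s) *: q + s *: (q + k).
      by rewrite scalerBl scale1r scalerDr addrA subrK.
    case/andP: s01 => s0 s1; apply: le_lt_trans (ler_normD _ _) _.
    rewrite !normrZ (ger0_norm s0) ger0_norm ?subr_ge0//.
    have h1 := mulr_ge0 s0 (normr_ge0 (q + k)).
    have [->|s_gt0] := eqVneq s 0; first by rewrite subr0 mul1r mul0r addr0.
    have -> : rho = (1 - s) * rho + s * rho by ring.
    apply: ler_ltD; first by rewrite ler_wpM2l ?subr_ge0// ltW.
    by rewrite ltr_pM2l// lt_def s_gt0.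
  by have [? _ _ ?] := bnd _ qskr.
have dOmE q v (t : R) : `|t *: q| < rho ->
    is_derive t 1 (fun s => Om (s *: q) v) (dOm (t *: q) q v).
  move=> tq.
  rewrite (_ : (fun s => Om (s *: q) v) =
     \sum_i v 0 i \*: (fun s => A i (q0 + s *: q))); last first.
    by apply/funext => s; rewrite fct_sumE.
  apply: is_derive_sum => i; apply: is_deriveZ.
  by rewrite -deriveE; [apply: is_derive_path|]; exact: dA.
have flat q h k : `|q| < rho ->
    Om q k *m Om q h - Om q h *m Om q k + dOm q h k - dOm q k h = 0.
  move=> qr; have [Dq _ _ _] := bnd q qr.
  have EM u v : Om q u *m Om q v =
      \sum_i \sum_j (u 0 i * v 0 j) *: (A i (q0 + q) *m A j (q0 + q)).
    rewrite mulmx_suml; apply: eq_bigr => i _; rewrite mulmx_sumr.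
    by apply: eq_bigr => j _; rewrite -scalemxAl -scalemxAr scalerA.
  have ED u v : dOm q u v =
      \sum_i \sum_j (v 0 i * u 0 j) *: 'D_(e_ j) (A i) (q0 + q).
    apply: eq_bigr => i _; rewrite diff_sum_coord; last exact: dA.
    by rewrite scaler_sumr; apply: eq_bigr => j _; rewrite scalerA.
  (* The same double sums with the indices exchanged, so that everything cancels term by term
     through [A_flat]. *)
  have EM' u v : Om q u *m Om q v =
      \sum_i \sum_j (u 0 j * v 0 i) *: (A j (q0 + q) *m A i (q0 + q)).
    by rewrite EM exchange_big.
  have ED' u v : dOm q u v =
      \sum_i \sum_j (v 0 j * u 0 i) *: 'D_(e_ i) (A j) (q0 + q).
    by rewrite ED exchange_big.
  rewrite (EM k h) (EM' h k) (ED h k) (ED' k h).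
  rewrite -sumrB -big_split -sumrB/=; apply: big1 => i _.
  rewrite -sumrB -big_split -sumrB/=; apply: big1 => j _.
  rewrite [h 0 j * _]mulrC -scalerBr -scalerDr -scalerBr.
  have := A_flat j i Dq => /eqP; rewrite subr_eq0 => /eqP E.
  apply/eqP; rewrite scaler_eq0; apply/orP; right; apply/eqP.
  move: E; move: (A i _ *m A j _) (A j _ *m A i _) => a b.
  move: ('D_(e_ j) (A i) _) ('D_(e_ i) (A j) _) => a' b' <-.
  by apply/matrixP => i' j'; rewrite !mxE; ring.
(* The three bounds give [r_rho], [r_half] and [r_small]; the [+ 1] keeps the last divisor positive
   when n K = 0. *)
pose r := Num.min rho (Num.min 2^-1 (2 * (n%:R * K + 1))^-1).
have nK0 : 0 < n%:R * K + 1 by rewrite ltr_wpDl// mulr_ge0.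
have r0 : 0 < r by rewrite !lt_min rho0 !invr_gt0 (mulr_gt0 _ nK0)// ltr0n.
have r1 : r <= rho by rewrite ge_min lexx.
have r2 : r <= 2^-1 by rewrite !ge_min lexx orbT.
have r3 : n%:R * (K * r) <= 2^-1.
  have : r <= (2 * (n%:R * K + 1))^-1 by rewrite !ge_min lexx !orbT.
  rewrite -[X in _ <= X]div1r ler_pdivlMr ?mulr_gt0// => h.
  move: r0 h; lra.
have [w [w00 [c wc]]] := flat_transport K0 OmD dOmD dOmZ Om_le dOm_le taylor
  dOmE flat r1 r2 r3 w0 r0.
exists r => //; exists (fun q => w (q - q0)); split; first by rewrite subrr.
move=> q qr; have [Dq _ _ _] := bnd _ (lt_le_trans qr r1).
rewrite addrC subrK in Dq.
(* Candidate differential of the solution at [q]; the error in [flat_transport] is quadratic in the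
   increment, hence negligible against it. *)
pose l (v : 'rV[R]_d) := \sum_i v 0 i *: (A i q *m w (q - q0)).
have lin : linear l.
  move=> a u v; rewrite /l scaler_sumr -big_split/=; apply: eq_bigr => i _.
  by rewrite !mxE scalerDl scalerA.
pose lM := GRing.isLinear.Build _ _ _ _ _ lin.
pose L : {linear 'rV[R]_d -> 'M[R]_(n, p)} := HB.pack l lM.
have : is_diff q (fun q => w (q - q0)) L.
  apply: is_diff_littleo => [|e e0]; first exact: sum_coord_continuous.
  have M0 : 0 < `|c| + 1 by rewrite ltr_wpDl.
  have q1 : 0 < r - `|q - q0| by rewrite subr_gt0.
  have d0 : 0 < Num.min (r - `|q - q0|) (e / (`|c| + 1)).
    by rewrite lt_min q1 divr_gt0.
  apply/nbhs_normP; exists (Num.min (r - `|q - q0|) (e / (`|c| + 1))) => //= h.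
  rewrite /ball_/= sub0r normrN lt_min => /andP[h1 h2].
  have hr : `|q - q0 + h| < r.
    by apply: le_lt_trans (ler_normD _ _) _; rewrite addrC -ltrBrDr.
  have -> : l h = Om (q - q0) h *m w (q - q0).
    rewrite /l /Om mulmx_suml; apply: eq_bigr => i _.
    by rewrite -scalemxAl [q0 + _]addrC subrK.
  rewrite [h + q - q0](_ : _ = q - q0 + h); last by rewrite -addrA addrC.
  apply: le_trans (wc _ _ qr hr) _; rewrite expr2 mulrA ler_wpM2r//.
  apply: (@le_trans _ _ (`|c| * `|h|)); first by rewrite ler_wpM2r// ler_norm.
  apply: (@le_trans _ _ ((`|c| + 1) * `|h|)); first by rewrite ler_wpM2r// lerDl.
  by rewrite mulrC -ler_pdivlMr// ltW.
case=> dw dwE; split; [exact: Dq|exact: dw|move=> v].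
by rewrite deriveE// dwE.
Qed.

(** Bootstrap: the derivatives of [w] are products of smooth coefficients with [w], so class C^k of
    [w] implies class C^(k+1). *)
Lemma total_system_smooth (B : set 'rV[R]_d) (w : 'rV[R]_d -> 'M[R]_(n, p)) :
  open B -> (forall i, smooth_on B (A i)) ->
  (forall q, B q -> differentiable w q) ->
  (forall q v, B q -> 'D_v w q = \sum_i v 0 i *: (A i q *m w q)) ->
  smooth_on B w.
Proof.
move=> oB CA dw Dw; elim=> [|k IH].
  by move=> q /dw; exact: differentiable_continuous.
split=> // v; apply: (Ck_eq (f := fun q => \sum_i v 0 i *: (A i q *m w q))) => //.
  by move=> q Bq; rewrite Dw.
apply: Ck_sum => // i; apply: CkZ => //; apply: Ck_mulmx => //; exact: CA.
Qed.

End Frobenius.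

(** On the segment from [q0] to [q] the inequality becomes a homogeneous one with coefficient C |q -
    q0|; once this is at most 1/2, [gronwall_half] applies with bound 0. *)
Lemma differential_gronwall_zero {R : realType} {V : normedModType R} m n
    (F : V -> 'M[R]_(m, n)) (q0 : V) (r C : R) : 0 < r -> 0 <= C ->
  (forall q, `|q - q0| < r -> differentiable F q) ->
  (forall q v, `|q - q0| < r -> `|'D_v F q| <= C * `|v| * `|F q|) ->
  F q0 = 0 -> exists2 r', 0 < r' <= r & forall q, `|q - q0| < r' -> F q = 0.
Proof.
move=> r0 C0 dF DF F0; have M0 : 0 < 2 * (C + 1) by rewrite mulr_gt0// ltr_wpDl.
exists (Num.min r (2 * (C + 1))^-1).
  by rewrite lt_min r0 invr_gt0 M0 ge_min lexx.
move=> q; rewrite lt_min => /andP[qr qC].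
have in_r (t : R) : 0 <= t <= 1 -> `|q0 + t *: (q - q0) - q0| < r.
  move=> /andP[t0 t1]; rewrite addrC addKr; apply: le_lt_trans qr.
  by rewrite normrZ ger0_norm// ler_piMl.
have dP (t : R) : 0 <= t <= 1 -> is_derive t 1 (fun s => F (q0 + s *: (q - q0)))
    ('D_(q - q0) F (q0 + t *: (q - q0))).
  by move=> t01; apply: is_derive_path; apply: dF; exact: in_r.
have itvW (t : R) : t \in `]0, 1[ -> 0 <= t <= 1.
  by rewrite in_itv/= => /andP[? ?]; rewrite !ltW.
have Fc : {within `[0, 1], continuous (fun s : R => F (q0 + s *: (q - q0)))}.
  apply: derivable_within_continuous => t; rewrite in_itv/= => t01.
  by have [] := dP t t01.
have := @gronwall_half _ _ _ (fun s : R => F (q0 + s *: (q - q0)))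
  (fun t => 'D_(q - q0) F (q0 + t *: (q - q0))) 0 (lexx 0).
rewrite scale0r addr0 => /(_ F0 Fc (fun t t01 => dP t (itvW t t01))) h.
apply/eqP; rewrite -normr_le0 -(mulr0 2).
rewrite -{1}[q](subrK q0) addrC -[q - q0]scale1r; apply: h; last first.
  by rewrite in_itv/= ler01 lexx.
move=> t /itvW t01; rewrite addr0; apply: le_trans (DF _ _ (in_r _ t01)) _.
rewrite ler_wpM2r//; move: qC; rewrite -[X in _ < X]div1r ltr_pdivlMr// => qC.
have := normr_ge0 (q - q0); move: qC; lra.
Qed.

(** * Surface geometry *)

Lemma sum_ord2 (V : nmodType) (F : 'I_2 -> V) : \sum_i F i = F 0 + F 1.
Proof.
rewrite !big_ord_recl big_ord0 addr0; congr (F _ + F _).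
exact: val_inj.
Qed.

Lemma ord2P (i : 'I_2) : i = 0 \/ i = 1.
Proof. by case: i => [[|[|//]] h]; [left|right]; apply: val_inj. Qed.

Section SurfaceGeometry.
Context {R : realType}.
Variables (U : set 'rV[R]_2) (E F G : 'rV[R]_2 -> R).
Hypothesis U_open : open U.
Hypothesis E_smooth : smooth_on U E.
Hypothesis F_smooth : smooth_on U F.
Hypothesis G_smooth : smooth_on U G.
Let g := fiber_metric E F G.
Hypothesis g_posdef : forall q, U q -> forall u : 'rV[R]_2, u != 0 ->
  0 < metric_form g q u u.
Implicit Types (q : 'rV[R]_2) (i j k l m : 'I_2).

Lemma fiber_metricE q : [/\ g q 0 0 = E q, g q 0 1 = F q, g q 1 0 = F q &
  g q 1 1 = G q].
Proof. by rewrite !mxE. Qed.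

Lemma fiber_metric_sym q i j : g q i j = g q j i.
Proof. by rewrite !mxE eq_sym; case: eqP => // ->. Qed.

Lemma fiber_metric_smooth i j : smooth_on U (fun y => g y i j).
Proof.
have -> : (fun y => g y i j) =
    (if i == j then if i == 0 then E else G else F).
  by apply/funext => y; rewrite mxE; do 2?case: eqP.
by do 2?case: eqP.
Qed.

Lemma det_fiber_metric q : \det (g q) = E q * G q - F q ^+ 2.
Proof.
rewrite (expand_det_row _ 0) sum_ord2 /cofactor !det_mx11 !mxE /=; ring.
Qed.

Lemma fiber_metric_det_gt0 q : U q -> [/\ 0 < E q, 0 < G q &
  0 < E q * G q - F q ^+ 2].
Proof.
move=> Uq; have [E1 E2 E3 E4] := fiber_metricE q.
have form u : metric_form g q u u =
    E q * u 0 0 * u 0 0 + 2 * F q * u 0 0 * u 0 1 + G q * u 0 1 * u 0 1.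
  by rewrite /metric_form !sum_ord2 E1 E2 E3 E4; ring.
have pos (a b : R) : (a != 0) || (b != 0) ->
    0 < E q * a * a + 2 * F q * a * b + G q * b * b.
  move=> ab; pose u : 'rV[R]_2 := \row_i (if i == 0 then a else b).
  have := form u; rewrite !mxE/= => <-; apply: g_posdef => //.
  by apply: contraL ab => /eqP /rowP u0; have := u0 0; have := u0 1;
     rewrite !mxE/= => -> ->; rewrite eqxx.
have E0 : 0 < E q by have := pos 1 0; rewrite oner_eq0 => /(_ isT); lra.
have G0 : 0 < G q by have := pos 0 1; rewrite oner_eq0 orbT => /(_ isT); lra.
(* On the vector (G, -F) the form takes the value G (E G - F^2). *)
split=> //; have := pos (G q) (- F q); rewrite gt_eqF// => /(_ isT) h.
by rewrite -(pmulr_rgt0 _ G0); move: h; rewrite expr2; lra.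
Qed.

Lemma fiber_metric_unit q : U q -> g q \in unitmx.
Proof.
move=> Uq; have [_ _ D0] := fiber_metric_det_gt0 Uq.
by rewrite unitmxE det_fiber_metric unitfE gt_eqF.
Qed.

Lemma invmx_fiber_metric q : U q -> invmx (g q) =
  (E q * G q - F q ^+ 2)^-1 *: \matrix_(i, j)
    (if i == j then (if i == 0 then G q else E q) else - F q).
Proof.
move=> Uq; have [_ _ D0] := fiber_metric_det_gt0 Uq.
rewrite -[RHS](mulKmx (fiber_metric_unit Uq)) -[LHS]mulmx1; congr (_ *m _).
rewrite -scalemxAr; apply/matrixP => i j; rewrite !mxE sum_ord2.
have D0' : E q * G q - F q ^+ 2 != 0 by rewrite gt_eqF.
by case: (ord2P i) => ->; case: (ord2P j) => ->; rewrite !mxE/=; field.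
Qed.

Lemma partial_smooth i (a : 'rV[R]_2 -> R) : smooth_on U a -> smooth_on U (partial i a).
Proof. by move=> Ca k; apply: Ck_derive; exact: Ca. Qed.

Lemma christoffel_smooth k i j : smooth_on U (christoffel g k i j).
Proof.
move=> n; rewrite /christoffel.
have CV l : Ck n U (fun q => invmx (g q) k l).
  apply: (Ck_eq (f := fun q => (E q * G q - F q * F q)^-1 *
    (if k == l then if k == 0 then G q else E q else - F q))) => // [q Uq|].
    by rewrite invmx_fiber_metric// !mxE expr2.
  apply: CkM => //.
    apply: CkV => // [q Uq|].
      by have [_ _] := fiber_metric_det_gt0 Uq; rewrite expr2 => /gt_eqF ->.
    by apply: CkD => //; [exact: CkM|apply: CkN => //; exact: CkM].
  case: (k == l); last by apply: CkN => //; exact: F_smooth.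
  by case: (k == 0); [exact: G_smooth|exact: E_smooth].
have Cg a i' j' : Ck n U (partial a (fun y => g y i' j')).
  by apply: partial_smooth; exact: fiber_metric_smooth.
apply: (CkM (f := fun=> 2^-1)) => //; first exact: Ck_cst.
apply: Ck_sum => // l; apply: CkM => //.
by apply: CkD => //; [exact: CkD|exact: CkN].
Qed.

Lemma lower_christoffel q m i j : U q ->
  \sum_k g q m k * christoffel g k i j q =
  2^-1 * (partial i (fun y => g y j m) q + partial j (fun y => g y i m) q
     - partial m (fun y => g y i j) q).
Proof.
move=> Uq; rewrite /christoffel.
under eq_bigr do rewrite mulrCA mulr_sumr.
rewrite -mulr_sumr; congr (_ * _); rewrite exchange_big/=.
pose x l := partial i (fun y => g y j l) q + partial j (fun y => g y i l) q
     - partial l (fun y => g y i j) q.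
rewrite (eq_bigr (fun l => (g q *m invmx (g q)) m l * x l)); last first.
  by move=> l _; rewrite mxE mulr_suml; apply: eq_bigr => k _; rewrite mulrA.
rewrite mulmxV ?fiber_metric_unit// (bigD1 m)//= mxE eqxx mul1r big1 ?addr0//.
by move=> l lm; rewrite mxE eq_sym (negbTE lm) mul0r.
Qed.

Lemma christoffel_sym k i j q : christoffel g k i j q = christoffel g k j i q.
Proof.
have E' : (fun y => g y i j) = (fun y => g y j i).
  by apply/funext => y; exact: fiber_metric_sym.
rewrite /christoffel; congr (_ * _); apply: eq_bigr => l _; rewrite E'.
by rewrite [X in _ * (X - _)]addrC.
Qed.

Lemma metric_compatible a i j q : U q -> partial a (fun y => g y i j) q =
  \sum_k (g q j k * christoffel g k a i q + g q i k * christoffel g k a j q).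
Proof.
move=> Uq; rewrite big_split/= !lower_christoffel//.
have sym b c : (fun y => g y b c) = (fun y => g y c b).
  by apply/funext => y; exact: fiber_metric_sym.
by rewrite (sym j i); field.
Qed.

(** The derivative of g_ij as given by metric compatibility. With it, identities between derivatives
    become polynomial ones in the metric, the Christoffel symbols and their derivatives. *)
Definition dmetric a i j q : R :=
  \sum_k (g q j k * christoffel g k a i q + g q i k * christoffel g k a j q).

Lemma is_derive_fiber_metric a i j q : U q ->
  is_derive q (delta_mx 0 a) (fun y => g y i j) (dmetric a i j q).
Proof.
move=> Uq; rewrite /dmetric -metric_compatible//; apply: is_derive_diff.
by have [+ _] := fiber_metric_smooth i j 1; apply.
Qed.

Lemma is_derive_christoffel v k i j q : U q ->
  is_derive q v (christoffel g k i j) ('D_v (christoffel g k i j) q).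
Proof.
by move=> Uq; apply: is_derive_diff; have [+ _] := christoffel_smooth k i j 1; apply.
Qed.

Lemma partial2_metric b a i j q : U q ->
  partial b (partial a (fun y => g y i j)) q = \sum_k
   (dmetric b j k q * christoffel g k a i q
     + g q j k * partial b (christoffel g k a i) q
     + (dmetric b i k q * christoffel g k a j q
     + g q i k * partial b (christoffel g k a j) q)).
Proof.
move=> Uq; rewrite {1}/partial (@near_eq_derive _ _ _ _
  (\sum_k ((fun y => g y j k) * christoffel g k a i +
           (fun y => g y i k) * christoffel g k a j))); last first.
  have : \forall y \near q, U y by exact: open_nbhs_nbhs.
  apply: filterS => y Uy; rewrite metric_compatible// fct_sumE.
  by apply: eq_bigr.
have d k c e f h : is_derive q (delta_mx 0 b) ((fun y => g y c e) * christoffel g k f h)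
   (g q c e *: partial b (christoffel g k f h) q +
    christoffel g k f h q *: dmetric b c e q).
  by apply: is_deriveM; [exact: is_derive_fiber_metric|exact: is_derive_christoffel].
have H : is_derive q (delta_mx 0 b)
    (\sum_k ((fun y => g y j k) * christoffel g k a i +
              (fun y => g y i k) * christoffel g k a j))
    (\sum_k ((g q j k *: partial b (christoffel g k a i) q +
      christoffel g k a i q *: dmetric b j k q) +
     (g q i k *: partial b (christoffel g k a j) q +
      christoffel g k a j q *: dmetric b i k q))).
  by apply: is_derive_sum => k; apply: is_deriveD; exact: d.
case: H => _ H; apply: (etrans H).
apply: eq_bigr => k _; rewrite /GRing.scale/=.
move: (christoffel g k) (@partial R b) (dmetric b) (g q i k) (g q j k) => c P dg x y.
ring.
Qed.

Lemma partial2_sym b a i j q : U q ->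
  partial b (partial a (fun y => g y i j)) q =
  partial a (partial b (fun y => g y i j)) q.
Proof. by move=> Uq; apply: Ck2_symmetric U_open Uq (fiber_metric_smooth i j 2). Qed.

(** The curvature operator is skew for the metric: once metric compatibility is differentiated
    again, this is the equality of the mixed second derivatives of g_mk. *)
Lemma riemann_antisym m k q : U q ->
  \sum_l g q m l * riemann g l k 0 1 q + \sum_l g q k l * riemann g l m 0 1 q = 0.
Proof.
move=> Uq; have := etrans (etrans (esym (partial2_metric 0 1 m k Uq))
  (partial2_sym 0 1 m k Uq)) (partial2_metric 1 0 m k Uq).
rewrite /dmetric /riemann; move: (christoffel_sym) (fiber_metric_sym q).
move: (christoffel g) (@partial R) (g q) => c P gq csym gsym.
rewrite !sum_ord2 => /eqP; rewrite -subr_eq0 => /eqP S; apply: etrans S.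
by case: (ord2P m) => ->; case: (ord2P k) => ->;
  rewrite ?(csym _ 1 0) ?(gsym 1 0); ring.
Qed.

(** In dimension 2 skewness leaves one independent lowered component, the one in [gauss_curvature].
    Raising the index again means solving two linear systems with matrix [g q], here by Cramer's
    rule. *)
Lemma riemann_surface q (K := gauss_curvature g q) : U q ->
  [/\ riemann g 0 0 0 1 q = K * F q, riemann g 1 0 0 1 q = - K * E q,
      riemann g 0 1 0 1 q = K * G q & riemann g 1 1 0 1 q = - K * F q].
Proof.
move=> Uq; have [E0 G0 D0] := fiber_metric_det_gt0 Uq.
have D1 : E q * G q - F q ^+ 2 != 0 by rewrite gt_eqF.
have := riemann_antisym 0 0 Uq; have := riemann_antisym 0 1 Uq.
have := riemann_antisym 1 1 Uq.
have : \sum_l g q 0 l * riemann g l 1 0 1 q = K * (E q * G q - F q ^+ 2).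
  by rewrite /K /gauss_curvature det_fiber_metric divfK.
rewrite !sum_ord2; have [-> -> -> ->] := fiber_metricE q.
move: (riemann g 0 0 0 1 q) (riemann g 0 1 0 1 q) (riemann g 1 0 0 1 q)
  (riemann g 1 1 0 1 q) => r00 r01 r10 r11 h1 h2 h3 h4.
have e01 : r01 = K * G q.
  apply: (mulfI D1); transitivity (G q * (E q * r01 + F q * r11)
     - F q * (F q * r01 + G q * r11)); first ring.
  have -> : F q * r01 + G q * r11 = 0 by lra.
  by rewrite h1; ring.
have e11 : r11 = - K * F q.
  apply: (mulfI D1); transitivity (E q * (F q * r01 + G q * r11)
     - F q * (E q * r01 + F q * r11)); first ring.
  have -> : F q * r01 + G q * r11 = 0 by lra.
  by rewrite h1; ring.
have h3' : F q * r00 + G q * r10 = - K * (E q * G q - F q ^+ 2).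
  by move: h3; rewrite h1; lra.
have e10 : r10 = - K * E q.
  apply: (mulfI D1); transitivity (E q * (F q * r00 + G q * r10)
     - F q * (E q * r00 + F q * r10)); first ring.
  have -> : E q * r00 + F q * r10 = 0 by lra.
  by rewrite h3'; ring.
have e00 : r00 = K * F q.
  apply: (mulfI D1); transitivity (G q * (E q * r00 + F q * r10)
     - F q * (F q * r00 + G q * r10)); first ring.
  have -> : E q * r00 + F q * r10 = 0 by lra.
  by rewrite h3'; ring.
by split.
Qed.

End SurfaceGeometry.

(** * Gauss and Codazzi equations *)

Section Dot.
Context {R : realType} {n : nat}.
Implicit Types u v w : 'rV[R]_n.

Lemma dotC u v : dot u v = dot v u.
Proof. by apply: eq_bigr => i _; rewrite mulrC. Qed.

Lemma dotDl u v w : dot (u + v) w = dot u w + dot v w.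
Proof. by rewrite -big_split; apply: eq_bigr => i _; rewrite !mxE mulrDl. Qed.

Lemma dotZl a u w : dot (a *: u) w = a * dot u w.
Proof. by rewrite mulr_sumr; apply: eq_bigr => i _; rewrite !mxE mulrA. Qed.

Lemma dotNl u w : dot (- u) w = - dot u w.
Proof. by rewrite -scaleN1r dotZl mulN1r. Qed.

Lemma dotDr u v w : dot w (u + v) = dot w u + dot w v.
Proof. by rewrite dotC dotDl !(dotC w). Qed.

Lemma dotZr a u w : dot w (a *: u) = a * dot w u.
Proof. by rewrite dotC dotZl (dotC w). Qed.

Lemma dot0l w : dot 0 w = 0.
Proof. by rewrite -(scale0r (0 : 'rV_n)) dotZl mul0r. Qed.

Lemma dot_suml (I : Type) (r : seq I) (F : I -> 'rV[R]_n) w :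
  dot (\sum_(i <- r) F i) w = \sum_(i <- r) dot (F i) w.
Proof.
elim: r => [|i r IH]; first by rewrite !big_nil dot0l.
by rewrite !big_cons dotDl IH.
Qed.

Lemma dot_ge0 u : 0 <= dot u u.
Proof. by apply: sumr_ge0 => i _; rewrite -expr2 sqr_ge0. Qed.

Lemma dot_eq0 u : (dot u u == 0) = (u == 0).
Proof.
apply/eqP/eqP => [|->]; last by rewrite dot0l.
move=> /psumr_eq0P u0; apply/rowP => i; rewrite mxE.
have /eqP := u0 (fun i _ => ltac:(by rewrite -expr2 sqr_ge0)) i isT.
by rewrite mulf_eq0 orbb => /eqP.
Qed.

Lemma is_derive_dot (V : normedModType R) (A B : V -> 'rV[R]_n) (x v : V)
    (dA dB : 'rV[R]_n) :
  is_derive x v A dA -> is_derive x v B dB ->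
  is_derive x v (fun y => dot (A y) (B y)) (dot dA (B x) + dot (A x) dB).
Proof.
move=> /is_derive_mxP hA /is_derive_mxP hB.
rewrite (_ : (fun y => _) = \sum_i ((fun y => A y 0 i) * (fun y => B y 0 i))).
  apply: is_derive_eq; rewrite -big_split/=; apply: eq_bigr => i _.
  by rewrite addrC /GRing.scale/= [B x 0 i * _]mulrC.
by apply/funext => y; rewrite fct_sumE.
Qed.

End Dot.

(** Splits the inner product of R^4 along [e], the plane of [x] and [y] (through the inverse of its
    Gram matrix) and the remaining normal line; [nu] is a coordinate on that line. *)
Lemma normal_functional {R : realType} (e x y : 'rV[R]_4) (a b c : R) :
  dot e e = 1 -> dot x e = 0 -> dot y e = 0 ->
  dot x x = a -> dot x y = b -> dot y y = c -> a * c - b ^+ 2 != 0 ->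
  exists nu : 'rV[R]_4 -> R, forall u v, dot u v = dot u e * dot v e +
    (c * dot u x * dot v x - b * (dot u x * dot v y + dot u y * dot v x) +
     a * dot u y * dot v y) / (a * c - b ^+ 2) + nu u * nu v.
Proof.
move=> ee xe ye xx xy yy D0.
pose rows z : 'M[R]_4 := \matrix_(i < 4) nth 0 [:: e; x; y; z] i.
have mulrows z (v : 'rV[R]_4) w : dot (v *m rows z) w =
    v 0 0 * dot e w + v 0 1 * dot x w + v 0 2 * dot y w + v 0 3 * dot z w.
  rewrite mulmx_sum_row dot_suml !big_ord_recl big_ord0 addr0 !dotZl !rowK/= !addrA.
  by congr (_ * _ + _ * _ + _ * _ + _ * _); congr (v 0 _); exact: val_inj.
have mulrowsT z (w : 'rV[R]_4) : w *m (rows z)^T = 0 <->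
    [/\ dot w e = 0, dot w x = 0, dot w y = 0 & dot w z = 0].
  have E i : (w *m (rows z)^T) 0 i = dot w (nth 0 [:: e; x; y; z] i).
    by rewrite mxE; apply: eq_bigr => j _; rewrite !mxE.
  split=> [w0|[h0 h1 h2 h3]].
    by have := E 0; have := E 1; have := E 2; have := E 3; rewrite w0 !mxE/=.
  apply/rowP => i; rewrite E mxE.
  by case: i => [[|[|[|[|//]]]] hi].
(* A zero last row makes the matrix singular, which yields a nonzero vector orthogonal to [e], [x]
   and [y]. *)
have [n n0 /mulrowsT [ne nx ny _]] : exists2 n : 'rV[R]_4, n != 0 & n *m (rows 0)^T = 0.
  apply/det0P; rewrite det_tr; apply/det0P; exists (delta_mx 0 3).
    by apply/eqP => /rowP/(_ 3); rewrite !mxE eqxx/= => /eqP; rewrite oner_eq0.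
  by rewrite -rowE rowK.
have nn : dot n n != 0 by rewrite dot_eq0.
have nn0 : 0 < dot n n by rewrite lt_def nn dot_ge0.
(* With [n] as last row the matrix is invertible: pairing a linear relation between its rows with
   each row kills all four coefficients. *)
have inj w : dot w e = 0 -> dot w x = 0 -> dot w y = 0 -> dot w n = 0 -> w = 0.
  move=> h0 h1 h2 h3; apply/eqP/negPn/negP => w0.
  have /eqP : \det (rows n)^T == 0.
    by apply/det0P; exists w => //; apply/mulrowsT.
  rewrite det_tr => /eqP /det0P [v v0 vn].
  have He := mulrows n v e; have Hx := mulrows n v x.
  have Hy := mulrows n v y; have Hn := mulrows n v n.
  move: He Hx Hy Hn; rewrite vn !dot0l.
  rewrite ee xe ye ne (dotC e x) (dotC e y) (dotC e n) (dotC y x) xe ye ne xx xy yy nx ny.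
  rewrite (dotC x n) (dotC y n) nx ny.
  rewrite !(mulr0, mulr1, addr0, add0r) => /esym ve /esym vx /esym vy /esym vnn.
  have v1 : v 0 1 = 0.
    apply: (mulIf D0); rewrite mul0r.
    transitivity (c * (v 0 1 * a + v 0 2 * b) - b * (v 0 1 * b + v 0 2 * c)); first ring.
    by rewrite vx vy; ring.
  have v2 : v 0 2 = 0.
    apply: (mulIf D0); rewrite mul0r.
    transitivity (a * (v 0 1 * b + v 0 2 * c) - b * (v 0 1 * a + v 0 2 * b)); first ring.
    by rewrite vx vy; ring.
  have v3 : v 0 3 = 0 by apply: (mulIf nn); rewrite mul0r.
  move/eqP: v0; apply; apply/rowP => i; rewrite mxE.
  case: i => [[|[|[|[|//]]]] hi]; [rewrite -[RHS]ve|rewrite -[RHS]v1|rewrite -[RHS]v2|rewrite -[RHS]v3];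
  by congr (v _ _); exact: val_inj.
exists (fun u => dot u n / Num.sqrt (dot n n)) => u v.
(* The difference between [u] and its expansion in [e], [x], [y], [n] is orthogonal to all four
   vectors. *)
have /eqP := inj (u - (dot u e *: e + ((c * dot u x - b * dot u y) / (a * c - b ^+ 2)) *: x
  + ((a * dot u y - b * dot u x) / (a * c - b ^+ 2)) *: y + (dot u n / dot n n) *: n))
  ltac:(rewrite dotDl dotNl !dotDl !dotZl ee xe ye ne; ring)
  ltac:(rewrite dotDl dotNl !dotDl !dotZl (dotC e x) xe xx (dotC y x) xy nx; by field; rewrite D0 nn)
  ltac:(rewrite dotDl dotNl !dotDl !dotZl (dotC e y) ye xy yy ny; by field; rewrite D0 nn)
  ltac:(rewrite dotDl dotNl !dotDl !dotZl (dotC e n) (dotC x n) (dotC y n) ne nx ny; by field; rewrite D0 nn).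
rewrite subr_eq0 => /eqP uE; rewrite {1}uE !dotDl !dotZl.
rewrite (dotC e v) (dotC x v) (dotC y v) (dotC n v).
have s2 : Num.sqrt (dot n n) * Num.sqrt (dot n n) = dot n n.
  by rewrite -expr2 sqr_sqrtr// dot_ge0.
rewrite mulrACA -invfM s2; field.
by rewrite D0 nn.
Qed.

(** Multiply the Codazzi equations by [A] and reduce by the Gauss equations: the cubic terms in b
    cancel and f f'' can be divided out, leaving b0 F = b1 E and b0 G = b1 F, a system of
    determinant E G - F^2 up to sign. With b = 0, A^2 det h = (f f'')^2 (E G - F^2) gives the last
    relation. *)
Lemma gauss_codazzi_algebra {R : realType} (E F G A b0 b1 h00 h01 h11 f f1 f2 K : R) :
  0 < f -> f2 != 0 -> 0 < E -> 0 < E * G - F ^+ 2 ->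
  A * h00 - b0 * b0 = - (f * f2) * E ->
  A * h01 - b0 * b1 = - (f * f2) * F ->
  A * h11 - b1 * b1 = - (f * f2) * G ->
  b0 * h01 = b1 * h00 -> b0 * h11 = b1 * h01 ->
  h00 * h11 - h01 * h01 = f ^+ 2 * (K - f1 ^+ 2) * (E * G - F ^+ 2) ->
  [/\ b0 = 0, b1 = 0 & A ^+ 2 * (K - f1 ^+ 2) = f2 ^+ 2].
Proof.
move=> f0 f20 E0 D0 e00 e01 e11 c0 c1 dh.
have ff0 : f * f2 != 0 by rewrite mulf_neq0// gt_eqF.
have D1 : E * G - F ^+ 2 != 0 by rewrite gt_eqF.
have E1 : E != 0 by rewrite gt_eqF.
have a00 : A * h00 = b0 * b0 - f * f2 * E by lra.
have a01 : A * h01 = b0 * b1 - f * f2 * F by lra.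
have a11 : A * h11 = b1 * b1 - f * f2 * G by lra.
have k0 : b0 * F = b1 * E.
  apply: (mulfI ff0); have : b0 * (A * h01) = b1 * (A * h00) by rewrite mulrCA c0; ring.
  rewrite a00 a01; lra.
have k1 : b0 * G = b1 * F.
  apply: (mulfI ff0); have : b0 * (A * h11) = b1 * (A * h01) by rewrite mulrCA c1; ring.
  rewrite a01 a11; lra.
have b00 : b0 = 0.
  apply: (mulIf D1); rewrite mul0r.
  transitivity (E * (b0 * G) - F * (b0 * F)); first ring.
  by rewrite k0 k1; ring.
have b10 : b1 = 0 by apply: (mulIf E1); rewrite -k0 b00 !mul0r.
split=> //; move: a00 a01 a11; rewrite b00 b10 !mul0r !sub0r => a00 a01 a11.
have fD : f ^+ 2 * (E * G - F ^+ 2) != 0 by rewrite mulf_neq0// expf_neq0// gt_eqF.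
apply: (mulfI fD).
transitivity ((A * h00) * (A * h11) - (A * h01) * (A * h01)).
  transitivity (A ^+ 2 * (h00 * h11 - h01 * h01)); last by ring.
  by rewrite dh; ring.
by rewrite a00 a01 a11; ring.
Qed.

(** On a ball inside [U] the mean value inequality with constant 0 makes [s] constant, so its level
    sets are relatively open and closed in [U]. *)
Lemma locally_constant_connected {R : realType} (V : normedModType R)
    (U : set V) (s : V -> R) : open U -> connected U ->
  (forall q, U q -> differentiable s q) ->
  (forall q v, U q -> 'D_v s q = 0) ->
  forall p q, U p -> U q -> s p = s q.
Proof.
move=> oU cU ds Ds p q Up Uq.
have loc x : U x -> \forall y \near x, U y /\ s y = s x.
  move=> Ux; have : \forall y \near x, U y by exact: open_nbhs_nbhs.
  move=> /nbhs_normP[r /= r0 hr]; apply/nbhs_normP; exists r => //= y xy.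
  split; first exact: hr.
  have Ut (t : R) : 0 <= t <= 1 -> U (x + t *: (y - x)).
    move=> /andP[t0 t1]; apply: hr; rewrite /ball_/= opprD addNKr normrN.
    apply: le_lt_trans xy; rewrite normrZ ger0_norm// distrC.
    by rewrite ler_piMl.
  have dt (t : R) : 0 <= t <= 1 -> is_derive t 1 (fun t => s (x + t *: (y - x))) 0.
    by move=> t01; rewrite -(Ds _ (y - x) (Ut t t01)); apply: is_derive_path; exact: ds (Ut t t01).
  suff : `|s (x + 1 *: (y - x)) - s (x + 0 *: (y - x))| <= 0 * (1 - 0).
    by rewrite scale1r scale0r addr0 subrKC mul0r normr_le0 subr_eq0 => /eqP.
  apply: (@mean_value_le R (fun t => s (x + t *: (y - x))) (fun=> 0)) => //.
  - by move=> t; rewrite in_itv/= => /andP[? ?]; apply: dt; rewrite !ltW.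
  - apply: derivable_within_continuous => t; rewrite in_itv/= => t01.
    by have [] := dt t t01.
  - by move=> t _; rewrite normr0.
have openS (P : R -> Prop) : open (U `&` [set x | P (s x)]).
  rewrite openE => x [/= Ux Px]; rewrite /interior/=.
  by apply: filterS (loc x Ux) => y [Uy sy]; split=> //=; rewrite /mkset sy.
have : [set x | U x /\ s x = s p] = U.
  apply: cU; first by exists p.
    exists (U `&` [set x | s x = s p]); first exact: openS (fun z => z = s p).
    by rewrite setIA setIid.
  exists (~` (U `&` [set x | s x <> s p])).
    by apply: open_closedC; exact: openS (fun z => z <> s p).
  apply/seteqP; split=> x /=; first by move=> [Ux E]; split=> // -[].
  by move=> [Ux h]; split=> //; apply: contrapT => h'; apply: h.
by move=> /seteqP [_ /(_ q Uq) []].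
Qed.

Lemma derive_comm_mx {R : realType} (V : normedModType R) m n (D : set V)
    (X : V -> 'M[R]_(m, n)) u v x : open D -> D x -> Ck 2 D X ->
  'D_u ('D_v X) x = 'D_v ('D_u X) x.
Proof.
move=> oD Dx CX.
have dX w y : D y -> derivable X y w.
  by move=> Dy; apply: diff_derivable; have [+ _] := CX; apply.
have dDX w w' y : D y -> derivable ('D_w X) y w'.
  by move=> Dy; apply: diff_derivable; have [_ /(_ w)[+ _]] := CX; apply.
have E w w' i j : ('D_w ('D_w' X) x) i j = 'D_w ('D_w' (fun y => X y i j)) x.
  rewrite derive_mx; last exact: dDX.
  rewrite mxE; apply: near_eq_derive.
  have : \forall y \near x, D y by exact: open_nbhs_nbhs.
  by apply: filterS => y Dy; rewrite derive_mx ?mxE//; exact: dX.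
apply/matrixP => i j; apply: (etrans (E u v i j)); apply: etrans (esym (E v u i j)).
apply: (@Ck2_symmetric R V D (fun y => X y i j)) => //.
by have := (Ck_mxP 2 X oD).1 CX i j.
Qed.

Lemma is_derive_comp_linear {R : realType} (V V' W : normedModType R)
    (l : {linear V' -> V}) (a : V -> W) x v da :
  is_derive (l x) (l v) a da -> is_derive x v (a \o l) da.
Proof.
move=> [h1 h2]; apply: DeriveDef; first exact: derivable_comp_linear.
by rewrite derive_comp_linear.
Qed.

(* The functions [X1], [X2], [X3] and [dc] are the successive derivatives of the
   embedding and those of the Christoffel symbols [c]; keeping them abstract
   prevents unification from unfolding the derivatives. *)
Section WarpedHypersurface.
Context {R : realType}.
Let V : normedModType R := (R * 'rV[R]_2)%type.
Variables (M : set V) (f f1 f2 : R -> R) (g : 'I_2 -> 'I_2 -> 'rV[R]_2 -> R).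
Variables (c : 'I_2 -> 'I_2 -> 'I_2 -> 'rV[R]_2 -> R).
Variables (dc : 'I_2 -> 'I_2 -> 'I_2 -> 'I_2 -> 'rV[R]_2 -> R) (K : 'rV[R]_2 -> R).
Variables (X1 : V -> V -> 'rV[R]_4) (X2 : V -> V -> V -> 'rV[R]_4).
Variable (X3 : V -> V -> V -> V -> 'rV[R]_4).
Let et : V := (1, 0).
Let ei (i : 'I_2) : V := (0, delta_mx 0 i).
Let dg k i j q : R := \sum_l (g j l q * c l k i q + g i l q * c l k j q).
Hypothesis M_open : open M.
Hypothesis f_gt0 : forall p, M p -> 0 < f p.1.
Hypothesis f2_neq0 : forall p, M p -> f2 p.1 != 0.
Hypothesis f_der : forall p, M p -> is_derive p.1 1 f (f1 p.1).
Hypothesis f1_der : forall p, M p -> is_derive p.1 1 f1 (f2 p.1).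
Hypothesis g_sym : forall i j q, g i j q = g j i q.
Hypothesis c_sym : forall l i j q, c l i j q = c l j i q.
Hypothesis g_pos : forall p, M p -> 0 < g 0 0 p.2.
Hypothesis g_det : forall p, M p -> 0 < g 0 0 p.2 * g 1 1 p.2 - g 0 1 p.2 ^+ 2.
Hypothesis g_der : forall k i j p, M p ->
  is_derive p.2 (delta_mx 0 k) (g i j) (dg k i j p.2).
Hypothesis c_der : forall k l i j p, M p ->
  is_derive p.2 (delta_mx 0 k) (c l i j) (dc k l i j p.2).
Hypothesis curvatureE : forall p, M p ->
  \sum_l g 0 l p.2 * (dc 0 l 1 1 p.2 - dc 1 l 0 1 p.2 +
    \sum_m (c l 0 m p.2 * c m 1 1 p.2 - c l 1 m p.2 * c m 0 1 p.2)) =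
  K p.2 * (g 0 0 p.2 * g 1 1 p.2 - g 0 1 p.2 ^+ 2).
Hypothesis X1_der : forall u v p, M p -> is_derive p u (X1 v) (X2 u v p).
Hypothesis X2_der : forall u v w p, M p -> is_derive p u (X2 v w) (X3 u v w p).
Hypothesis X2_sym : forall u v p, M p -> X2 u v p = X2 v u p.
Hypothesis X3_sym : forall u v w p, M p -> X3 u v w p = X3 v u w p.
Hypothesis iso_tt : forall p, M p -> dot (X1 et p) (X1 et p) = 1.
Hypothesis iso_ti : forall i p, M p -> dot (X1 (ei i) p) (X1 et p) = 0.
Hypothesis iso_ij : forall i j p, M p ->
  dot (X1 (ei i) p) (X1 (ei j) p) = f p.1 ^+ 2 * g i j p.2.

(** All structure equations below come from this: an inner product known on the open set [M] is
    differentiated by the product rule. *)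
Lemma derive_dot_eq (A B : V -> 'rV[R]_4) (m : V -> R) (dA dB : 'rV[R]_4) (a : R)
    (u p : V) : M p -> (forall y, M y -> dot (A y) (B y) = m y) ->
  is_derive p u A dA -> is_derive p u B dB -> is_derive p u m a ->
  dot dA (B p) + dot (A p) dB = a.
Proof.
move=> Mp ABm hA hB [_ <-]; have [_ <-] := is_derive_dot hA hB.
apply: near_eq_derive; have : \forall y \near p, M y by exact: open_nbhs_nbhs.
by apply: filterS.
Qed.

Let base_der (a : R -> R) da (p : V) : is_derive p.1 1 a da ->
  is_derive p et (fun y : V => a y.1) da.
Proof. exact: (@is_derive_comp_linear _ _ _ _ (@fst R 'rV[R]_2) a p et). Qed.

Let base_der0 (a : R -> R) (p : V) i : is_derive p (ei i) (fun y : V => a y.1) 0.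
Proof.
apply: (@is_derive_comp_linear _ _ _ _ (@fst R 'rV[R]_2) a p (ei i)).
exact: is_derive0.
Qed.

Let fiber_der (a : 'rV[R]_2 -> R) da (p : V) k : is_derive p.2 (delta_mx 0 k) a da ->
  is_derive p (ei k) (fun y : V => a y.2) da.
Proof. exact: (@is_derive_comp_linear _ _ _ _ (@snd R 'rV[R]_2) a p (ei k)). Qed.

Let fiber_der0 (a : 'rV[R]_2 -> R) (p : V) : is_derive p et (fun y : V => a y.2) 0.
Proof.
apply: (@is_derive_comp_linear _ _ _ _ (@snd R 'rV[R]_2) a p et).
exact: is_derive0.
Qed.

Let mul_der_t (a : R -> R) (b : 'rV[R]_2 -> R) da (p : V) : is_derive p.1 1 a da ->
  is_derive p et (fun y : V => a y.1 * b y.2) (da * b p.2).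
Proof.
move=> ha; apply: is_derive_eq; first exact: is_deriveM (base_der ha) (fiber_der0 b p).
by rewrite /GRing.scale/= mulr0 add0r mulrC.
Qed.

Let mul_der_i (a : R -> R) (b : 'rV[R]_2 -> R) db (p : V) k :
  is_derive p.2 (delta_mx 0 k) b db ->
  is_derive p (ei k) (fun y : V => a y.1 * b y.2) (a p.1 * db).
Proof.
move=> hb; apply: is_derive_eq; first exact: is_deriveM (base_der0 a p k) (fiber_der hb).
by rewrite /GRing.scale/= mulr0 addr0.
Qed.

Let sqr_der (p : V) : M p -> is_derive p.1 1 (fun t => f t ^+ 2) (2 * f p.1 * f1 p.1).
Proof.
move=> Mp; apply: is_derive_eq; first exact: (is_deriveX 2 (f_der Mp)).
by rewrite /GRing.scale/= expr1.
Qed.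

Let ff1_der (p : V) : M p -> is_derive p.1 1 (fun t => - (f t * f1 t))
  (- (f1 p.1 ^+ 2 + f p.1 * f2 p.1)).
Proof.
move=> Mp; apply: is_deriveN; apply: is_derive_eq.
  exact: is_deriveM (f_der Mp) (f1_der Mp).
by rewrite /GRing.scale/= addrC expr2.
Qed.

Lemma Xtt_Xt p : M p -> dot (X2 et et p) (X1 et p) = 0.
Proof.
move=> Mp; have := derive_dot_eq Mp iso_tt (X1_der et et Mp) (X1_der et et Mp)
  (is_derive_cst (1 : R) p et).
by rewrite (dotC (X1 et p)); lra.
Qed.

Lemma Xit_Xt i p : M p -> dot (X2 (ei i) et p) (X1 et p) = 0.
Proof.
move=> Mp; have := derive_dot_eq Mp iso_tt (X1_der (ei i) et Mp) (X1_der (ei i) et Mp)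
  (is_derive_cst (1 : R) p (ei i)).
by rewrite (dotC (X1 et p)); lra.
Qed.

Lemma Xi_Xtt i p : M p -> dot (X1 (ei i) p) (X2 et et p) = 0.
Proof.
move=> Mp; have := derive_dot_eq Mp (iso_ti i) (X1_der et (ei i) Mp) (X1_der et et Mp)
  (is_derive_cst 0 p et).
by rewrite (X2_sym et (ei i) Mp) Xit_Xt// add0r.
Qed.

Lemma Xit_Xj_skew i j p : M p ->
  dot (X2 (ei i) et p) (X1 (ei j) p) + dot (X2 (ei i) (ei j) p) (X1 et p) = 0.
Proof.
move=> Mp; have := derive_dot_eq Mp (iso_ti j) (X1_der (ei i) (ei j) Mp)
  (X1_der (ei i) et Mp) (is_derive_cst 0 p (ei i)).
by rewrite (dotC (X1 (ei j) p)) addrC.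
Qed.

(** By [Xit_Xj_skew] the left side is -<X_ij, X_t>, hence symmetric in [i] and [j]; twice it is the
    t-derivative of f^2 g_ij. *)
Lemma Xit_Xj i j p : M p ->
  dot (X2 (ei i) et p) (X1 (ei j) p) = f p.1 * f1 p.1 * g i j p.2.
Proof.
move=> Mp; have := derive_dot_eq Mp (iso_ij i j) (X1_der et (ei i) Mp)
  (X1_der et (ei j) Mp) (mul_der_t (g i j) (sqr_der Mp)).
rewrite (X2_sym et (ei i) Mp) (X2_sym et (ei j) Mp) (dotC (X1 (ei i) p)).
have := Xit_Xj_skew i j Mp; have := Xit_Xj_skew j i Mp.
rewrite (X2_sym (ei i) (ei j) Mp); lra.
Qed.

Lemma Xt_Xij i j p : M p ->
  dot (X1 et p) (X2 (ei i) (ei j) p) = - (f p.1 * f1 p.1) * g i j p.2.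
Proof.
move=> Mp; have := Xit_Xj_skew i j Mp; rewrite Xit_Xj// (dotC (X1 et p)); lra.
Qed.

(** Koszul's argument: a combination of three derivatives of the products <X_i, X_j> isolates one
    term, and the Christoffel symbols come out of the same combination for [g]. *)
Lemma Xk_Xij i j k p : M p -> dot (X1 (ei k) p) (X2 (ei i) (ei j) p) =
  f p.1 ^+ 2 * \sum_l g k l p.2 * c l i j p.2.
Proof.
move=> Mp.
have D a b d := derive_dot_eq Mp (iso_ij b d) (X1_der (ei a) (ei b) Mp)
  (X1_der (ei a) (ei d) Mp) (mul_der_i (fun t => f t ^+ 2) (g_der a b d Mp)).
have := D i j k; have := D j i k; have := D k i j.
rewrite (X2_sym (ei j) (ei i) Mp) (X2_sym (ei k) (ei i) Mp) (X2_sym (ei k) (ei j) Mp).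
rewrite !(dotC _ (X1 (ei k) p)) !(dotC _ (X1 (ei j) p)).
rewrite /dg !sum_ord2 !(c_sym _ j i) !(c_sym _ k i) !(c_sym _ k j); lra.
Qed.

(** The third derivative X_tij is eliminated between the t-derivative of <X_t, X_ij> and the
    derivative along [ei i] of <X_t, X_tj> = 0. *)
Lemma gauss_t i j p : M p ->
  dot (X2 et et p) (X2 (ei i) (ei j) p) - dot (X2 (ei i) et p) (X2 (ei j) et p) =
  - (f1 p.1 ^+ 2 + f p.1 * f2 p.1) * g i j p.2.
Proof.
move=> Mp.
have D1 := derive_dot_eq Mp (Xt_Xij i j) (X1_der et et Mp)
  (X2_der et (ei i) (ei j) Mp) (mul_der_t (g i j) (ff1_der Mp)).
have H0 y : M y -> dot (X1 et y) (X2 et (ei j) y) = 0.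
  by move=> My; rewrite dotC (X2_sym et (ei j) My) Xit_Xt.
have D2 := derive_dot_eq Mp H0 (X1_der (ei i) et Mp)
  (X2_der (ei i) et (ei j) Mp) (is_derive_cst 0 p (ei i)).
move: D1 D2; rewrite (X3_sym et (ei i) (ei j) Mp) (X2_sym et (ei j) Mp); lra.
Qed.

(** X_01i cancels between the derivative of <X_t, X_1i> along [ei 0] and that of <X_t, X_0i> along
    [ei 1]. *)
Lemma codazzi_t i p : M p ->
  dot (X2 (ei 0) et p) (X2 (ei 1) (ei i) p) - dot (X2 (ei 1) et p) (X2 (ei 0) (ei i) p) =
  - (f p.1 * f1 p.1) * (dg 0 1 i p.2 - dg 1 0 i p.2).
Proof.
move=> Mp.
have D j k := derive_dot_eq Mp (Xt_Xij k i) (X1_der (ei j) et Mp)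
  (X2_der (ei j) (ei k) (ei i) Mp) (mul_der_i (fun t => - (f t * f1 t)) (g_der j k i Mp)).
have := D 0 1; have := D 1 0; rewrite (X3_sym (ei 1) (ei 0) (ei i) Mp); lra.
Qed.

(** X_011 cancels between the derivative of <X_0, X_11> along [ei 0] and that of <X_0, X_01> along
    [ei 1]. *)
Lemma gauss_fiber p : M p ->
  dot (X2 (ei 0) (ei 0) p) (X2 (ei 1) (ei 1) p)
   - dot (X2 (ei 0) (ei 1) p) (X2 (ei 0) (ei 1) p) =
  f p.1 ^+ 2 * (\sum_l (dg 0 0 l p.2 * c l 1 1 p.2 + g 0 l p.2 * dc 0 l 1 1 p.2)
     - \sum_l (dg 1 0 l p.2 * c l 0 1 p.2 + g 0 l p.2 * dc 1 l 0 1 p.2)).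
Proof.
move=> Mp.
have S a k i j : is_derive p.2 (delta_mx 0 a) (fun q => \sum_l g k l q * c l i j q)
    (\sum_l (dg a k l p.2 * c l i j p.2 + g k l p.2 * dc a l i j p.2)).
  rewrite (_ : (fun q => _) = \sum_l (g k l * c l i j)); last first.
    by apply/funext => q; rewrite fct_sumE.
  apply: is_derive_sum => l; apply: is_derive_eq.
    exact: is_deriveM (g_der a k l Mp) (c_der a l i j Mp).
  by rewrite /GRing.scale/= addrC mulrC.
have D1 := derive_dot_eq Mp (Xk_Xij 1 1 0) (X1_der (ei 0) (ei 0) Mp)
  (X2_der (ei 0) (ei 1) (ei 1) Mp) (mul_der_i (fun t => f t ^+ 2) (S 0 0 1 1)).
have D2 := derive_dot_eq Mp (Xk_Xij 0 1 0) (X1_der (ei 1) (ei 0) Mp)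
  (X2_der (ei 1) (ei 0) (ei 1) Mp) (mul_der_i (fun t => f t ^+ 2) (S 1 0 0 1)).
move: D1 D2; rewrite (X3_sym (ei 1) (ei 0) (ei 1) Mp) (X2_sym (ei 1) (ei 0) Mp); lra.
Qed.

(** The normal coordinate [nu] exists only at [p], so the conclusions avoid it: A^2 appears as
    |X_tt|^2, and b_i = 0 as X_it = (f'/f) X_i. *)
Lemma hypersurface_pointwise p : M p ->
  dot (X2 et et p) (X2 et et p) * (K p.2 - f1 p.1 ^+ 2) = f2 p.1 ^+ 2 /\
  forall i v, dot (X2 (ei i) et p) v = f1 p.1 / f p.1 * dot (X1 (ei i) p) v.
Proof.
move=> Mp; have f0 := f_gt0 Mp; have D0 := g_det Mp; have g0 := g_pos Mp.
have f0' : f p.1 != 0 by rewrite gt_eqF.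
have D1 : g 0 0 p.2 * g 1 1 p.2 - g 0 1 p.2 ^+ 2 != 0 by rewrite gt_eqF.
have gram : f p.1 ^+ 2 * g 0 0 p.2 * (f p.1 ^+ 2 * g 1 1 p.2)
    - (f p.1 ^+ 2 * g 0 1 p.2) ^+ 2 =
    f p.1 ^+ 2 * f p.1 ^+ 2 * (g 0 0 p.2 * g 1 1 p.2 - g 0 1 p.2 ^+ 2) by ring.
have gram0 : f p.1 ^+ 2 * g 0 0 p.2 * (f p.1 ^+ 2 * g 1 1 p.2)
    - (f p.1 ^+ 2 * g 0 1 p.2) ^+ 2 != 0.
  by rewrite gram !mulf_neq0// expf_neq0.
have [nu nuE] := normal_functional (iso_tt Mp) (iso_ti 0 Mp) (iso_ti 1 Mp)
  (iso_ij 0 0 Mp) (iso_ij 0 1 Mp) (iso_ij 1 1 Mp) gram0.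
rewrite gram in nuE.
have it_dot i v : dot (X2 (ei i) et p) v =
    f1 p.1 / f p.1 * dot (X1 (ei i) p) v + nu (X2 (ei i) et p) * nu v.
  rewrite nuE Xit_Xt// !Xit_Xj// (dotC _ v).
  have -> : dot v (X1 (ei i) p) = if i == 0 then dot v (X1 (ei 0) p) else dot v (X1 (ei 1) p).
    by case: (ord2P i) => ->.
  congr (_ + _); rewrite (g_sym i 0).
  by case: (ord2P i) => -> /=; rewrite ?(g_sym 1 0); field; rewrite f0' D1.
have gt i j := gauss_t i j Mp.
have ct i := codazzi_t i Mp.
have gf := gauss_fiber Mp.
have curv := curvatureE Mp.
(* Gauss formula: the tangential part of X_ij has component -f f' g_ij along X_t and the Christoffel
   symbols along the fiber. *)
have ij_dot i j v : dot (X2 (ei i) (ei j) p) v =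
   - (f p.1 * f1 p.1) * g i j p.2 * dot (X1 et p) v
   + (c 0 i j p.2 * dot (X1 (ei 0) p) v + c 1 i j p.2 * dot (X1 (ei 1) p) v)
   + nu (X2 (ei i) (ei j) p) * nu v.
  rewrite nuE !(dotC _ (X1 _ p)) Xt_Xij// !Xk_Xij// !sum_ord2 ?(g_sym 1 0).
  by congr (_ + _); rewrite -addrA; congr (_ + _); field; rewrite f0' D1.
set A := nu (X2 et et p).
set b0 := nu (X2 (ei 0) et p); set b1 := nu (X2 (ei 1) et p).
set h00 := nu (X2 (ei 0) (ei 0) p); set h01 := nu (X2 (ei 0) (ei 1) p).
set h11 := nu (X2 (ei 1) (ei 1) p).
have tt_dot v : dot (X2 et et p) v = A * nu v.
  rewrite nuE Xtt_Xt// !(dotC _ (X1 (ei _) p)) !Xi_Xtt//.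
  by rewrite /A; field; rewrite f0' D1.
have e i j : A * nu (X2 (ei i) (ei j) p) - nu (X2 (ei i) et p) * nu (X2 (ei j) et p) =
    - (f p.1 * f2 p.1) * g i j p.2.
  have := gt i j; rewrite tt_dot it_dot (dotC (X1 (ei i) p)) Xit_Xj// (g_sym j i).
  have -> : f1 p.1 / f p.1 * (f p.1 * f1 p.1 * g i j p.2) = f1 p.1 ^+ 2 * g i j p.2.
    by field.
  lra.
(* The tangential contributions match the right side of [codazzi_t], and only the normal ones
   remain. *)
have co i : b0 * nu (X2 (ei 1) (ei i) p) = b1 * nu (X2 (ei 0) (ei i) p).
  have := ct i; rewrite !it_dot !Xk_Xij//.
  have fE x : f1 p.1 / f p.1 * (f p.1 ^+ 2 * x) = f p.1 * f1 p.1 * x by field.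
  rewrite !fE.
  rewrite -/b0 -/b1 /dg !sum_ord2.
  by case: (ord2P i) => ->; rewrite ?(g_sym 1 0) ?(c_sym _ 1 0); lra.
have [b00 b10 KE] : [/\ b0 = 0, b1 = 0 & A ^+ 2 * (K p.2 - f1 p.1 ^+ 2) = f2 p.1 ^+ 2].
  apply: (@gauss_codazzi_algebra R (g 0 0 p.2) (g 0 1 p.2) (g 1 1 p.2) A b0 b1
    h00 h01 h11 (f p.1) (f1 p.1) (f2 p.1) (K p.2) f0 (f2_neq0 Mp) g0 D0) => //.
  - exact: e.
  - exact: e.
  - exact: e.
  - by have := co 0; rewrite (X2_sym (ei 1) (ei 0) Mp).
  - exact: co.
  (* Besides det h, the Gauss formula contributes f^2 f'^2 det g from the components along X_t, and
     Christoffel terms that combine with the right side of [gauss_fiber] into the curvature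
     [curv]. *)
  move: gf; rewrite !ij_dot !Xt_Xij// !Xk_Xij// -/h00 -/h01 -/h11.
  have -> : h00 * h11 - h01 * h01 =
    (h00 * h11 + 0) - (h01 * h01 + 0) by rewrite !addr0.
  move: curv; rewrite /dg !sum_ord2 ?(g_sym 1 0) ?(c_sym _ 1 0).
  move=> curv gf.
  rewrite -[RHS]mulrA mulrBl -curv; move: gf; lra.
split; first by rewrite tt_dot -expr2.
move=> i v; rewrite it_dot.
by case: (ord2P i) => ->; rewrite -?/b0 -?/b1 ?b00 ?b10 mul0r addr0.
Qed.

(** X_i is orthogonal to X_tt, and so is X_it = (f'/f) X_i. The t-derivative of the first relation
    gives <X_i, X_ttt> = 0, hence <X_it, X_ttt> = 0, and then that of the second gives the claim:
    |X_tt|^2 has zero derivative along the fiber. *)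
Lemma Xitt_Xtt i p : M p -> dot (X3 (ei i) et et p) (X2 et et p) = 0.
Proof.
move=> Mp.
have H1 y : M y -> dot (X2 (ei i) et y) (X2 et et y) = 0.
  by move=> My; have [_ ->] := hypersurface_pointwise My; rewrite Xi_Xtt// mulr0.
have D1 := derive_dot_eq Mp H1 (X2_der et (ei i) et Mp) (X2_der et et et Mp)
  (is_derive_cst 0 p et).
have D2 := derive_dot_eq Mp (Xi_Xtt i) (X1_der et (ei i) Mp) (X2_der et et et Mp)
  (is_derive_cst 0 p et).
move: D1 D2; rewrite (X2_sym et (ei i) Mp) H1// add0r => D1 D2.
have [_ E] := hypersurface_pointwise Mp.
by move: D1; rewrite E D2 mulr0 addr0 (X3_sym et (ei i) et Mp).
Qed.

End WarpedHypersurface.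

Lemma Ck_dot {R : realType} (V : normedModType R) n k (D : set V)
    (A B : V -> 'rV[R]_n) : open D -> Ck k D A -> Ck k D B ->
  Ck k D (fun x => dot (A x) (B x)).
Proof.
move=> oD /(Ck_mxP _ _ oD) CA /(Ck_mxP _ _ oD) CB.
by apply: Ck_sum => // i; apply: CkM.
Qed.

Lemma metric_form_delta {R : realType} (g : 'rV[R]_2 -> 'M[R]_2) q i j :
  metric_form g q (delta_mx 0 i) (delta_mx 0 j) = g q i j.
Proof.
rewrite /metric_form !sum_ord2 !mxE /=.
by case: (ord2P i) => ->; case: (ord2P j) => -> /=; ring.
Qed.

Lemma metric_form0l {R : realType} (g : 'rV[R]_2 -> 'M[R]_2) q v :
  metric_form g q 0 v = 0.
Proof. by rewrite /metric_form !sum_ord2 !mxE; ring. Qed.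

Lemma metric_form0r {R : realType} (g : 'rV[R]_2 -> 'M[R]_2) q v :
  metric_form g q v 0 = 0.
Proof. by rewrite /metric_form !sum_ord2 !mxE; ring. Qed.

Lemma open_prod_set {R : realType} (V W : normedModType R) (A : set V) (B : set W) :
  open A -> open B -> open (A `*` B).
Proof.
move=> oA oB; rewrite openE => -[x y] /= [Ax By]; rewrite /interior/=.
by exists (A, B) => //; split; exact: open_nbhs_nbhs.
Qed.

Lemma smooth_is_derive {R : realType} (V W : normedModType R) (D : set V)
    (a : V -> W) x v : smooth_on D a -> D x -> is_derive x v a ('D_v a x).
Proof. by move=> Ca Dx; apply: is_derive_diff; have [+ _] := Ca 1; apply. Qed.

Lemma smooth_derive {R : realType} (V W : normedModType R) (D : set V)
    (a : V -> W) v : smooth_on D a -> smooth_on D ('D_v a).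
Proof. by move=> Ca k; apply: Ck_derive; exact: Ca. Qed.

(** * Constancy of the fiber curvature *)

Section WarpedEmbedding.
Context {R : realType}.
Variables (I : set R) (U : set 'rV[R]_2) (f : R -> R) (E F G : 'rV[R]_2 -> R).
Hypothesis I_open : open I.
Hypothesis I_nonempty : I !=set0.
Hypothesis U_open : open U.
Hypothesis U_connected : connected U.
Hypothesis U_nonempty : U !=set0.
Hypothesis f_smooth : smooth_on I f.
Hypothesis f_gt0 : forall x, I x -> 0 < f x.
Hypothesis E_smooth : smooth_on U E.
Hypothesis F_smooth : smooth_on U F.
Hypothesis G_smooth : smooth_on U G.
Let g := fiber_metric E F G.
Hypothesis g_posdef : forall q, U q -> forall u : 'rV[R]_2, u != 0 ->
  0 < metric_form g q u u.
Variable X : R * 'rV[R]_2 -> 'rV[R]_4.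
Let M := I `*` U.
Hypothesis X_smooth : smooth_on M X.
Hypothesis X_iso : forall p, M p -> forall v w,
  dot ('d X p v) ('d X p w) = warped_metric f g p v w.
Hypothesis f2_neq0 : forall x, I x -> 'D_1 ('D_1 f) x != 0.

Let et : R * 'rV[R]_2 := (1, 0).
Let ei (i : 'I_2) : R * 'rV[R]_2 := (0, delta_mx 0 i).

Let M_open : open M.
Proof. exact: open_prod_set. Qed.

Let isoD p v w : M p -> dot ('D_v X p) ('D_w X p) = warped_metric f g p v w.
Proof.
move=> Mp; have dX : differentiable X p by have [+ _] := X_smooth 1; apply.
by rewrite !deriveE// X_iso.
Qed.

Let curv q : U q -> \sum_l g q 0 l *
   (partial 0 (christoffel g l 1 1) q - partial 1 (christoffel g l 0 1) q +
    \sum_m (christoffel g l 0 m q * christoffel g m 1 1 q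
            - christoffel g l 1 m q * christoffel g m 0 1 q)) =
  gauss_curvature g q * (g q 0 0 * g q 1 1 - g q 0 1 ^+ 2).
Proof.
move=> Uq; have [_ _ D0] := fiber_metric_det_gt0 g_posdef Uq.
have [-> -> _ ->] := fiber_metricE E F G q.
by rewrite /gauss_curvature det_fiber_metric divfK ?gt_eqF.
Qed.

(** Written with a continuation [P] so that the hypotheses of the abstract section are checked once
    and serve both of its results. *)
Let pointwise_hyps (P : Prop) :
  ((forall p, M p -> dot ('D_et ('D_et X) p) ('D_et ('D_et X) p) *
      (gauss_curvature g p.2 - 'D_1 f p.1 ^+ 2) = 'D_1 ('D_1 f) p.1 ^+ 2) ->
   (forall i p, M p -> dot ('D_(ei i) ('D_et ('D_et X)) p) ('D_et ('D_et X) p) = 0) ->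
   P) -> P.
Proof.
have h1 p : M p -> 0 < f p.1 by move=> [Ip _]; exact: f_gt0.
have h2 p : M p -> 'D_1 ('D_1 f) p.1 != 0 by move=> [Ip _]; exact: f2_neq0.
have h3 p : M p -> is_derive p.1 1 f ('D_1 f p.1).
  by move=> [Ip _]; exact: smooth_is_derive f_smooth Ip.
have h4 p : M p -> is_derive p.1 1 ('D_1 f) ('D_1 ('D_1 f) p.1).
  by move=> [Ip _]; apply: smooth_is_derive Ip; exact: smooth_derive.
have gE q := fiber_metricE E F G q.
have h7 (p : R * 'rV[R]_2) : M p -> 0 < g p.2 0 0.
  by move=> [_ Up]; have [+ _ _] := fiber_metric_det_gt0 g_posdef Up; have [-> _ _ _] := gE p.2.
have h8 (p : R * 'rV[R]_2) : M p -> 0 < g p.2 0 0 * g p.2 1 1 - g p.2 0 1 ^+ 2.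
  by move=> [_ Up]; have [_ _] := fiber_metric_det_gt0 g_posdef Up; have [-> -> _ ->] := gE p.2.
have h9 k i j (p : R * 'rV[R]_2) : M p ->
    is_derive p.2 (delta_mx 0 k) (fun y => g y i j) (\sum_l (g p.2 j l *
     christoffel g l k i p.2 + g p.2 i l * christoffel g l k j p.2)).
  move=> [_ Up]; exact: (is_derive_fiber_metric E_smooth F_smooth G_smooth g_posdef k i j Up).
have h10 k l i j (p : R * 'rV[R]_2) : M p ->
    is_derive p.2 (delta_mx 0 k) (christoffel g l i j) (partial k (christoffel g l i j) p.2).
  move=> [_ Up].
  exact: (is_derive_christoffel U_open E_smooth F_smooth G_smooth g_posdef (delta_mx 0 k) l i j Up).
have h11 (p : R * 'rV[R]_2) (Mp : M p) := curv Mp.2.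
have h12 u v p : M p -> is_derive p u ('D_v X) ('D_u ('D_v X) p).
  by move=> Mp; apply: smooth_is_derive Mp; exact: smooth_derive.
have h13 u v w p : M p -> is_derive p u ('D_v ('D_w X)) ('D_u ('D_v ('D_w X)) p).
  by move=> Mp; apply: smooth_is_derive Mp; do 2?apply: smooth_derive.
have h14 u v p : M p -> 'D_u ('D_v X) p = 'D_v ('D_u X) p.
  by move=> Mp; apply: derive_comm_mx M_open Mp (X_smooth 2).
have h15 u v w p : M p -> 'D_u ('D_v ('D_w X)) p = 'D_v ('D_u ('D_w X)) p.
  by move=> Mp; apply: derive_comm_mx M_open Mp (smooth_derive w X_smooth 2).
have h16 p : M p -> dot ('D_et X p) ('D_et X p) = 1.
  by move=> Mp; rewrite isoD// /warped_metric/= metric_form0l mulr0 addr0 mulr1.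
have h17 i p : M p -> dot ('D_(ei i) X p) ('D_et X p) = 0.
  by move=> Mp; rewrite isoD// /warped_metric/= metric_form0r mulr0 addr0 mul0r.
have h18 i j p : M p -> dot ('D_(ei i) X p) ('D_(ei j) X p) = f p.1 ^+ 2 * g p.2 i j.
  by move=> Mp; rewrite isoD// /warped_metric/= metric_form_delta mul0r add0r.
have gsym i j q := fiber_metric_sym E F G q i j.
have csym l i j q := christoffel_sym E F G l i j q.
have H := @hypersurface_pointwise R M f ('D_1 f) ('D_1 ('D_1 f))
  (fun i j q => g q i j) (christoffel g)
  (fun k l i j q => partial k (christoffel g l i j) q) (gauss_curvature g)
  (fun v => 'D_v X) (fun u v => 'D_u ('D_v X)) (fun u v w => 'D_u ('D_v ('D_w X)))
  M_open h1 h2 h3 h4 gsym csym h7 h8 h9 h10 h11 h12 h13 h14 h15 h16 h17 h18.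
have H' := @Xitt_Xtt R M f ('D_1 f) ('D_1 ('D_1 f))
  (fun i j q => g q i j) (christoffel g)
  (fun k l i j q => partial k (christoffel g l i j) q) (gauss_curvature g)
  (fun v => 'D_v X) (fun u v => 'D_u ('D_v X)) (fun u v w => 'D_u ('D_v ('D_w X)))
  M_open h1 h2 h3 h4 gsym csym h7 h8 h9 h10 h11 h12 h13 h14 h15 h16 h17 h18.
by apply=> [p /H []//|i p Mp]; exact: H'.
Qed.

Lemma warped_embedding_curvature : exists K : R,
  [/\ 0 < K, forall q, U q -> gauss_curvature g q = K &
      forall x, I x -> 'D_1 f x ^+ 2 <= K].
Proof.
apply: pointwise_hyps => HK Hs.
have [t0 It0] := I_nonempty; have [q0 Uq0] := U_nonempty.
pose S p := dot ('D_et ('D_et X) p) ('D_et ('D_et X) p).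
have CS k : Ck k M S.
  by apply: Ck_dot => //; do 2?apply: smooth_derive; exact: X_smooth.
have dS p : M p -> differentiable S p by have [+ _] := CS 1; apply.
have DS i p : M p -> 'D_(ei i) S p = 0.
  move=> Mp; have h : is_derive p (ei i) ('D_et ('D_et X)) ('D_(ei i) ('D_et ('D_et X)) p).
    by apply: smooth_is_derive Mp; do 2?apply: smooth_derive.
  case: (is_derive_dot h h) => _ SE; have Z := Hs i p Mp.
  exact: (etrans SE (etrans (f_equal2 +%R Z (etrans (dotC _ _) Z)) (addr0 0))).
have Mt q : U q -> M (t0, q) by [].
have slice q v : 'D_v (fun q => S (t0, q)) q = 'D_(0, v) S (t0, q).
  rewrite /derive; set a := (X in lim (X @ _) = _); set b := (X in _ = lim (X @ _)).
  suff -> : a = b by [].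
  apply/funext => h; rewrite /a /b /=.
  have -> // : h *: ((0, v) : R * 'rV[R]_2) + (t0, q) = (t0, h *: v + q).
  apply: (f_equal2 pair) => //.
  exact: (etrans (f_equal2 +%R (scaler0 _ h) erefl) (add0r _)).
(* One slice is enough, because the curvature depends on the fiber coordinates only. *)
have Sconst q : U q -> S (t0, q) = S (t0, q0).
  move=> Uq; apply: (locally_constant_connected U_open U_connected
    (s := fun q => S (t0, q))) => // [{}q|{}q v] {}Uq.
    apply: (@differentiable_comp _ _ _ _ (fun q => (t0, q)) S); last exact: dS.
    have [idd _] := is_diff_id q.
    by apply: differentiable_pair; [exact: differentiable_cst|exact: idd].
  rewrite slice deriveE; last exact: dS.
  have -> : ((0, v) : R * 'rV[R]_2) = \sum_i v 0 i *: ei i.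
    rewrite sum_ord2.
    have -> : v 0 0 *: ei 0 + v 0 1 *: ei 1 = (v 0 0 *: (0 : R) + v 0 1 *: (0 : R),
      v 0 0 *: delta_mx 0 0 + v 0 1 *: delta_mx 0 1) by [].
    by rewrite !scaler0 addr0 {1}(row_sum_delta v) sum_ord2.
  rewrite linear_sum big1// => i _; rewrite linearZ/= -deriveE; last exact: dS.
  by rewrite DS// scaler0.
have K_gt p : M p -> 'D_1 f p.1 ^+ 2 < gauss_curvature g p.2.
  move=> Mp; rewrite -subr_gt0; have HKp := HK p Mp.
  have f2p : 0 < 'D_1 ('D_1 f) p.1 ^+ 2.
    by rewrite exprn_even_gt0//=; apply: f2_neq0; case: Mp.
  have := eq_ind_r (fun z => 0 < z) f2p HKp.
  have := dot_ge0 ('D_et ('D_et X) p); move: (dot _ _) (gauss_curvature _ _ - _) => s z.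
  by rewrite le_eqVlt => /predU1P[<-|S0]; rewrite ?mul0r ?ltxx// pmulr_rgt0.
exists (gauss_curvature g q0); split.
- apply: le_lt_trans (K_gt (t0, q0) (conj It0 Uq0)); exact: sqr_ge0.
- move=> q Uq; have h1 := HK _ (Mt q Uq); have h2 := HK _ (Mt q0 Uq0).
  have S0 : S (t0, q0) != 0.
    have := eq_ind_r (fun z => z != 0) (expf_neq0 2 (f2_neq0 It0)) h2.
    by rewrite mulf_eq0 negb_or => /andP[].
  (* Both sides equal the square of f'' at [t0]; the nonzero factor [S (t0, q0)] then cancels. *)
  have h3 : S (t0, q0) * (gauss_curvature g q - 'D_1 f t0 ^+ 2) =
            S (t0, q0) * (gauss_curvature g q0 - 'D_1 f t0 ^+ 2).
    exact: (etrans (f_equal2 *%R (esym (Sconst q Uq)) erefl) (etrans h1 (esym h2))).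
  exact: (addIr _ (mulfI S0 h3)).
- by move=> x Ix; apply/ltW/(K_gt (x, q0)).
Qed.

End WarpedEmbedding.

(** * Local inverses *)

(** The lower bound makes [X] injective on [N] and its inverse Lipschitz with constant 1/c. The
    inverse picks a preimage, with [p0] as default off the image. *)
Lemma left_inverse_of_expanding {R : realType} (V W : normedModType R) (N : set V)
    (X : V -> W) (p0 : V) c : 0 < c ->
  (forall x y, N x -> N y -> c * `|x - y| <= `|X x - X y|) ->
  exists2 psi : W -> V, (forall p, N p -> psi (X p) = p) &
    {within X @` N, continuous psi}.
Proof.
move=> c0 expand; pose psi w := xget p0 [set p | N p /\ X p = w].
have psiK p : N p -> psi (X p) = p.
  move=> Np; have [Nq Xq] : [set q | N q /\ X q = X p] (psi (X p)).
    by apply: xgetPex; exists p.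
  apply/eqP; rewrite -subr_eq0 -normr_le0 -(pmulr_rle0 _ c0).
  by apply: le_trans (expand _ _ Nq Np) _; rewrite Xq subrr normr0.
exists psi => //; apply/subspace_continuousP => w [p Np <-].
suff : psi x @[x --> within (X @` N) (nbhs (X p))] --> psi (X p) by [].
apply/cvgrPdist_lt => e e0; rewrite psiK//.
have : \forall w \near X p, `|X p - w| < c * e.
  by have /cvgrPdist_lt := @cvg_id _ (nbhs (X p)); apply; rewrite mulr_gt0.
rewrite /prop_near1 /within/=; apply: filterS => w' h [q Nq qw'].
rewrite -qw' psiK// -(ltr_pM2l c0); apply: le_lt_trans (expand _ _ Np Nq) _.
by rewrite qw'.
Qed.

Lemma derive_linear {R : realType} (V W : normedModType R) (L : {linear V -> W}) x v :
  continuous L -> 'D_v L x = L v.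
Proof. by move=> Lc; rewrite deriveE ?diff_lin//; exact: linear_differentiable. Qed.

Lemma linear_defect {R : realType} (V W : normedModType R) (a b : W)
    (L : {linear V -> W}) x y :
  `|L (x - y)| <= `|a - L x - (b - L y)| + `|a - b|.
Proof.
rewrite linearB [leRHS]addrC; apply: le_trans (ler_normB _ _).
suff -> : a - b - (a - L x - (b - L y)) = L x - L y by [].
apply/eqP; rewrite subr_eq; apply/eqP.
by rewrite (opprB b) addrACA [L x + _]addrC subrK addKr.
Qed.

Section ProductCoordinates.
Context {R : realType}.

Lemma prod_coord (v : R * 'rV[R]_2) :
  v = v.1 *: (1, 0) + \sum_i v.2 0 i *: (0, delta_mx 0 i).
Proof.
rewrite sum_ord2; case: v => a u /=.
have -> : a *: ((1 : R, 0 : 'rV[R]_2)) + (u 0 0 *: (0 : R, delta_mx 0 0 : 'rV[R]_2) +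
    u 0 1 *: (0 : R, delta_mx 0 1 : 'rV[R]_2)) =
  (a *: (1 : R) + (u 0 0 *: (0 : R) + u 0 1 *: (0 : R)),
   a *: (0 : 'rV[R]_2) + (u 0 0 *: delta_mx 0 0 + u 0 1 *: delta_mx 0 1)) by [].
rewrite !scaler0 !addr0 add0r; congr (_, _); first by rewrite /GRing.scale/= mulr1.
by rewrite {1}(row_sum_delta u) sum_ord2.
Qed.

Lemma norm_fst_le (v : R * 'rV[R]_2) : `|v.1| <= `|v|.
Proof. by rewrite [leRHS]prod_normE le_max lexx. Qed.

Lemma norm_snd_le (v : R * 'rV[R]_2) : `|v.2| <= `|v|.
Proof. by rewrite [leRHS]prod_normE le_max lexx orbT. Qed.

Lemma combination_close m (x y z e n : R) (a b d a' b' d' : 'rV[R]_m) :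
  `|a' - a| < e -> `|b' - b| < e -> `|d' - d| < e ->
  `|x| <= n -> `|y| <= n -> `|z| <= n ->
  `|x *: a + (y *: b + z *: d) - (x *: a' + (y *: b' + z *: d'))| <= n * (3 * e).
Proof.
move=> ha hb hd hx hy hz.
have -> : x *: a + (y *: b + z *: d) - (x *: a' + (y *: b' + z *: d')) =
    x *: (a - a') + (y *: (b - b') + z *: (d - d')).
  by apply/matrixP => i j; rewrite !mxE; ring.
have -> : n * (3 * e) = n * e + (n * e + n * e) by ring.
apply: le_trans (ler_normD _ _) _; apply: lerD.
  by rewrite normrZ ler_pM// distrC ltW.
apply: le_trans (ler_normD _ _) _.
by apply: lerD; rewrite normrZ ler_pM// distrC ltW.
Qed.

(** On a small ball [X] minus ['d X p0] is Lipschitz with constant c/2, whereas ['d X p0] expands by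
    [c]; hence [X] expands by c/2. *)
Lemma local_left_inverse m (N : set (R * 'rV[R]_2)) (X : R * 'rV[R]_2 -> 'rV[R]_m)
    (p0 : R * 'rV[R]_2) c : open N -> N p0 -> Ck 1 N X -> 0 < c ->
  (forall v, c * `|v| <= `|'d X p0 v|) ->
  exists N' : set (R * 'rV[R]_2), [/\ open N', N' p0, N' `<=` N &
    exists2 psi : 'rV[R]_m -> R * 'rV[R]_2, (forall p, N' p -> psi (X p) = p) &
    {within X @` N', continuous psi}].
Proof.
move=> oN Np0 [dX DX] c0 cX.
pose et : R * 'rV[R]_2 := (1, 0).
pose ei (i : 'I_2) : R * 'rV[R]_2 := (0, delta_mx 0 i).
(* A vector has three coordinates, each bounded by its norm and each contributing an error c/6, in
   total c/2. *)
have c6 : 0 < c / 6 by rewrite divr_gt0.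
have Nn : \forall p \near p0, N p by exact: open_nbhs_nbhs.
have trans_lt (a b a' b' : 'rV[R]_m) e : a = a' -> b = b' ->
  `|a - b| < e -> `|a' - b'| < e by move=> -> ->.
have trans_le (a b a' b' : 'rV[R]_m) e : a = a' -> b = b' ->
  `|a' - b'| <= e -> `|a - b| <= e by move=> -> ->.
have near_e (e : R * 'rV[R]_2) : \forall p \near p0, `|'d X p0 e - 'd X p e| < c / 6.
  have : \forall p \near p0, `|'D_e X p0 - 'D_e X p| < c / 6.
    by have /cvgrPdist_lt := DX e p0 Np0; apply.
  apply: filterS2 Nn => p Np.
  exact: trans_lt (deriveE e (dX p0 Np0)) (deriveE e (dX p Np)).
have FF : Filter (nbhs p0) by exact: nbhs_filter.
have := filterI (filterI Nn (near_e et)) (filterI (near_e (ei 0)) (near_e (ei 1))).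
move=> /(_ FF FF FF) /nbhs_normP[r /= r0 hr].
exists (ball p0 r).
have ballE p : ball p0 r p <-> `|p0 - p| < r by rewrite -ball_normE.
split.
- exact: ball_open.
- exact: ballxx.
- by move=> p /ballE /hr [[]].
apply: (@left_inverse_of_expanding _ _ _ _ X p0 (c / 2)); first by rewrite divr_gt0.
have dXC : continuous ('d X p0) by apply: diff_continuous; exact: dX.
have lind y : differentiable ('d X p0) y by exact: linear_differentiable.
have small p v : ball p0 r p -> `|'D_v X p - 'd X p0 v| <= c / 2 * `|v|.
  move=> /ballE /hr [[Np ht] [h0 h1]].
  have E q : 'd X q v =
      v.1 *: 'd X q et + (v.2 0 0 *: 'd X q (ei 0) + v.2 0 1 *: 'd X q (ei 1)).
    by rewrite {1}(prod_coord v) sum_ord2 !linearD !linearZ.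
  apply: (trans_le _ _ _ _ _ (etrans (deriveE v (dX p Np)) (E p)) (E p0)).
  have ent i : `|v.2 0 i| <= `|v| by apply: le_trans (mx_entry_le _ _ _) (norm_snd_le v).
  have -> : c / 2 * `|v| = `|v| * (3 * (c / 6)) by field.
  exact: combination_close ht h0 h1 (norm_fst_le v) (ent 0) (ent 1).
move=> x y Bx By.
pose Y p := X p - 'd X p0 p.
have seg s : 0 <= s <= 1 -> ball p0 r (y + s *: (x - y)).
  move=> /andP[s0 s1]; apply/ballE.
  have -> : p0 - (y + s *: (x - y)) = (1 - s) *: (p0 - y) + s *: (p0 - x).
    rewrite !scalerBr !scalerBl !scale1r !opprD !opprK.
    by rewrite [RHS]addrACA subrK (addrC (- y)) -!addrA; congr (_ + _);
      rewrite addrCA [RHS]addrC -addrA addrC.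
  move/ballE : Bx => Bx; move/ballE : By => By.
  apply: le_lt_trans (ler_normD _ _) _.
  rewrite !normrZ (ger0_norm s0) ger0_norm ?subr_ge0//.
  have [->|s_gt0] := eqVneq s 0; first by rewrite subr0 mul1r mul0r addr0.
  have -> : r = (1 - s) * r + s * r by ring.
  apply: ler_ltD; first by rewrite ler_wpM2l ?subr_ge0// ltW.
  by rewrite ltr_pM2l// lt_def s_gt0.
have NB p : ball p0 r p -> N p by move=> /ballE /hr [[]].
have : `|Y (y + (x - y)) - Y y| <= c / 2 * `|x - y|.
  apply: mean_value_segment => s s01; have Bs := seg s s01.
    by apply: differentiableB; [exact: dX (NB _ Bs)|exact: lind].
  have -> : 'D_(x - y) Y (y + s *: (x - y)) = 'D_(x - y) X (y + s *: (x - y)) - 'd X p0 (x - y).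
    exact: (etrans (deriveB (diff_derivable (dX _ (NB _ Bs)))
      (diff_derivable (lind _))) (f_equal2 (fun a b => a - b) erefl
      (derive_linear _ _ dXC))).
  exact: small.
rewrite subrKC => h.
have := cX (x - y); have := linear_defect (X x) (X y) ('d X p0) x y.
rewrite -/(Y x) -/(Y y); lra.
Qed.

End ProductCoordinates.

(** * Isometries into spheres *)

Lemma sum_ord3 (V : nmodType) (F : 'I_3 -> V) : \sum_i F i = F 0 + F 1 + F 2.
Proof.
rewrite !big_ord_recl big_ord0 addr0 addrA; congr (F _ + F _ + F _);
exact: val_inj.
Qed.

Lemma ord3P (i : 'I_3) : [\/ i = 0, i = 1 | i = 2].
Proof.
by case: i => [[|[|[|//]]] h]; [apply: Or31|apply: Or32|apply: Or33]; apply: val_inj.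
Qed.

Section MovingFrame.
Context {R : realType}.
Variables (U : set 'rV[R]_2) (E F G : 'rV[R]_2 -> R) (K : R).
Hypothesis U_open : open U.
Hypothesis E_smooth : smooth_on U E.
Hypothesis F_smooth : smooth_on U F.
Hypothesis G_smooth : smooth_on U G.
Let g := fiber_metric E F G.
Hypothesis g_posdef : forall q, U q -> forall u : 'rV[R]_2, u != 0 ->
  0 < metric_form g q u u.
Hypothesis K_gt0 : 0 < K.
Hypothesis g_curvature : forall q, U q -> gauss_curvature g q = K.
Let e_ (i : 'I_2) : 'rV[R]_2 := delta_mx 0 i.
Let C := christoffel g.

(* Gauss-Weingarten equations of the sphere of curvature [K]: the matrix of
   d_i acting on the column of rows (y, d_0 y, d_1 y). *)
Let conn (i : 'I_2) (a b : 'I_3) : 'rV[R]_2 -> R :=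
  nth (cst 0) (nth [::] [::
    [:: cst 0; cst (i == 0)%:R; cst (i == 1)%:R];
    [:: (fun q => - K * g q i 0); C 0 i 0; C 1 i 0];
    [:: (fun q => - K * g q i 1); C 0 i 1; C 1 i 1]] a) b.

Let dconn (k i : 'I_2) (a b : 'I_3) : 'rV[R]_2 -> R :=
  nth (cst 0) (nth [::] [::
    [:: cst 0; cst 0; cst 0];
    [:: (fun q => - K * dmetric E F G k i 0 q); partial k (C 0 i 0); partial k (C 1 i 0)];
    [:: (fun q => - K * dmetric E F G k i 1 q); partial k (C 0 i 1); partial k (C 1 i 1)]] a) b.

(** Inner products required of (y, d_0 y, d_1 y): [y] has squared norm 1/K, is orthogonal to its
    derivatives, and these induce [g]. *)
Let gram (a b : 'I_3) : 'rV[R]_2 -> R :=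
  nth (cst 0) (nth [::] [::
    [:: cst K^-1; cst 0; cst 0];
    [:: cst 0; (fun q => g q 0 0); (fun q => g q 0 1)];
    [:: cst 0; (fun q => g q 1 0); (fun q => g q 1 1)]] a) b.

Let dgram (k : 'I_2) (a b : 'I_3) : 'rV[R]_2 -> R :=
  nth (cst 0) (nth [::] [::
    [:: cst 0; cst 0; cst 0];
    [:: cst 0; dmetric E F G k 0 0; dmetric E F G k 0 1];
    [:: cst 0; dmetric E F G k 1 0; dmetric E F G k 1 1]] a) b.

Definition connection i q : 'M[R]_3 := \matrix_(a, b) conn i a b q.
Definition gram_mx q : 'M[R]_3 := \matrix_(a, b) gram a b q.

Lemma connection_smooth i : smooth_on U (connection i).
Proof.
move=> k; apply/Ck_mxP => // a b.
apply: (Ck_eq (f := conn i a b)) => // [q _|]; first by rewrite mxE.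
have Cg x y : Ck k U (fun q => - K * g q x y).
  apply: (CkM (f := fun=> - K)) => //; first exact: Ck_cst.
  exact: fiber_metric_smooth.
have CC x y z : Ck k U (C x y z) by exact: christoffel_smooth.
by rewrite /conn; case: (ord3P a) => ->; case: (ord3P b) => -> //=; exact: Ck_cst.
Qed.

Lemma connection_row0 i q (W : 'M[R]_3) b :
  (connection i q *m W) 0 b = (i == 0)%:R * W 1 b + (i == 1)%:R * W 2 b.
Proof.
rewrite mxE (eq_bigr (fun j => conn i 0 j q * W j b)) => [|j _]; last by rewrite mxE.
by rewrite sum_ord3 /conn /= /cst mul0r add0r.
Qed.

Lemma gram_mx_smooth : smooth_on U gram_mx.
Proof.
move=> k; apply/Ck_mxP => // a b.
apply: (Ck_eq (f := gram a b)) => // [q _|]; first by rewrite mxE.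
have Cg x y : Ck k U (fun q => g q x y) by exact: fiber_metric_smooth.
by rewrite /gram; case: (ord3P a) => ->; case: (ord3P b) => -> //=; exact: Ck_cst.
Qed.

Lemma is_derive_connection k i q : U q ->
  is_derive q (e_ k) (connection i) (\matrix_(a, b) dconn k i a b q).
Proof.
move=> Uq; apply/is_derive_mxP => a b.
have -> : (fun y => connection i y a b) = conn i a b.
  by apply/funext => y; rewrite mxE.
have Dg x y : is_derive q (e_ k) (fun q => - K * g q x y) (- K * dmetric E F G k x y q).
  exact: is_deriveZ (is_derive_fiber_metric E_smooth F_smooth G_smooth g_posdef k x y Uq).
have DC x y z : is_derive q (e_ k) (C x y z) (partial k (C x y z) q).
  exact: (is_derive_christoffel U_open E_smooth F_smooth G_smooth g_posdef).
have D0 (x : R) : is_derive q (e_ k) (cst x) 0 by exact: is_derive_cst.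
rewrite mxE /conn /dconn.
by case: (ord3P a) => ->; case: (ord3P b) => -> /=.
Qed.

Lemma is_derive_gram_mx k q : U q ->
  is_derive q (e_ k) gram_mx (\matrix_(a, b) dgram k a b q).
Proof.
move=> Uq; apply/is_derive_mxP => a b.
have -> : (fun y => gram_mx y a b) = gram a b.
  by apply/funext => y; rewrite mxE.
have Dg x y : is_derive q (e_ k) (fun q => g q x y) (dmetric E F G k x y q).
  exact: (is_derive_fiber_metric E_smooth F_smooth G_smooth g_posdef k x y Uq).
have D0 (x : R) : is_derive q (e_ k) (cst x) 0 by exact: is_derive_cst.
rewrite mxE /gram /dgram.
by case: (ord3P a) => ->; case: (ord3P b) => -> /=.
Qed.

(** The prescribed Gram matrix solves the equation that the system induces on w w^T. The tangent
    block is metric compatibility; the mixed entries cancel because K^-1 times K g is g. *)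
Lemma gram_mx_parallel k q : U q -> \matrix_(a, b) dgram k a b q =
  connection k q *m gram_mx q + gram_mx q *m (connection k q)^T.
Proof.
move=> Uq; have K0 : K != 0 by rewrite gt_eqF.
have gsym : g q 1 0 = g q 0 1 by exact: fiber_metric_sym.
have csym l : C l 1 0 q = C l 0 1 q by exact: christoffel_sym.
apply/matrixP => a b; rewrite !mxE !sum_ord3 !mxE /dgram /gram /conn.
case: (ord3P a) => ->; case: (ord3P b) => -> /=; rewrite /cst /dmetric;
  move: csym gsym; rewrite -/g -/C;
  move: (C) (g q) => c gq csym gsym; rewrite ?sum_ord2;
  case: (ord2P k) => -> /=; rewrite ?csym ?gsym; by [ring | field].
Qed.

(** Row 0 and column 0 vanish by the symmetries of [g] and of the Christoffel symbols and by metric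
    compatibility. The remaining block compares the Riemann tensor of [g] with that of a sphere of
    curvature [K], and vanishes by [riemann_surface]. *)
Lemma connection_flat01 q : U q ->
  \matrix_(a, b) dconn 0 1 a b q - \matrix_(a, b) dconn 1 0 a b q
   + connection 1 q *m connection 0 q - connection 0 q *m connection 1 q = 0.
Proof.
move=> Uq.
have gsym : g q 1 0 = g q 0 1 by exact: fiber_metric_sym.
have csym l : C l 1 0 q = C l 0 1 q by exact: christoffel_sym.
have := riemann_surface U_open E_smooth F_smooth G_smooth g_posdef Uq.
rewrite -/g (g_curvature Uq).
have [<- <- _ <-] := fiber_metricE E F G q.
rewrite /riemann -/g -/C => -[r00 r10 r01 r11].
rewrite /connection /dconn /conn /dmetric -/g -/C.
move: r00 r10 r01 r11 gsym csym; move: (C) (@partial R) (g) => c P h.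
rewrite !sum_ord2 => r00 r10 r01 r11 gsym csym.
apply/matrixP => a b; rewrite !mxE !sum_ord3 !mxE.
case: (ord3P a) => ->; case: (ord3P b) => -> /=; rewrite /cst ?sum_ord2;
  rewrite ?csym ?gsym in r00 r10 r01 r11 *; lra.
Qed.

Lemma connection_flat q i j : U q ->
  'D_(e_ i) (connection j) q - 'D_(e_ j) (connection i) q
   + connection j q *m connection i q - connection i q *m connection j q = 0.
Proof.
move=> Uq; have D k l : 'D_(e_ k) (connection l) q = \matrix_(a, b) dconn k l a b q.
  by have [] := is_derive_connection k l Uq.
have flat01 : 'D_(e_ 0) (connection 1) q - 'D_(e_ 1) (connection 0) q
   + connection 1 q *m connection 0 q - connection 0 q *m connection 1 q = 0.
  apply: etrans (connection_flat01 Uq); congr (_ + _ - _).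
  exact: (f_equal2 (fun x y => x - y) (D 0 1) (D 1 0)).
have [ij|ij] := eqVneq i j; first by rewrite ij subrr add0r subrr.
have [[-> ->]|[-> ->]] : (i = 0 /\ j = 1) \/ (i = 1 /\ j = 0) by
  move: ij; case: (ord2P i) => ->; case: (ord2P j) => -> //; [left|right].
  exact: flat01.
rewrite -[RHS]oppr0 -flat01.
move: ('D_(e_ 0) (connection 1) q) ('D_(e_ 1) (connection 0) q) => x y.
move: (connection 1 q *m connection 0 q) (connection 0 q *m connection 1 q) => z t.
by apply/matrixP => a b; rewrite !mxE; ring.
Qed.

(** A Cholesky factor, which serves as initial value of the frame. *)
Lemma gram_mx_factor q : U q -> exists w0 : 'M[R]_3, w0 *m w0^T = gram_mx q.
Proof.
move=> Uq; have [E0 G0 D0] := fiber_metric_det_gt0 g_posdef Uq.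
have [gE gF gF' gG] := fiber_metricE E F G q.
pose rK := Num.sqrt K^-1; pose rE := Num.sqrt (E q).
pose rD := Num.sqrt ((E q * G q - F q ^+ 2) / E q).
have rK2 : rK * rK = K^-1 by rewrite -expr2 sqr_sqrtr// invr_ge0 ltW.
have rE2 : rE * rE = E q by rewrite -expr2 sqr_sqrtr// ltW.
have rE0 : rE != 0 by rewrite sqrtr_eq0 -ltNge.
have rD2 : rD * rD = (E q * G q - F q ^+ 2) / E q.
  by rewrite -expr2 sqr_sqrtr// divr_ge0// ltW.
exists (\matrix_(a, b) nth 0 (nth [::] [:: [:: rK; 0; 0]; [:: 0; rE; 0];
  [:: 0; F q / rE; rD]] a) b).
apply/matrixP => a b; rewrite !mxE sum_ord3 !mxE /gram.
case: (ord3P a) => ->; case: (ord3P b) => -> /=;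
  rewrite ?gE ?gF ?gF' ?gG ?(mul0r, mulr0, add0r, addr0)//.
- by rewrite mulrC divfK.
- by rewrite divfK.
- rewrite rD2 mulrACA -invfM rE2; field.
  by rewrite gt_eqF.
Qed.

Lemma is_derive_trmx (V : normedModType R) m n (A : V -> 'M[R]_(m, n)) x v dA :
  is_derive x v A dA -> is_derive x v (fun y => (A y)^T) dA^T.
Proof.
move=> /is_derive_mxP h; apply/is_derive_mxP => i j; rewrite mxE.
by rewrite (_ : (fun y => _) = (fun y => A y j i)); [exact: h|apply/funext => y; rewrite mxE].
Qed.

Lemma Ck_trmx (V : normedModType R) m n k (D : set V) (A : V -> 'M[R]_(m, n)) :
  open D -> Ck k D A -> Ck k D (fun y => (A y)^T).
Proof.
move=> oD /(Ck_mxP _ _ oD) CA; apply/Ck_mxP => // i j.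
by apply: (Ck_eq (f := fun y => A y j i)) => // y _; rewrite mxE.
Qed.

(** The defect obeys a homogeneous linear equation, so a Gronwall argument propagates its vanishing
    from one point. *)
Lemma is_derive_gram_defect (V : normedModType R) n (w T : V -> 'M[R]_n) (A : 'M[R]_n) x v :
  is_derive x v w (A *m w x) -> is_derive x v T (A *m T x + T x *m A^T) ->
  is_derive x v (fun y => w y *m (w y)^T - T y)
    (A *m (w x *m (w x)^T - T x) + (w x *m (w x)^T - T x) *m A^T).
Proof.
move=> hw hT.
apply: (is_derive_eq (is_deriveB (is_derive_mulmx hw (is_derive_trmx hw)) hT)).
rewrite mulmxBr mulmxBl trmx_mul !mulmxA.
move: (A *m w x *m (w x)^T) (w x *m (w x)^T *m A^T) => y z.
move: (A *m T x) (T x *m A^T) => s t.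
by apply/matrixP => a b; rewrite !mxE; ring.
Qed.

Lemma frame_exists q0 : U q0 -> exists2 r, 0 < r &
  exists w : 'rV[R]_2 -> 'M[R]_3, [/\ forall q, ball q0 r q -> U q,
    smooth_on (ball q0 r) w,
    forall q v, ball q0 r q -> 'D_v w q = \sum_i v 0 i *: (connection i q *m w q) &
    forall q, ball q0 r q -> w q *m (w q)^T = gram_mx q].
Proof.
move=> Uq0; have A_C2 i : Ck 2 U (connection i) by exact: connection_smooth.
have [w0 w0E] := gram_mx_factor Uq0.
have [r1 r10 [w [wq0 wP]]] := frobenius U_open Uq0 A_C2 connection_flat w0.
have [rho rho0 [B B0 bnd]] := connection_bounds U_open Uq0 A_C2.
pose r2 := Num.min r1 rho; have r20 : 0 < r2 by rewrite lt_min r10.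
have ballE r q : ball q0 r q <-> `|q - q0| < r.
  by rewrite -ball_normE /ball_/= distrC.
have in1 q : `|q - q0| < r2 -> `|q - q0| < r1 by rewrite lt_min => /andP[].
have U2 q : `|q - q0| < r2 -> U q by move=> /in1 /wP [].
have Dw q v : `|q - q0| < r2 -> 'D_v w q = \sum_i v 0 i *: (connection i q *m w q).
  by move=> /in1 /wP [].
have w_smooth : smooth_on (ball q0 r2) w.
  apply: (total_system_smooth (A := connection)) => [|i|q|q v].
  - exact: ball_open.
  - by move=> k; apply: Ck_sub (connection_smooth i k) => q /ballE /U2.
  - by move=> /ballE /in1 /wP [].
  - by move=> /ballE; exact: Dw.
have oB : open (ball q0 r2) by exact: ball_open.
pose Q q := w q *m (w q)^T - gram_mx q.
have CQ : Ck 1 (ball q0 r2) Q.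
  apply: CkD => //; first by apply: Ck_mulmx => //; apply: Ck_trmx.
  by apply: CkN => //; apply: Ck_sub (gram_mx_smooth 1) => q /ballE /U2.
have dQ q : `|q - q0| < r2 -> differentiable Q q.
  by move=> /ballE Bq; have [+ _] := CQ; apply.
have DQ q i : `|q - q0| < r2 -> 'D_(e_ i) Q q =
    connection i q *m Q q + Q q *m (connection i q)^T.
  move=> qr; have Uq := U2 q qr.
  have hw : is_derive q (e_ i) w (connection i q *m w q).
    apply: is_derive_eq; first by apply: smooth_is_derive w_smooth _; apply/ballE.
    apply: (etrans (Dw q (e_ i) qr)).
    rewrite (bigD1 i)//= mxE !eqxx/= scale1r big1 ?addr0// => j ji.
    by rewrite mxE (negbTE ji) andbF scale0r.
  have hT := is_derive_gram_mx i Uq; rewrite gram_mx_parallel// in hT.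
  by have [] := is_derive_gram_defect hw hT.
(* The 2 counts coordinate directions; the 6 comes from two products of 3 by 3 matrices, each
   costing a factor 3 in [mx_norm_mul]. *)
have Q_le q v : `|q - q0| < r2 -> `|'D_v Q q| <= 2 * (6 * B) * `|v| * `|Q q|.
  move=> qr; rewrite derive_sum_coord; last exact: dQ.
  have -> : 2 * (6 * B) * `|v| * `|Q q| = 2%:R * (6 * B * `|Q q|) * `|v| by ring.
  apply: norm_sum_coord_le => [|i]; first by rewrite !mulr_ge0.
  rewrite DQ//.
  have Bi : `|connection i q| <= B.
    have : `|q - q0| < rho by move: qr; rewrite lt_min => /andP[].
    by move=> /bnd [_ /(_ i) + _ _]; rewrite addrC subrK.
  apply: le_trans (ler_normD _ _) _.
  have -> : 6 * B * `|Q q| = 3%:R * B * `|Q q| + 3%:R * `|Q q| * B by ring.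
  apply: lerD; apply: le_trans (mx_norm_mul _ _) _; rewrite ?mx_norm_tr.
    by rewrite ler_wpM2r// ler_wpM2l.
  by rewrite ler_wpM2l// mulr_ge0.
have Q0 : Q q0 = 0 by rewrite /Q wq0 w0E subrr.
have c0 : 0 <= 2 * (6 * B) by rewrite !mulr_ge0.
have [r /andP[r0 rr2] Qr] := differential_gronwall_zero r20 c0 dQ Q_le Q0.
have in2 q : ball q0 r q -> `|q - q0| < r2 by move=> /ballE /lt_le_trans; apply.
exists r => //; exists w; split.
- by move=> q /in2 /U2.
- by move=> k; apply: Ck_sub (w_smooth k) => q /in2 /ballE.
- by move=> q v /in2; exact: Dw.
- by move=> q /ballE /Qr /eqP; rewrite subr_eq0 => /eqP.
Qed.

(** [y] is row 0 of the frame. Row 0 of the connection says that the other two rows are its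
    derivatives, so the Gram matrix contains all three properties. *)
Lemma local_isometry_to_sphere q0 : U q0 -> exists2 r, 0 < r &
  exists y : 'rV[R]_2 -> 'rV[R]_3, [/\ forall q, ball q0 r q -> U q,
    smooth_on (ball q0 r) y & forall q, ball q0 r q ->
    [/\ dot (y q) (y q) = K^-1, forall v, dot (y q) ('D_v y q) = 0 &
      forall u v, dot ('D_u y q) ('D_v y q) = metric_form g q u v]].
Proof.
move=> Uq0; have [r r0 [w [Uw w_smooth Dw wwT]]] := frame_exists Uq0.
have oB : open (ball q0 r) by exact: ball_open.
have dot_row q a b : ball q0 r q -> dot (row a (w q)) (row b (w q)) = gram a b q.
  move=> Bq; transitivity ((w q *m (w q)^T) a b); last by rewrite wwT// mxE.
  by rewrite mxE; apply: eq_bigr => j _; rewrite !mxE.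
have Dy q v : ball q0 r q -> is_derive q v (fun q => row 0 (w q))
    (v 0 0 *: row 1 (w q) + v 0 1 *: row 2 (w q)).
  move=> Bq; have /is_derive_mxP hw := smooth_is_derive v w_smooth Bq.
  apply/is_derive_mxP => i b; rewrite ord1.
  rewrite (_ : (fun y => _) = (fun y => w y 0 b)); last first.
    by apply/funext => y; rewrite mxE.
  have rowE (W : 'M[R]_3) : (\sum_i v 0 i *: (connection i q *m W)) 0 b =
      (v 0 0 *: row 1 W + v 0 1 *: row 2 W) 0 b.
    rewrite sum_ord2 mxE [X in X + _ = _]mxE [X in _ + X = _]mxE !connection_row0.
    by rewrite /= !mxE !(mul0r, mul1r, add0r, addr0).
  apply: (is_derive_eq (hw 0 b)).
  exact: (etrans (congr1 (fun M : 'M[R]_3 => M 0 b) (Dw q v Bq)) (rowE (w q))).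
exists r => //; exists (fun q => row 0 (w q)); split=> //.
  move=> k; apply/Ck_mxP => // i b.
  have := (Ck_mxP k w oB).1 (w_smooth k) 0 b.
  by apply: Ck_eq => // q _; rewrite mxE.
move=> q Bq; have D v : 'D_v (fun q => row 0 (w q)) q =
    v 0 0 *: row 1 (w q) + v 0 1 *: row 2 (w q) by have [] := Dy q v Bq.
split=> [|v|u v]; first exact: dot_row.
  by rewrite D dotDr !dotZr !dot_row//= !mulr0 addr0.
rewrite !D !dotDl !dotDr !dotZl !dotZr !dot_row//= /metric_form !sum_ord2.
change (gram 1 1 q) with (g q 0 0); change (gram 1 2 q) with (g q 0 1).
change (gram 2 1 q) with (g q 1 0); change (gram 2 2 q) with (g q 1 1).
by move: (g q) => A; ring.
Qed.

End MovingFrame.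

(** * Rotation embedding *)

Lemma is_derive_translate {R : realType} (V W : normedModType R) (a : V -> W) c x v da :
  is_derive (c + x) v a da -> is_derive x v (fun y => a (c + y)) da.
Proof.
move=> [h1 h2]; pose b h := h^-1 *: (((fun y => a (c + y)) \o shift x) (h *: v) - a (c + x)).
have E : (fun h => h^-1 *: ((a \o shift (c + x)) (h *: v) - a (c + x))) = b.
  by apply/funext => h; rewrite /b /= addrCA.
rewrite /derivable E in h1; rewrite /derive E in h2.
exact: DeriveDef.
Qed.

(** [is_derive_primitive] asks for continuity on the whole line: [c] sends the line into a compact
    interval around [t0] inside [I], and is a translation near 0. *)
Lemma local_primitive {R : realType} (I : set R) (a : R -> R) t0 : open I -> I t0 ->
  (forall t, I t -> {for t, continuous a}) ->
  exists2 d, 0 < d & exists H : R -> R, forall t, `|t - t0| < d ->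
    I t /\ is_derive t 1 H (a t).
Proof.
move=> oI It0 ac; have : \forall t \near t0, I t by exact: open_nbhs_nbhs.
move=> /nbhs_normP[r /= r0 hr].
(* d < r keeps the values of [c] in [I]; d <= 1/2 keeps t - t0 above -1, where [primitive] is
   differentiable. *)
pose d := Num.min (r / 2) (2^-1).
have d0 : 0 < d by rewrite lt_min divr_gt0//= invr_gt0.
have dr : d < r.
  by apply: (@le_lt_trans _ _ (r / 2)); [rewrite ge_min lexx|rewrite ltr_pdivrMr// ltr_pMr// ltr1n].
have d1 : d <= 2^-1 by rewrite ge_min lexx orbT.
pose c (s : R) : R := t0 - d + 2 * d * clamp ((s + d) / (2 * d)).
have cc : continuous c.
  move=> s; apply: (@continuousD _ _ _ (cst (t0 - d)) (fun s => 2 * d * clamp ((s + d) / (2 * d)))).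
    exact: cst_continuous.
  apply: (@continuousM _ _ (cst (2 * d)) (fun s => clamp ((s + d) / (2 * d)))).
    exact: cst_continuous.
  apply: (@continuous_comp _ _ _ (fun s => (s + d) / (2 * d)) clamp); last exact: clamp_continuous.
  apply: (@continuousM _ _ (fun s => s + d) (cst (2 * d)^-1)); last exact: cst_continuous.
  apply: (@continuousD _ _ _ id (cst d)); last exact: cst_continuous.
  exact: cvg_id.
have Ic s : I (c s).
  apply: hr; rewrite /ball_/= /c; have /andP[x0 x1] := clamp_itv ((s + d) / (2 * d)).
  move: (clamp _) x0 x1 => x x0 x1; apply: le_lt_trans dr.
  have h0 : 0 <= d * x by rewrite mulr_ge0// ltW.
  have h1 : d * x <= d by rewrite ler_piMr// ltW.
  by rewrite ler_norml; apply/andP; split; lra.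
have cE t : `|t - t0| < d -> c (t - t0) = t.
  rewrite ltr_norml => /andP[h1 h2]; rewrite /c clamp_id.
    by field; rewrite gt_eqF.
  have D0 : 0 < 2 * d by rewrite mulr_gt0.
  apply/andP; split; first by apply: divr_ge0; [move: h1; lra|exact: ltW].
  by rewrite ler_pdivrMr// mul1r; lra.
exists d => //; exists (fun t => primitive (a \o c) (- t0 + t)) => t td.
have tE : - t0 + t = t - t0 by rewrite addrC.
split; first by rewrite -(cE t td); exact: Ic.
rewrite -{2}(cE t td) -tE; apply: is_derive_translate.
apply: (@is_derive_primitive R (a \o c)).
  by move=> s; apply: continuous_comp; [exact: cc|apply: ac; exact: Ic].
by move: td; rewrite tE ltr_norml => /andP[h1 h2]; move: h1 d1; lra.
Qed.

Lemma smooth_of_derivative {R : realType} (D : set R) (H a : R -> R) : open D ->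
  (forall t, D t -> is_derive t 1 H (a t)) -> smooth_on D a -> smooth_on D H.
Proof.
move=> oD HD Ca; have dH t : D t -> differentiable H t.
  by move=> /HD [h _]; apply/derivable1_diffP.
elim=> [|k _]; first by move=> t /dH; exact: differentiable_continuous.
split=> // v; apply: (Ck_eq (f := fun t => v * a t)) => // [t Dt|].
  rewrite deriveE; last exact: dH.
  rewrite -[v in RHS]mulr1 -[v * 1]/(v *: (1 : R)) linearZ/= -deriveE; last exact: dH.
  by have [_ ->] := HD t Dt.
by apply: (CkM (f := fun=> v)) => //; exact: Ck_cst.
Qed.

Lemma is_derive_scale {R : realType} (W : normedModType R) (a : R -> W) t s :
  differentiable a t -> is_derive t s a (s *: 'D_1 a t).
Proof.
move=> da; have -> : s *: 'D_1 a t = 'D_s a t; last exact: is_derive_diff.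
by rewrite !deriveE// -linearZ /= [s *: 1]mulr1.
Qed.

(** Determinant over trace is a lower bound for the eigenvalues: by Cayley-Hamilton the trace times
    the form, minus the determinant times the squared Euclidean norm of [u], is the squared
    Euclidean norm of g u, the two squares used at the end. *)
Lemma metric_form_lower {R : realType} (E F G : 'rV[R]_2 -> R) q :
  0 < E q -> 0 < G q -> 0 < E q * G q - F q ^+ 2 ->
  exists2 m, 0 < m & forall u, m * `|u| ^+ 2 <= metric_form (fiber_metric E F G) q u u.
Proof.
move=> E0 G0 D0; have EG : 0 < E q + G q by rewrite addr_gt0.
exists ((E q * G q - F q ^+ 2) / (E q + G q)); first by rewrite divr_gt0.
move=> u; rewrite /metric_form !sum_ord2; have [-> -> -> ->] := fiber_metricE E F G q.
rewrite mulrAC ler_pdivrMr//.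
have un : `|u| ^+ 2 <= u 0 0 ^+ 2 + u 0 1 ^+ 2.
  have ent i : `|u 0 i| ^+ 2 <= u 0 0 ^+ 2 + u 0 1 ^+ 2.
    rewrite real_normK ?num_real//.
    by case: (ord2P i) => ->; rewrite ?lerDl ?lerDr sqr_ge0.
  have [->|u0] := eqVneq u 0; first by rewrite normr0 expr0n/= addr_ge0// sqr_ge0.
  have : mx_norm u != 0 by rewrite -[mx_norm u]/(`|u|) normr_eq0.
  move=> /mx_norm_neq0 [[i j] /=]; rewrite ord1 -[mx_norm u]/(`|u|) => ->.
  exact: ent.
apply: (@le_trans _ _ ((E q * G q - F q ^+ 2) * (u 0 0 ^+ 2 + u 0 1 ^+ 2))).
  by rewrite ler_pM2l.
have := sqr_ge0 (E q * u 0 0 + F q * u 0 1); have := sqr_ge0 (F q * u 0 0 + G q * u 0 1).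
lra.
Qed.

Lemma dot_le_norm {R : realType} n (z : 'rV[R]_n) : dot z z <= n%:R * `|z| ^+ 2.
Proof.
rewrite /dot (le_trans (ler_sum _ (G := fun=> `|z| ^+ 2) _))//; last first.
  by rewrite sumr_const card_ord mulr_natl.
move=> i _; rewrite -expr2 -[leLHS]real_normK ?num_real//.
by rewrite ler_pXn2r ?nnegrE// mx_entry_le.
Qed.

Section SphericalWarpedProduct.
Context {R : realType}.
Variables (I : set R) (B : set 'rV[R]_2) (f : R -> R) (E F G : 'rV[R]_2 -> R) (K : R).
Variables (y : 'rV[R]_2 -> 'rV[R]_3) (H : R -> R).
Let g := fiber_metric E F G.
Let h t := Num.sqrt (1 - 'D_1 f t ^+ 2 / K).
Hypothesis I_open : open I.
Hypothesis B_open : open B.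
Hypothesis f_smooth : smooth_on I f.
Hypothesis f_gt0 : forall t, I t -> 0 < f t.
Hypothesis K_gt0 : 0 < K.
Hypothesis f_lt : forall t, I t -> 'D_1 f t ^+ 2 < K.
Hypothesis g_det : forall q, B q ->
  [/\ 0 < E q, 0 < G q & 0 < E q * G q - F q ^+ 2].
Hypothesis y_smooth : smooth_on B y.
Hypothesis y_sphere : forall q, B q -> dot (y q) (y q) = K^-1.
Hypothesis y_tangent : forall q v, B q -> dot (y q) ('D_v y q) = 0.
Hypothesis y_iso : forall q u v, B q -> dot ('D_u y q) ('D_v y q) = metric_form g q u v.
Hypothesis H_smooth : smooth_on I H.
Hypothesis H_der : forall t, I t -> is_derive t 1 H (h t).
Let N : set (R * 'rV[R]_2) := I `*` B.

(* [dot (y q) (y q) = 1/K] and H' = h make the dx_1^2 coefficient f'^2/K + h^2 = 1. *)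
Definition rotation_embedding (p : R * 'rV[R]_2) : 'rV[R]_4 :=
  \row_j nth 0 [:: f p.1 * y p.2 0 0; f p.1 * y p.2 0 1; f p.1 * y p.2 0 2; H p.1] j.
Let X := rotation_embedding.

Let N_open : open N.
Proof. exact: open_prod_set. Qed.

Lemma ord4P (j : 'I_4) : [\/ j = 0, j = 1, j = 2 | j = 3].
Proof.
by case: j => [[|[|[|[|//]]]] hj]; [apply: Or41|apply: Or42|apply: Or43|apply: Or44];
  apply: val_inj.
Qed.

Lemma rotation_embedding_smooth : smooth_on N X.
Proof.
have Cfst (a : R -> R) k : Ck k I a -> Ck k N (fun p : R * 'rV[R]_2 => a p.1).
  move=> Ca; have fc : continuous (@fst R 'rV[R]_2) by move=> p; exact: cvg_fst.
  have := Ck_comp_linear (l := @fst R 'rV[R]_2) fc Ca.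
  by apply: Ck_sub => p [].
have Csnd (a : 'rV[R]_2 -> R) k : Ck k B a -> Ck k N (fun p : R * 'rV[R]_2 => a p.2).
  move=> Ca; have fc : continuous (@snd R 'rV[R]_2) by move=> p; exact: cvg_snd.
  have := Ck_comp_linear (l := @snd R 'rV[R]_2) fc Ca.
  by apply: Ck_sub => p [].
have oN := N_open.
move=> k; apply/Ck_mxP => // i j; rewrite ord1.
have Cy b : Ck k N (fun p : R * 'rV[R]_2 => f p.1 * y p.2 0 b).
  apply: CkM => //; first exact: Cfst.
  by apply: (Csnd (fun q => y q 0 b)); have := (Ck_mxP k y B_open).1 (y_smooth k) 0 b.
apply: (Ck_eq (f := fun p : R * 'rV[R]_2 =>
  nth 0 [:: f p.1 * y p.2 0 0; f p.1 * y p.2 0 1; f p.1 * y p.2 0 2; H p.1] j)) => //.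
  by move=> p _; rewrite mxE.
by case: (ord4P j) => -> //=; exact: Cfst.
Qed.

Lemma rotation_embedding_derive p v : N p -> 'D_v X p = \row_j nth 0
  [:: v.1 * 'D_1 f p.1 * y p.2 0 0 + f p.1 * 'D_(v.2) y p.2 0 0;
      v.1 * 'D_1 f p.1 * y p.2 0 1 + f p.1 * 'D_(v.2) y p.2 0 1;
      v.1 * 'D_1 f p.1 * y p.2 0 2 + f p.1 * 'D_(v.2) y p.2 0 2;
      v.1 * h p.1] j.
Proof.
move=> [Ip Bp].
have df : differentiable f p.1 by have [+ _] := f_smooth 1; apply.
have dH : differentiable H p.1 by have [+ _] := H_smooth 1; apply.
have hf := @is_derive_comp_linear _ _ _ _ (@fst R 'rV[R]_2) f p v _ (is_derive_scale v.1 df).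
have hH := @is_derive_comp_linear _ _ _ _ (@fst R 'rV[R]_2) H p v _ (is_derive_scale v.1 dH).
have hy b : is_derive p v (fun p : R * 'rV[R]_2 => y p.2 0 b) ('D_(v.2) y p.2 0 b).
  have /is_derive_mxP/(_ 0 b) := smooth_is_derive v.2 y_smooth Bp.
  exact: (@is_derive_comp_linear _ _ _ _ (@snd R 'rV[R]_2) (fun q => y q 0 b)).
suff [] : is_derive p v X (\row_j nth 0
  [:: v.1 * 'D_1 f p.1 * y p.2 0 0 + f p.1 * 'D_(v.2) y p.2 0 0;
      v.1 * 'D_1 f p.1 * y p.2 0 1 + f p.1 * 'D_(v.2) y p.2 0 1;
      v.1 * 'D_1 f p.1 * y p.2 0 2 + f p.1 * 'D_(v.2) y p.2 0 2;
      v.1 * h p.1] j) by [].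
apply/is_derive_mxP => i j; rewrite ord1 mxE.
have -> : (fun p => X p 0 j) = fun p =>
  nth 0 [:: f p.1 * y p.2 0 0; f p.1 * y p.2 0 1; f p.1 * y p.2 0 2; H p.1] j.
  by apply/funext => z; rewrite mxE.
have hfy b : is_derive p v (fun p : R * 'rV[R]_2 => f p.1 * y p.2 0 b)
    (v.1 * 'D_1 f p.1 * y p.2 0 b + f p.1 * 'D_(v.2) y p.2 0 b).
  apply: (is_derive_eq (is_deriveM hf (hy b))).
  by rewrite addrC; congr (_ + _); rewrite mulrC.
have Hh : 'D_1 H p.1 = h p.1 by have [] := H_der Ip.
rewrite Hh in hH.
by case: (ord4P j) => -> /=.
Qed.

Lemma rotation_embedding_iso p v w : N p ->
  dot ('d X p v) ('d X p w) = warped_metric f g p v w.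
Proof.
move=> Np; have [Ip Bp] := Np.
have dX : differentiable X p by have [+ _] := rotation_embedding_smooth 1; apply.
have -> : 'd X p v = 'D_v X p by rewrite deriveE.
have -> : 'd X p w = 'D_w X p by rewrite deriveE.
rewrite (rotation_embedding_derive v Np) (rotation_embedding_derive w Np).
have h2 : h p.1 * h p.1 = 1 - 'D_1 f p.1 ^+ 2 / K.
  by rewrite -expr2 sqr_sqrtr// subr_ge0 ler_pdivrMr// mul1r ltW// f_lt.
have := y_sphere Bp; have := y_tangent v.2 Bp; have := y_tangent w.2 Bp.
have := y_iso v.2 w.2 Bp; rewrite /warped_metric.
move: ('D_(v.2) y p.2) ('D_(w.2) y p.2) (metric_form g p.2 v.2 w.2) => a b m.
move: ('D_1 f p.1) (h p.1) h2 => f1 hh h2.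
have dot3 (s t : 'rV[R]_3) : dot s t = s 0 0 * t 0 0 + s 0 1 * t 0 1 + s 0 2 * t 0 2.
  rewrite /dot !big_ord_recl big_ord0 addr0 !addrA.
  by congr (_ * _ + _ * _ + _ * _); congr (_ 0 _); exact: val_inj.
have -> : dot (\row_j nth 0 [:: v.1 * f1 * y p.2 0 0 + f p.1 * a 0 0;
    v.1 * f1 * y p.2 0 1 + f p.1 * a 0 1; v.1 * f1 * y p.2 0 2 + f p.1 * a 0 2; v.1 * hh] j)
  (\row_(j < 4) nth 0 [:: w.1 * f1 * y p.2 0 0 + f p.1 * b 0 0;
    w.1 * f1 * y p.2 0 1 + f p.1 * b 0 1; w.1 * f1 * y p.2 0 2 + f p.1 * b 0 2; w.1 * hh] j)
  = v.1 * w.1 * f1 ^+ 2 * dot (y p.2) (y p.2) + v.1 * f1 * f p.1 * dot (y p.2) b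
   + w.1 * f1 * f p.1 * dot (y p.2) a + f p.1 ^+ 2 * dot a b + v.1 * w.1 * (hh * hh).
  rewrite !dot3 /dot !big_ord_recl big_ord0 !mxE /=; ring.
move=> -> -> -> ->; rewrite h2; field.
by rewrite gt_eqF.
Qed.

Lemma rotation_embedding_diff_lower p : N p -> exists2 c, 0 < c &
  forall v, c * `|v| <= `|'d X p v|.
Proof.
move=> Np; have [Ip Bp] := Np; have [E0 G0 D0] := g_det Bp.
have [m m0 hm] := metric_form_lower E0 G0 D0.
have fm0 : 0 < f p.1 ^+ 2 * m by rewrite mulr_gt0// exprn_gt0// f_gt0.
(* 1 comes from the base direction, f^2 m from the fiber; capping at 1 also gives c^2 <= c, used
   below. *)
pose c := Num.min 1 (f p.1 ^+ 2 * m).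
have c0 : 0 < c by rewrite lt_min ltr01.
have c1 : c <= 1 by rewrite ge_min lexx.
have c2 : c <= f p.1 ^+ 2 * m by rewrite ge_min lexx orbT.
(* Halved because the Euclidean norm on R^4 is at most twice the maximum norm. *)
exists (c / 2); first by rewrite divr_gt0.
move=> v; have iso := rotation_embedding_iso v v Np.
have up := dot_le_norm ('d X p v); rewrite iso in up.
have low : c * `|v| ^+ 2 <= warped_metric f g p v v.
  apply: (@le_trans _ _ (v.1 ^+ 2 + f p.1 ^+ 2 * m * `|v.2| ^+ 2)); last first.
    by rewrite /warped_metric -expr2 lerD2l -mulrA ler_wpM2l ?sqr_ge0.
  rewrite [`|v|]prod_normE /Num.max; case: ifP => _.
    apply: (@le_trans _ _ (f p.1 ^+ 2 * m * `|v.2| ^+ 2)); last by rewrite lerDr sqr_ge0.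
    by rewrite ler_wpM2r// exprn_ge0.
  rewrite real_normK ?num_real//; apply: (@le_trans _ _ (v.1 ^+ 2)).
    by rewrite ler_piMl// sqr_ge0.
  by rewrite lerDl mulr_ge0// ?exprn_ge0// ltW.
have cv : (c * `|v|) ^+ 2 <= (2 * `|'d X p v|) ^+ 2.
  apply: (@le_trans _ _ (c * `|v| ^+ 2)).
    by rewrite exprMn ler_wpM2r ?exprn_ge0// expr2 ler_piMl// ltW.
  apply: (le_trans low); apply: (le_trans up); rewrite exprMn; lra.
have cv' : c * `|v| <= 2 * `|'d X p v|.
  by move: cv; rewrite ler_pXn2r// nnegrE mulr_ge0// ltW.
move: cv'; lra.
Qed.

Lemma rotation_embedding_isometric p0 : N p0 -> exists N' : set (R * 'rV[R]_2),
  [/\ open N', N' p0, N' `<=` N & isometric_embedding N' (warped_metric f g) X].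
Proof.
move=> Np0; have [c c0 hc] := rotation_embedding_diff_lower Np0.
have [N' [oN' N'p0 N'N psi]] :=
  local_left_inverse N_open Np0 (rotation_embedding_smooth 1) c0 hc.
exists N'; split=> //; split; last by move=> p /N'N Np v w; exact: rotation_embedding_iso.
split=> //.
  by move=> k; apply: Ck_sub (rotation_embedding_smooth k).
move=> p /N'N Np v w vw; have [c' c'0 hc'] := rotation_embedding_diff_lower Np.
apply/eqP; rewrite -subr_eq0 -normr_le0 -(pmulr_rle0 _ c'0).
by apply: le_trans (hc' _) _; rewrite linearB vw subrr normr0.
Qed.

End SphericalWarpedProduct.

Lemma warped_local_embedding (R : realType) (I : set R) (U : set 'rV[R]_2)
    (f : R -> R) (E F G : 'rV[R]_2 -> R) (K : R) :
  open I -> open U -> smooth_on I f -> (forall x, I x -> 0 < f x) ->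
  smooth_on U E -> smooth_on U F -> smooth_on U G ->
  (forall q, U q -> forall u : 'rV[R]_2, u != 0 ->
    0 < metric_form (fiber_metric E F G) q u u) ->
  0 < K -> (forall q, U q -> gauss_curvature (fiber_metric E F G) q = K) ->
  (forall x, I x -> 'D_1 f x ^+ 2 < K) ->
  locally_isometrically_embeddable 4 (I `*` U) (warped_metric f (fiber_metric E F G)).
Proof.
move=> oI oU Cf f0 CE CF CG gpos K0 curv fK [t0 q0] [/= It0 Uq0].
have [r r0 [y [BU Cy yP]]] := local_isometry_to_sphere oU CE CF CG gpos K0 curv Uq0.
pose h t := Num.sqrt (1 - 'D_1 f t ^+ 2 / K).
(* The strict inequality [fK] keeps the radicand positive, where the square root is smooth. *)
have Ch : smooth_on I h.
  move=> k; apply: Ck_sqrt => // [t It|].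
    by rewrite subr_gt0 ltr_pdivrMr// mul1r fK.
  apply: (CkD oI (Ck_cst k I (1 : R))).
  apply: CkN => //; apply: (CkM oI _ (Ck_cst k I (K^-1 : R))).
  by apply: CkM => //; apply: smooth_derive.
have [d d0 [H HP]] := local_primitive oI It0 (fun t It => Ck_continuous (Ch 0%N) It).
have ballE t : ball t0 d t -> `|t - t0| < d by rewrite -ball_normE /ball_/= distrC.
have sub t : ball t0 d t -> I t by move=> /ballE /HP [].
have oB : open (ball t0 d) by exact: ball_open.
have HD t : ball t0 d t -> is_derive t 1 H (h t) by move=> /ballE /HP [].
have CH : smooth_on (ball t0 d) H.
  apply: (smooth_of_derivative oB HD) => k; exact: Ck_sub sub (Ch k).
have oB' : open (ball q0 r) by exact: ball_open.
have Cf' : smooth_on (ball t0 d) f by move=> k; exact: Ck_sub sub (Cf k).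
have [N [oN Np NB iso]] := rotation_embedding_isometric oB oB' Cf' (fun t Bt => f0 t (sub t Bt)) K0
  (fun t Bt => fK t (sub t Bt)) (fun q Bq => fiber_metric_det_gt0 gpos (BU q Bq))
  Cy (fun q Bq => let: And3 a _ _ := yP q Bq in a)
  (fun q v Bq => let: And3 _ b _ := yP q Bq in b v)
  (fun q u v Bq => let: And3 _ _ c := yP q Bq in c u v) CH HD
  (conj (ballxx t0 d0) (ballxx q0 r0) : (ball t0 d `*` ball q0 r) (t0, q0)).
exists N; split=> //; last by exists (rotation_embedding f y H).
by move=> p /NB [/sub ? /BU ?].
Qed.

Theorem theorem5p1 (R : realType) (I : set R) (U : set 'rV[R]_2)
    (f : R -> R) (E F G : 'rV[R]_2 -> R)
    (I_open : open I) (I_interval : is_interval I) (I_nonempty : I !=set0)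
    (U_open : open U) (U_connected : connected U) (U_nonempty : U !=set0)
    (f_smooth : smooth_on I f) (f_gt0 : forall x, I x -> 0 < f x)
    (E_smooth : smooth_on U E) (F_smooth : smooth_on U F)
    (G_smooth : smooth_on U G)
    (g_posdef : forall q, U q -> forall u : 'rV[R]_2, u != 0 ->
      0 < metric_form (fiber_metric E F G) q u u) :
  let g := fiber_metric E F G in
  let M := I `*` U in
  let ds2 := warped_metric f g in
  (isometrically_embeddable 4 M ds2 ->
     (forall x, I x -> f^`(2)%classic x != 0) ->
     exists K : R,
       [/\ 0 < K, forall q, U q -> gauss_curvature g q = K &
           forall x, I x -> K >= (f^`()%classic x) ^+ 2])
  /\
  (forall K : R, 0 < K ->
     (forall q, U q -> gauss_curvature g q = K) ->
     (forall x, I x -> K > (f^`()%classic x) ^+ 2) ->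
     locally_isometrically_embeddable 4 M ds2).
Proof.
move=> g M ds2.
have f1E : f^`()%classic = 'D_1 f by apply/funext => x; rewrite derive1E.
have f2E : f^`(2)%classic = 'D_1 ('D_1 f).
  by apply/funext => x; rewrite derive1nS derive1n1 derive1E f1E.
rewrite f1E f2E; split=> [[X [[CX _ _] iso]] f2_neq0|K K0 curv fK].
  exact: (warped_embedding_curvature I_open I_nonempty U_open U_connected U_nonempty
    f_smooth f_gt0 E_smooth F_smooth G_smooth g_posdef CX iso f2_neq0).
exact (warped_local_embedding I_open U_open f_smooth f_gt0 E_smooth F_smooth G_smooth
  g_posdef K0 curv fK).
Qed.
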